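(* Let $\{X(u,s): s\ge0,\ u\in[0,1]\}$ be an Arratia flow with zero drift and let $t\in(0,1]$ be fixed. Let $U^{(n)}=(u^{(n)}_1<\ldots<u^{(n)}_n)$, $n\ge2$, be vectors with $u^{(n)}_1=0$, $u^{(n)}_n=1$, with $\{u^{(n)}_1,\ldots,u^{(n)}_n\}\subset\{u^{(n+1)}_1,\ldots,u^{(n+1)}_{n+1}\}$ for all $n$, and $\lim_{n\to\infty}\max_{1\le j\le n-1}(u^{(n)}_{j+1}-u^{(n)}_j)=0$. Let $p^1_t$ be the $1$-point density of the flow started from $[0,1]$ and $p^1_t(U^{(n)};\cdot)$ the $1$-point density associated with the starting points $U^{(n)}$. Then there exists an absolute constant $C>0$ (independent of $n$, $y$ and of the choice of the vectors $U^{(n)}$) such that for all $n$ $$ 0\le p^1_t(y)-p^1_t(U^{(n)};y)\le C\max_{1\le j\le n-1}\left(u^{(n)}_{j+1}-u^{(n)}_j\right)^2 $$ for almost all $y\in\mathbb{R}$.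
   Context: Arratia flow with zero drift: a random field $\{X(u,s)\}$, nondecreasing in $u$, such that for any finite set of points $u_1,\ldots,u_m$ the processes $X(u_1,\cdot),\ldots,X(u_m,\cdot)$ are coalescing standard Brownian motions started at $u_1,\ldots,u_m$ (independent before meeting, moving together after meeting). Put $X_t=\{X(u,t):u\in[0,1]\}$. The $k$-point density $p^k_t$ of the flow is the measurable function on $\mathbb{R}^k$ such that for every bounded nonnegative measurable $f:\mathbb{R}^k\to\mathbb{R}$ $$\int_{\mathbb{R}^k}f(x)p^k_t(x)\,dx=\mathrm{E}\sum_{v_1,\ldots,v_k\in X_t,\ \text{all distinct}}f(v_1,\ldots,v_k)$$ (sum over ordered $k$-tuples of distinct points). Coalescence scheme: for $x=(x_1<\ldots<x_n)$, let $l$ be the number of distinct values among $X(x_1,t),\ldots,X(x_n,t)$. If $l=n$, $J_t(x)=\emptyset$. If $l<n$, start from the system $\mathcal{X}^n=(X(x_1,\cdot),\ldots,X(x_n,\cdot))$; let $\tau_1\le t$ be the first collision time and $j_1$ the smallest index of a coordinate participating in this collision; delete the $j_1$-th coordinate to get $\mathcal{X}^{n-1}$ (coordinates renumbered $1,\ldots,n-1$); repeat with $\mathcal{X}^{n-1}$ to get $j_2$, and so on, $n-l$ times. Then $J_t(x)=(j_1,\ldots,j_{n-l})$, where $j_i\in\{1,\ldots,n-i\}$. $\mathcal{J}_{n,r}$ denotes the set of all possible such collections consisting of $r$ numbers ($\mathcal{J}_{n,0}=\{\emptyset\}$). For $J\in\mathcal{J}_{n,n-l}$ and $k\le l$, the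 $k$-point density $p^{J,k}_t(x;\cdot)$ corresponding to $J$ and the start points $x$ is the measurable function on $\mathbb{R}^k$ such that for every bounded nonnegative measurable $f:\mathbb{R}^k\to\mathbb{R}$ $$\int_{\mathbb{R}^k}p^{J,k}_t(x;y)f(y)\,dy=\mathrm{E}\sum_{v_1,\ldots,v_k\in\{X(x_1,t),\ldots,X(x_n,t)\},\ \text{all distinct}}f(v_1,\ldots,v_k)\,\mathbf{1}(J_t(x)=J).$$ Finally, $p^k_t(U^{(n)};\cdot)=\sum_{i=k}^{n}\sum_{J\in\mathcal{J}_{n,n-i}}p^{J,k}_t(U^{(n)};\cdot)$, $1\le k\le n$.
   Formalization: The Arratia flow is taken to be right-continuous in u (the standard version); without this, extra values could be inserted at the random jump points of u ↦ X(u,t), so the range X_t and its density would not be determined and the upper bound would fail. *)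

(* Defs.v *)
From mathcomp Require Import all_boot all_order all_algebra.
From mathcomp Require Import all_classical all_reals all_analysis.

Set Implicit Arguments.
Unset Strict Implicit.
Unset Printing Implicit Defensive.
Import Order.TTheory GRing.Theory Num.Theory.
Import numFieldNormedType.Exports.
Local Open Scope classical_set_scope.
Local Open Scope ring_scope.

(** * Coalescing Brownian motions *)

(** Independent standard Brownian motions [W 0, ..., W (size u).-1], with [W i]
    started at [u`_i].  The last clause says at once that the increments are
    Gaussian and that they are independent, both over disjoint time intervals
    and over [i].  The second argument of [normal_prob] is the standard
    deviation. *)
Definition independent_BMs (R : realType) (d : measure_display)
    (T : measurableType d) (P : probability T R)
    (u : seq R) (W : nat -> R -> T -> R) : Prop :=
  [/\ forall i s, (i < size u)%N -> 0 <= s -> measurable_fun setT (W i s),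
      forall i w, (i < size u)%N -> W i 0 w = u`_i,
      forall i w, (i < size u)%N ->
        {within `[0, +oo[, continuous (fun s => W i s w)}
    & forall (N : nat) (s : nat -> R) (B : nat -> nat -> set R),
        0 <= s 0%N -> (forall k, (k < N)%N -> s k < s k.+1) ->
        (forall i k, measurable (B i k)) ->
        P [set w | forall i k, (i < size u)%N -> (k < N)%N ->
                     B i k (W i (s k.+1) w - W i (s k) w)]
        = (\prod_(0 <= i < size u) \prod_(0 <= k < N)
             normal_prob 0 (Num.sqrt (s k.+1 - s k)) (B i k))%E].

(** Coalescing system built from paths [w 0, w 1, ...] with increasing starting
    points: path [k.+1] follows [w k.+1] until it meets the (already coalesced)
    path [k], and moves together with it afterwards.  Continuous paths have to
    meet their left neighbour before any path further to the left.  For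
    independent Brownian motions the rule deciding which of the two driving
    motions is kept after a meeting does not affect the law. *)
Fixpoint coalesced (R : realType) (w : nat -> R -> R) (k : nat) (s : R) : R :=
  if k is k'.+1 then
    if `[< exists r : R, 0 <= r <= s /\ w k r = coalesced w k' r >]
    then coalesced w k' s
    else w k s
  else w 0%N s.

(** The processes [Y 0, ..., Y (size u).-1] have the finite-dimensional
    distributions of coalescing standard Brownian motions started at the points
    of the increasing sequence [u].  The driving motions live on a probability
    space of their own: the original one need not carry them, since the system
    [Y] does not see a driving motion after its coalescence. *)
Definition coalescing_BMs (R : realType) (d : measure_display)
    (T : measurableType d) (P : probability T R)
    (u : seq R) (Y : nat -> R -> T -> R) : Prop :=
  exists (d' : measure_display) (T' : measurableType d')
         (P' : probability T' R) (W : nat -> R -> T' -> R),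
    independent_BMs P' u W /\
    forall (N : nat) (i : nat -> nat) (s : nat -> R) (B : nat -> set R),
      (forall k, (k < N)%N -> (i k < size u)%N /\ 0 <= s k) ->
      (forall k, measurable (B k)) ->
      P [set w | forall k, (k < N)%N -> B k (Y (i k) (s k) w)]
      = P' [set w | forall k, (k < N)%N ->
                      B k (coalesced (fun j r => W j r w) (i k) (s k))].

(** Arratia flow with zero drift started from [0, 1]; [X u s w] is only
    meaningful for [0 <= u <= 1] and [0 <= s].  As usual the flow is the
    right-continuous version in [u].  The finite-dimensional laws and
    monotonicity alone do not determine the range [X u t w, u in [0, 1]]:
    values strictly between the one-sided limits could be inserted at the
    (random) jump points of [u |-> X u t w]. *)
Definition Arratia_flow (R : realType) (d : measure_display)
    (T : measurableType d) (P : probability T R) (X : R -> R -> T -> R) : Prop :=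
  [/\ forall u s, 0 <= u <= 1 -> 0 <= s -> measurable_fun setT (X u s),
      forall u, 0 <= u <= 1 ->
        {ae P, forall w, {within `[0, +oo[, continuous (fun s => X u s w)}},
      {ae P, forall w, forall s u v, 0 <= s -> 0 <= u -> u <= v -> v <= 1 ->
        X u s w <= X v s w},
      {ae P, forall w, forall s u, 0 <= s -> 0 <= u < 1 ->
        X v s w @[v --> u^'+] --> X u s w}
    & forall u : seq R, sorted <%R u -> all (fun x => 0 <= x <= 1) u ->
        coalescing_BMs P u (fun i => X u`_i)].

(** * One-point densities *)

(** [p] is the density of the measure [f |-> 'E (S f)] on the bounded
    nonnegative measurable functions [f]. *)
Definition is_density (R : realType) (d : measure_display)
    (T : measurableType d) (P : probability T R)
    (S : (R -> R) -> T -> \bar R) (p : R -> R) : Prop :=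
  measurable_fun setT p /\
  forall f : R -> R, measurable_fun setT f -> (forall y, 0 <= f y) ->
    (exists M, forall y, f y <= M) ->
    (\int[lebesgue_measure]_y (f y * p y)%:E = \int[P]_w S f w)%E.

Definition flow_density (R : realType) (d : measure_display)
    (T : measurableType d) (P : probability T R)
    (X : R -> R -> T -> R) (t : R) (p : R -> R) : Prop :=
  is_density P
    (fun f w => \esum_(v in [set X u t w | u in `[0, 1]]) (f v)%:E) p.

(** * The coalescence scheme *)

(** First time in [0, t] at which two of the paths of [z] coincide. *)
Definition collision_time (R : realType) (t : R) (z : seq (R -> R)) : R :=
  inf [set s | 0 <= s <= t /\ ~~ uniq [seq path s | path <- z]].

(** Position, counted from 0, of the first value occurring at least twice. *)
Definition first_repeated (R : realType) (vs : seq R) : nat :=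
  find (fun x => (1 < count_mem x vs)%N) vs.

Fixpoint scheme_steps (R : realType) (t : R) (r : nat) (z : seq (R -> R)) :
    seq nat :=
  if r is r'.+1 then
    let tau := collision_time t z in
    let j := first_repeated [seq path tau | path <- z] in
    j.+1 :: scheme_steps t r' (take j z ++ drop j.+1 z)
  else [::].

(** The collection [J_t] of a system of paths; its entries are counted from 1. *)
Definition scheme (R : realType) (t : R) (z : seq (R -> R)) : seq nat :=
  scheme_steps t (size z - size (undup [seq path t | path <- z])) z.

(** The possible collections of [r] numbers: the [i]-th one (from [i = 1]) is in
    [{1, ..., n - i}]. *)
Fixpoint schemes (n r : nat) : seq (seq nat) :=
  if r is r'.+1 then
    [seq j :: J | j <- iota 1 n.-1, J <- schemes n.-1 r']
  else [:: [::]].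

Definition flow_scheme (R : realType) (T : Type) (X : R -> R -> T -> R)
    (x : seq R) (t : R) (w : T) : seq nat :=
  scheme t [seq (fun s => X u s w) | u <- x].

Definition scheme_density (R : realType) (d : measure_display)
    (T : measurableType d) (P : probability T R)
    (X : R -> R -> T -> R) (t : R) (x : seq R) (J : seq nat) (p : R -> R) :
    Prop :=
  is_density P
    (fun f w => ((\sum_(v <- undup [seq X u t w | u <- x]) f v)
                 * (flow_scheme X x t w == J)%:R)%:E) p.

(** The density of the points [X (x_j, t)], [pJ J] being the one for [J]. *)
Definition points_density (R : realType) (n : nat) (pJ : seq nat -> R -> R)
    (y : R) : R :=
  \sum_(1 <= l < n.+1) \sum_(J <- schemes n (n - l)) pJ J y.

(** * Partitions *)

(** [U n] is the [n]-th partition, for [n >= 2]; [(U n)`_j] stands for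
    $u^{(n)}_{j+1}$. *)
Definition nested_partitions (R : realType) (U : forall n, n.-tuple R) : Prop :=
  [/\ forall n, (2 <= n)%N ->
        [/\ sorted <%R (U n), (U n)`_0 = 0 & (U n)`_n.-1 = 1],
      forall n, (2 <= n)%N -> {subset U n <= U n.+1}
    & \big[Num.max/0]_(0 <= j < n.-1) ((U n)`_j.+1 - (U n)`_j)
        @[n --> \oo] --> (0 : R)].

(* Main.v *)
(** Adding a point [b] between two neighbouring starting points [a < c] creates
    a new value in a set [A] at time [t] only if the middle one of three
    independent Brownian motions started at [a < b < c] is in [A] at time [t]
    and none of them have met.  By the Karlin-McGregor formula, integrated over
    the outer motions, this has probability
    [<= K (b - a) (c - b) (c - a) |A|] with [K = pdf_t(0)^2 / t].  To avoid the
    strong Markov property, the motions are sampled on a grid: once the outer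
    walks are pulled apart by a small amount, the determinant is an approximate
    supersolution for the walks killed when they leave the chamber, and the
    mesh of the grid and then the shift are sent to 0.

    Since [3 (b - a) (c - b) (c - a) = (c - a)^3 - (b - a)^3 - (c - b)^3],
    the bounds for successive insertions telescope: refining [U n] increases
    the expected number of values in [A] by at most
    [K / 3 * \sum_j (u_(j+1) - u_j)^3 |A| <= K / 3 * max_j (u_(j+1) - u_j)^2 |A|].
    By right-continuity and local finiteness, almost surely every value of the
    flow is reached from some partition point, so the same bound holds for the
    whole range.  Summing the densities over all coalescence schemes gives the
    density of the values at [U n], and comparing integrals over all [A] of
    finite measure gives the almost everywhere bound. *)

Require Import Defs.
From HB Require Import structures.
From mathcomp Require Import all_boot all_order all_algebra.
From mathcomp Require Import all_classical all_reals all_analysis.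
From mathcomp Require Import measurable_realfun ring lra.
Import Order.TTheory GRing.Theory Num.Theory.
Import numFieldNormedType.Exports.
Local Open Scope classical_set_scope.
Local Open Scope ring_scope.

(** * Gaussian densities *)

(** In discrete time the path-switching argument behind the Karlin-McGregor formula breaks down:
    walks can jump over one another without ever being equal, so the determinant need not vanish
    when the killed walks leave the chamber, and it may be negative there. Pulling the outer walks
    apart by [eps] leaves room. As long as the true walks are ordered, the shifted gaps exceed
    [eps], and only an increment of size at least [eps / 2] can reverse them in one step. With steps
    of variance [t / n.+1] such increments are exponentially rare in [n], which outweighs both the
    number of steps and the growth of [gauss_peak (t / n.+1)].

    A second obstacle is measurability: neither the sum over the range of the flow nor the indicator
    of a coalescence scheme is known to be measurable, so each is compared off a null set with a
    measurable function. A third is that the driving motions live on another probability space, so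
    only events about the values of the flow can be carried over to them. *)

Definition gauss_peak {R : realType} (v : R) : R := normal_peak (Num.sqrt v).

(** The parameter [v] is the variance, whereas [normal_pdf] takes the standard deviation: variances
    are what adds up under convolution. *)
Definition gauss_pdf {R : realType} (v z : R) : R :=
  normal_pdf 0 (Num.sqrt v) z.

Definition gauss_cdf {R : realType} (v z : R) : R :=
  \int[lebesgue_measure]_(x in `]-oo, z]) gauss_pdf v x.

Section Gaussian.
Context {R : realType}.
Implicit Types v w x z : R.
Local Notation mu := (@lebesgue_measure R).

Lemma gauss_pdfE v z : 0 < v ->
  gauss_pdf v z = gauss_peak v * expR (- (z ^+ 2) / (v *+ 2)).
Proof.
move=> v0; rewrite /gauss_pdf normal_pdfE ?gt_eqF ?sqrtr_gt0//.
by rewrite /normal_fun subr0 sqr_sqrtr// ltW.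
Qed.

Lemma gauss_pdf_ge0 v z : 0 <= gauss_pdf v z.
Proof. exact: normal_pdf_ge0. Qed.

Lemma gauss_peak_gt0 v : 0 < v -> 0 < gauss_peak v.
Proof. by move=> v0; rewrite normal_peak_gt0// gt_eqF// sqrtr_gt0. Qed.

Lemma gauss_pdf_le_peak v z : 0 < v -> gauss_pdf v z <= gauss_peak v.
Proof. by move=> v0; rewrite normal_pdf_ub// gt_eqF// sqrtr_gt0. Qed.

Lemma measurable_gauss_pdf v : measurable_fun setT (gauss_pdf v).
Proof. exact: measurable_normal_pdf. Qed.

Lemma gauss_peakM v w : 0 < v -> 0 < w ->
  gauss_peak v * gauss_peak w = gauss_peak (v + w) * gauss_peak (v * w / (v + w)).
Proof.
move=> v0 w0; have vw0 : 0 < v + w by rewrite addr_gt0.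
have u0 : 0 < v * w / (v + w) by rewrite divr_gt0// mulr_gt0.
rewrite /gauss_peak /normal_peak !sqr_sqrtr ?(ltW v0) ?(ltW w0) ?(ltW vw0) ?(ltW u0)//.
rewrite -!invfM -!sqrtrM ?mulrn_wge0 ?mulr_ge0 ?pi_ge0// ?(ltW v0) ?(ltW vw0)//.
congr (Num.sqrt _)^-1; field; rewrite gt_eqF//.
Qed.

(** Completing the square: the joint density of two independent centred Gaussians factors into the
    density of their sum and the conditional density of one summand given the sum. *)
Lemma gauss_pdf_mul v w z x : 0 < v -> 0 < w ->
  gauss_pdf v (z - x) * gauss_pdf w x
  = gauss_pdf (v + w) z
    * normal_pdf (w * z / (v + w)) (Num.sqrt (v * w / (v + w))) x.
Proof.
move=> v0 w0; have vw0 : 0 < v + w by rewrite addr_gt0.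
have u0 : 0 < v * w / (v + w) by rewrite divr_gt0// mulr_gt0.
rewrite !gauss_pdfE// normal_pdfE ?gt_eqF ?sqrtr_gt0// mulrACA.
rewrite -/(gauss_peak _) [RHS]mulrACA gauss_peakM// /normal_fun -!expRD.
congr (_ * expR _).
rewrite sqr_sqrtr ?(ltW u0)//; field.
by rewrite !gt_eqF.
Qed.

(** A bounded [f] is integrable for the normal law, so the change of variables through the
    Radon-Nikodym derivative applies, and this derivative is almost everywhere the normal
    density. *)
Lemma integral_normal_prob (m s : R) (f : R -> R) :
  measurable_fun setT f -> (exists M, forall x, `|f x| <= M) ->
  (\int[normal_prob m s]_x (f x)%:E
   = \int[mu]_x (f x * normal_pdf m s x)%:E)%E.
Proof.
move=> mf [M fM].
have dom := @normal_prob_dominates R m s.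
have mdf : measurable_fun setT (EFin \o normal_pdf m s).
  by apply/measurable_EFinP; exact: measurable_normal_pdf.
have fi : (normal_prob m s).-integrable setT (EFin \o f).
  apply: measurable_bounded_integrable => //.
    by rewrite -ge0_fin_numE// fin_num_measure.
  exists M; split; first exact: num_real.
  by move=> x Mx y _; exact: le_trans (fM y) (ltW Mx).
rewrite -(Radon_Nikodym_change_of_variables dom)//=.
under [RHS]eq_integral do rewrite EFinM.
apply: ae_eq_integral => //.
- apply: emeasurable_funM; first exact/measurable_EFinP.
  apply: (measurable_int mu).
  exact: Radon_Nikodym_integrable.
- by apply: emeasurable_funM => //; exact/measurable_EFinP.
- apply: ae_eqe_mul2l; apply: integral_ae_eq => //=.
  + exact: Radon_Nikodym_integrable.
  + by move=> E _ mE; rewrite -Radon_Nikodym_integral.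
Qed.

Lemma integral_gauss_pdf_conv v w z : 0 < v -> 0 < w ->
  (\int[normal_prob 0 (Num.sqrt w)]_x (gauss_pdf v (z - x))%:E
   = (gauss_pdf (v + w) z)%:E)%E.
Proof.
move=> v0 w0; rewrite integral_normal_prob; last 2 first.
- by apply: measurableT_comp; [exact: measurable_gauss_pdf|exact: measurable_funB].
- exists (gauss_peak v) => x; rewrite ger0_norm ?gauss_pdf_ge0//.
  exact: gauss_pdf_le_peak.
under eq_integral do rewrite gauss_pdf_mul// EFinM.
rewrite ge0_integralZl//=.
- by rewrite integral_normal_pdf mule1.
- by apply/measurable_EFinP; exact: measurable_normal_pdf.
- by move=> x _; rewrite lee_fin normal_pdf_ge0.
- by rewrite lee_fin gauss_pdf_ge0.
Qed.

Lemma integrable_gauss_pdf v A : measurable A ->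
  mu.-integrable A (EFin \o gauss_pdf v).
Proof.
by move=> mA; apply: (integrableS _ _ (subsetT A)) => //; exact: integrable_normal_pdf.
Qed.

Lemma gauss_cdfE v z :
  (gauss_cdf v z)%:E = normal_prob 0 (Num.sqrt v) `]-oo, z].
Proof. by rewrite /gauss_cdf fineK//; exact: integrable_fin_num (integrable_gauss_pdf _ _ _). Qed.

Lemma gauss_cdf_ge0 v z : 0 <= gauss_cdf v z.
Proof. by rewrite -lee_fin gauss_cdfE. Qed.

Lemma gauss_cdf_le1 v z : gauss_cdf v z <= 1.
Proof. by rewrite -lee_fin gauss_cdfE probability_le1. Qed.

Lemma is_derive_gauss_cdf v z : 0 < v ->
  is_derive z 1 (gauss_cdf v) (gauss_pdf v z).
Proof.
move=> v0.
have [||||d1 d2] := @continuous_FTC1 R (gauss_pdf v) -oo%O z (z + 1).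
- by rewrite ltrDl.
- exact: integrable_gauss_pdf.
- exact: ltNyr.
- by apply: continuous_normal_pdf; rewrite gt_eqF// sqrtr_gt0.
- have d3 : 'D_1 (gauss_cdf v) z = gauss_pdf v z by rewrite -derive1E; exact: d2.
  exact: (DeriveDef d1 d3).
Qed.

Lemma is_derive_gauss_pdf v z : 0 < v ->
  is_derive z 1 (gauss_pdf v) (- (z / v) * gauss_pdf v z).
Proof.
move=> v0.
have -> : gauss_pdf v = (fun z => gauss_peak v * expR (- (z ^+ 2) / (v *+ 2))).
  by apply/funext => x; rewrite gauss_pdfE.
apply: is_derive_eq.
rewrite /GRing.scale/=; set e := expR _.
by field; rewrite gt_eqF.
Qed.

Lemma measurable_gauss_cdf v : 0 < v -> measurable_fun setT (gauss_cdf v).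
Proof.
move=> v0; apply: continuous_measurable_fun => z.
apply: differentiable_continuous; apply/derivable1_diffP.
by have [] := is_derive_gauss_cdf v z v0.
Qed.

End Gaussian.

(** * Measurability of sets defined by comparing two functions *)

Section MeasurableComparisons.
Context {R : realType} {d} {T : measurableType d}.
Variables (f g : T -> R).
Hypotheses (mf : measurable_fun setT f) (mg : measurable_fun setT g).

Lemma measurable_set_le : measurable [set x | f x <= g x].
Proof.
rewrite -[X in measurable X]setTI.
by apply: (@measurable_lee _ _ _ _ _ (EFin \o f) (EFin \o g)) => //;
  exact/measurable_EFinP.
Qed.

Lemma measurable_set_lt : measurable [set x | f x < g x].
Proof.
rewrite -[X in measurable X]setTI.
by apply: (@measurable_lte _ _ _ _ _ (EFin \o f) (EFin \o g)) => //;
  exact/measurable_EFinP.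
Qed.

Lemma measurable_set_eq : measurable [set x | f x = g x].
Proof.
have -> : [set x | f x = g x] = [set x | f x <= g x] `\` [set x | f x < g x].
  apply/seteqP; split => x /= => [->|[fg /negP]]; first by rewrite lexx ltxx.
  by rewrite -leNgt => gf; apply/eqP; rewrite eq_le fg.
by apply: measurableD; [exact: measurable_set_le|exact: measurable_set_lt].
Qed.

Lemma measurable_bool_indic (b : T -> bool) : measurable [set x | b x] ->
  measurable_fun setT (fun x => (b x)%:R : R).
Proof.
move=> mb; have -> : (fun x => (b x)%:R : R) = \1_[set x | b x].
  apply/funext => x; rewrite indicE; congr (nat_of_bool _)%:R.
  by apply/idP/idP => [h|/set_mem//]; exact/mem_set.
exact: measurable_indic.
Qed.

End MeasurableComparisons.

(** * Translation invariance and convolution of Gaussian distribution functions *)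

Section GaussianCdfConvolution.
Context {R : realType}.
Implicit Types v w x z : R.
Local Notation mu := (@lebesgue_measure R).

Lemma lebesgue_measure_shift (c : R) (A : set R) : measurable A ->
  pushforward mu ((fun x => x + c) : R -> measurableTypeR R) A = mu A.
Proof.
have mc : measurable_fun [set: R] ((fun x => x + c) : R -> measurableTypeR R).
  exact: measurable_funD.
move=> mA; apply/esym/lebesgue_measure_unique => //= _ [[a b]] _ <-.
have -> : pushforward mu ((fun x => x + c) : R -> measurableTypeR R) `]a, b]
    = mu `]a - c, b - c].
  rewrite /pushforward; congr (mu _); apply/seteqP; split => x /=;
    by rewrite !in_itv/= ltrBlDr lerBrDr.
by rewrite !lebesgue_measure_itv/= !lte_fin ltrD2r -!EFinB opprB addrA subrK.
Qed.

Lemma ge0_integral_shift (f : R -> \bar R) (c : R) :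
  measurable_fun setT f -> (forall x, (0 <= f x)%E) ->
  (\int[mu]_x f (x + c)%R = \int[mu]_x f x)%E.
Proof.
move=> mf f0.
pose shift := (fun x => x + c) : measurableTypeR R -> measurableTypeR R.
have mc : measurable_fun setT shift by exact: measurable_funD.
transitivity (\int[pushforward mu shift]_x f x)%E.
  by rewrite ge0_integral_pushforward.
by apply: eq_measure_integral => A mA _; exact: lebesgue_measure_shift.
Qed.

Lemma gauss_cdf_integral v z :
  ((gauss_cdf v z)%:E = \int[mu]_u (gauss_pdf v u * (u <= z)%R%:R)%:E)%E.
Proof.
rewrite gauss_cdfE /normal_prob integral_mkcond; apply: eq_integral => u _.
rewrite patchE /gauss_pdf; case: ifPn => [|]; first rewrite inE/= in_itv/= => ->.
  by rewrite mulr1.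
by move/negP; rewrite inE/= in_itv/= => /negP/negbTE ->; rewrite mulr0.
Qed.

(** By translation, [gauss_cdf v (z - x)] is the integral over [u <= z] of [gauss_pdf v (u - x)];
    Tonelli then reduces the claim to the convolution of densities. *)
Lemma integral_gauss_cdf_conv v w z : 0 < v -> 0 < w ->
  (\int[normal_prob 0 (Num.sqrt w)]_x (gauss_cdf v (z - x))%:E
   = (gauss_cdf (v + w) z)%:E)%E.
Proof.
move=> v0 w0.
pose f (p : R * R) := gauss_pdf v (p.2 - p.1) * (p.2 <= z)%R%:R.
have mf : measurable_fun setT (EFin \o f).
  apply/measurable_EFinP; apply: measurable_funM.
    apply: measurableT_comp; first exact: measurable_gauss_pdf.
    exact: measurable_funB.
  exact/measurable_bool_indic/measurable_set_le.
have f0 p : (0 <= (EFin \o f) p)%E by rewrite lee_fin mulr_ge0// gauss_pdf_ge0.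
transitivity (\int[normal_prob 0 (Num.sqrt w)]_x \int[mu]_u (EFin \o f) (x, u))%E.
  apply: eq_integral => x _; rewrite gauss_cdf_integral.
  pose g := fun u => (gauss_pdf v u * (u <= z - x)%R%:R)%:E.
  have mg : measurable_fun [set: R] g.
    apply/measurable_EFinP; apply: measurable_funM; first exact: measurable_gauss_pdf.
    exact/measurable_bool_indic/measurable_set_le.
  rewrite -(ge0_integral_shift g (- x))//; last first.
    by move=> u; rewrite lee_fin mulr_ge0// gauss_pdf_ge0.
  by apply: eq_integral => u _; rewrite /g /f/= lerD2r.
rewrite fubini_tonelli//= gauss_cdf_integral; apply: eq_integral => u _.
rewrite /f/=; under eq_integral do rewrite mulrC EFinM.
rewrite ge0_integralZl//=.
- by rewrite integral_gauss_pdf_conv// muleC -EFinM.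
- apply/measurable_EFinP; apply: measurableT_comp; first exact: measurable_gauss_pdf.
  exact: measurable_funB.
- by move=> x _; rewrite lee_fin gauss_pdf_ge0.
Qed.

End GaussianCdfConvolution.

(* The density at [y] of the middle one of three Brownian motions killed at
   their first collision is, by the Karlin-McGregor formula integrated over the
   two outer particles, the determinant of the rows [1], [cdf z_i], [pdf z_i]
   with [z_i = y - x_i]. *)
Definition mid_det {R : realType} (v z0 z1 z2 : R) : R :=
  gauss_pdf v z1 * (gauss_cdf v z0 - gauss_cdf v z2)
  + gauss_pdf v z2 * (gauss_cdf v z1 - gauss_cdf v z0)
  + gauss_pdf v z0 * (gauss_cdf v z2 - gauss_cdf v z1).

(** * Bounds for the three-particle determinant *)

Section MidDet.
Context {R : realType}.
Implicit Types v x y z : R.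

Lemma is_derive_continuous (f df : R -> R) :
  (forall x : R, is_derive x 1 f (df x)) -> continuous f.
Proof.
move=> fdf x; apply: differentiable_continuous; apply/derivable1_diffP.
by have [] := fdf x.
Qed.

Lemma MVT_continuous (f df : R -> R) (a b : R) : a <= b ->
  (forall x : R, is_derive x 1 f (df x)) ->
  exists2 c, a <= c <= b & f b - f a = df c * (b - a).
Proof.
move=> ab fdf; have [|c cab ->] := @MVT_segment R f df a b ab.
  exact/continuous_subspaceT/is_derive_continuous.
by exists c => //; move: cab; rewrite in_itv.
Qed.

Lemma gauss_cdf_incr v x y : 0 < v -> x <= y ->
  0 <= gauss_cdf v y - gauss_cdf v x <= gauss_peak v * (y - x).
Proof.
move=> v0 xy.
have [c _ ->] := MVT_continuous _ _ _ _ xy (fun z => is_derive_gauss_cdf v z v0).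
rewrite mulr_ge0 ?gauss_pdf_ge0 ?subr_ge0//=.
by rewrite ler_wpM2r ?subr_ge0// gauss_pdf_le_peak.
Qed.

(* [pdf + (m / v) cdf] has derivative [pdf(z) (m - z) / v], hence is maximal
   at [m]. *)
Lemma gauss_tilt_max v m z : 0 < v ->
  0 <= (gauss_pdf v m + m / v * gauss_cdf v m)
       - (gauss_pdf v z + m / v * gauss_cdf v z)
    <= gauss_peak v / v * (m - z) ^+ 2.
Proof.
move=> v0.
have dh x : is_derive x 1 (fun x => gauss_pdf v x + m / v * gauss_cdf v x)
    (gauss_pdf v x * ((m - x) / v)).
  have h1 := is_derive_gauss_pdf v x v0; have h2 := is_derive_gauss_cdf v x v0.
  apply: is_derive_eq; rewrite /GRing.scale/=; set a := gauss_pdf v x.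
  by field; rewrite gt_eqF.
(* The mean value point [c] lies between [m] and [z]; the two sign conditions say so without fixing
   the order of [m] and [z]. *)
have [c cP ->] : exists2 c, (m - z) * (m - c) >= 0 /\ (m - z) * (c - z) >= 0 &
    (gauss_pdf v m + m / v * gauss_cdf v m)
    - (gauss_pdf v z + m / v * gauss_cdf v z)
    = gauss_pdf v c * ((m - c) / v) * (m - z).
  have [zm|mz] := leP z m.
    have [c /andP[c1 c2] e] := MVT_continuous _ _ _ _ zm dh.
    by exists c; [split; apply: mulr_ge0; rewrite subr_ge0|].
  have [c /andP[c1 c2] e] := MVT_continuous _ _ _ _ (ltW mz) dh.
  exists c; first by split; nra.
  by rewrite -opprB e -mulrN opprB.
have [c1 c2] := cP; apply/andP; split.
  rewrite -mulrA mulr_ge0 ?gauss_pdf_ge0// mulrAC divr_ge0 ?(ltW v0)//.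
  by rewrite mulrC.
rewrite -!mulrA ler_pM ?gauss_pdf_ge0 ?gauss_pdf_le_peak//.
  by rewrite mulrCA mulr_ge0 ?invr_ge0 ?(ltW v0)// mulrC.
rewrite mulrCA ler_wpM2l ?invr_ge0 ?(ltW v0)//; nra.
Qed.

(** Adding [z1 / v] times the cdf row to the pdf row and subtracting the column of [z1] from the
    others leaves the determinant unchanged. The tilted row is maximal at [z1], so the expansion is
    a sum of two products of nonnegative factors. Each cdf increment is at most the peak times a gap
    and each drop of the tilted row at most the peak over [v] times a squared gap, which is where
    the constant [gauss_peak v ^+ 2 / v] comes from. *)
Lemma mid_det_bounds v z0 z1 z2 : 0 < v -> z2 <= z1 -> z1 <= z0 ->
  0 <= mid_det v z0 z1 z2
    <= gauss_peak v ^+ 2 / v * ((z0 - z1) * (z1 - z2) * (z0 - z2)).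
Proof.
move=> v0 z21 z10.
have /andP[a0 a1] := gauss_cdf_incr _ _ _ v0 z10.
have /andP[b0 b1] := gauss_cdf_incr _ _ _ v0 z21.
have /andP[p0 p1] := gauss_tilt_max v z1 z0 v0.
have /andP[q0 q1] := gauss_tilt_max v z1 z2 v0.
have -> : mid_det v z0 z1 z2 =
  (gauss_cdf v z0 - gauss_cdf v z1)
    * ((gauss_pdf v z1 + z1 / v * gauss_cdf v z1)
       - (gauss_pdf v z2 + z1 / v * gauss_cdf v z2))
  + (gauss_cdf v z1 - gauss_cdf v z2)
    * ((gauss_pdf v z1 + z1 / v * gauss_cdf v z1)
       - (gauss_pdf v z0 + z1 / v * gauss_cdf v z0)).
  by rewrite /mid_det; field; rewrite gt_eqF.
apply/andP; split; first by rewrite addr_ge0// mulr_ge0.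
apply: (@le_trans _ _
  (gauss_peak v * (z0 - z1) * (gauss_peak v / v * (z1 - z2) ^+ 2)
   + gauss_peak v * (z1 - z2) * (gauss_peak v / v * (z1 - z0) ^+ 2))).
  by rewrite lerD// ler_pM.
by rewrite le_eqVlt; apply/orP; left; apply/eqP; field; rewrite gt_eqF.
Qed.

(** A crude bound valid for any order of the arguments; it limits the loss at steps where the
    shifted walks cross. *)
Lemma mid_det_ge v z0 z1 z2 : 0 < v -> - (3 * gauss_peak v) <= mid_det v z0 z1 z2.
Proof.
move=> v0.
have b z z' z'' : - gauss_peak v
    <= gauss_pdf v z * (gauss_cdf v z' - gauss_cdf v z'').
  have := gauss_pdf_ge0 v z; have := gauss_pdf_le_peak v z v0.
  have := gauss_cdf_ge0 v z'; have := gauss_cdf_le1 v z'.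
  have := gauss_cdf_ge0 v z''; have := gauss_cdf_le1 v z''.
  by nra.
have := b z1 z0 z2; have := b z2 z1 z0; have := b z0 z2 z1.
rewrite /mid_det; lra.
Qed.

End MidDet.

(** * Independence *)

Section IndependentIntegral.
Context {R : realType} {d d'} {T : measurableType d} {E : measurableType d'}.
Context {P : probability T R}.
Variables (Pi : set (set T)) (mu : probability E R) (xi : T -> E).
Hypothesis Pi_measurable : Pi `<=` measurable.
Hypothesis PiI : setI_closed Pi.
Hypothesis PiT : Pi setT.
Hypothesis mxi : measurable_fun setT xi.
Hypothesis indep : forall G B, Pi G -> measurable B ->
  P (G `&` xi @^-1` B) = (P G * mu B)%E.

Local Notation past := (g_sigma_algebraType Pi).

Lemma g_sigma_sub G : <<s Pi >> G -> measurable G.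
Proof. by apply: smallest_sub => //; exact: sigma_algebra_measurable. Qed.

Lemma measurable_past : measurable_fun [set: T] (id : T -> past).
Proof. by move=> _ G mG; rewrite setTI; exact: g_sigma_sub. Qed.

(** As functions of [G], both sides are finite measures that agree on the pi-system [Pi], hence on
    the sigma-algebra which it generates. *)
Lemma indep_past G B : <<s Pi >> G -> measurable B ->
  P (G `&` xi @^-1` B) = (P G * mu B)%E.
Proof.
move=> sG mB.
have mxB : measurable (xi @^-1` B) by rewrite -[X in measurable X]setTI; exact: mxi.
have muB0 : 0 <= fine (mu B) by rewrite fine_ge0.
pose m1 : {measure set T -> \bar R} := mrestr P mxB.
pose m2 : {measure set T -> \bar R} := mscale (NngNum muB0) P.
have -> : P (G `&` xi @^-1` B) = m1 G by [].
have -> : (P G * mu B)%E = m2 G.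
  by rewrite /m2/= /mscale/= fineK ?fin_num_measure// muleC.
apply: (@g_sigma_algebra_measure_unique _ R T Pi _ (fun=> setT)) => //.
- by rewrite bigcup_const.
- move=> A PiA; rewrite /m1 /m2/= /mrestr /mscale/= fineK ?fin_num_measure//.
  by rewrite indep// muleC.
- by move=> _; rewrite -ge0_fin_numE// /m1/= /mrestr fin_num_measure// setTI.
Qed.

(** The joint law of the past and [xi] is a product measure, so [xi] may be integrated out with the
    past frozen. The past is encoded as the identity map from [T] to the same set with the smaller
    sigma-algebra; a function on [past] is then just a function of [w] with a stronger measurability
    requirement. *)
Lemma indep_integral (f : past * E -> \bar R) :
  measurable_fun setT f -> (forall x, (0 <= f x)%E) ->
  (\int[P]_w f (w, xi w) = \int[P]_w \int[mu]_y f (w, y))%E.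
Proof.
move=> mf f0.
pose X0 : {mfun T >-> past} := HB.pack (id : T -> past)
  (isMeasurableFun.Build _ _ _ _ _ measurable_past).
have mX1 : measurable_fun [set: T] ((fun w => (w, xi w)) : T -> past * E).
  by apply/measurable_fun_pairP; split => //; exact: measurable_past.
pose X1 : {mfun T >-> (past * E)%type} := HB.pack
  ((fun w => (w, xi w)) : T -> past * E) (isMeasurableFun.Build _ _ _ _ _ mX1).
pose P0 : probability past R := distribution P X0.
pose P1 : probability (past * E)%type R := distribution P X1.
have PE : forall A, measurable A -> (P0 \x mu)%E A = P1 A.
  apply: product_measure_unique => A B mA mB.
  by rewrite /P1 /P0 /= /distribution /pushforward/= -indep_past.
transitivity (\int[P1]_x f x)%E.
  by rewrite ge0_integral_pushforward.
transitivity (\int[P0 \x mu]_x f x)%E.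
  by apply: eq_measure_integral => A mA _; exact/esym/PE.
rewrite fubini_tonelli1// ge0_integral_pushforward//.
- exact: measurable_fun_fubini_tonelli_F.
- by move=> x _; exact: integral_ge0.
Qed.

End IndependentIntegral.

(** * Independent arrays of increments *)

Section Cylinders.
Context {R : realType} {d d'} {T : measurableType d} {E : measurableType d'}.
Context (P : probability T R).
Variables (n N : nat) (mu : probability E R) (xi : nat -> nat -> T -> E).
Hypothesis mxi : forall i k, (i < n)%N -> (k < N)%N ->
  measurable_fun setT (xi i k).

Definition cylinder (B : nat -> nat -> set E) : set T :=
  [set w | forall i k, (i < n)%N -> (k < N)%N -> B i k (xi i k w)].

Hypothesis indep : forall B, (forall i k, measurable (B i k)) ->
  P (cylinder B) = (\prod_(0 <= i < n) \prod_(0 <= k < N) mu (B i k))%E.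

(** The mask [c] marks the increments regarded as known. It is a set of pairs of a walk and a step
    rather than a time, because the walks are advanced one at a time within a single step. *)
Definition cylinders (c : nat -> nat -> bool) : set (set T) :=
  [set G | exists B, [/\ forall i k, measurable (B i k),
                      forall i k, ~~ c i k -> B i k = setT & G = cylinder B]].

Lemma measurable_cylinder B : (forall i k, measurable (B i k)) ->
  measurable (cylinder B).
Proof.
move=> mB.
have -> : cylinder B =
  \bigcap_(i in `I_n) \bigcap_(k in `I_N) (xi i k @^-1` B i k).
  apply/seteqP; split => w /= h => [i /= ni k /= Nk|i k ni Nk]; first exact: h.
  exact: (h i ni k Nk).
apply: fin_bigcap_measurable => // i /= ni.
apply: fin_bigcap_measurable => // k /= Nk.
by rewrite -[X in measurable X]setTI; exact: mxi.
Qed.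

Lemma cylinders_measurable c : cylinders c `<=` measurable.
Proof. by move=> _ [B [mB _ ->]]; exact: measurable_cylinder. Qed.

Lemma cylindersT c : cylinders c setT.
Proof.
exists (fun _ _ => setT); split => //.
by apply/esym/seteqP; split.
Qed.

Lemma cylinderI B B' :
  cylinder B `&` cylinder B' = cylinder (fun i k => B i k `&` B' i k).
Proof.
apply/seteqP; split => w /=.
  by move=> [h h'] i k ni Nk; split; [exact: h|exact: h'].
by move=> h; split => i k ni Nk; have [] := h i k ni Nk.
Qed.

Lemma cylindersI c : setI_closed (cylinders c).
Proof.
move=> _ _ [B [mB Bc ->]] [B' [mB' Bc' ->]].
exists (fun i k => B i k `&` B' i k); split => //; last exact: cylinderI.
- by move=> i k; exact: measurableI.
- by move=> i k cik; rewrite Bc// Bc'// setIT.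
Qed.

Lemma preimage_cylinder i0 k0 B : (i0 < n)%N -> (k0 < N)%N ->
  xi i0 k0 @^-1` B =
  cylinder (fun i k => if (i == i0) && (k == k0) then B else setT).
Proof.
move=> ni Nk; apply/seteqP; split => w /=.
  by move=> h i k _ _; case: ifP => // /andP[/eqP -> /eqP ->].
by move=> /(_ _ _ ni Nk); rewrite !eqxx.
Qed.

(** In the product formula the factor of an unmarked increment is the measure of [setT], namely 1
    for [G] alone; intersecting with the preimage of [B] replaces this one factor by [mu B]. *)
Lemma cylinders_indep c i0 k0 G B : (i0 < n)%N -> (k0 < N)%N -> ~~ c i0 k0 ->
  cylinders c G -> measurable B ->
  P (G `&` xi i0 k0 @^-1` B) = (P G * mu B)%E.
Proof.
move=> ni Nk cF [B' [mB' Bc ->]] mB.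
rewrite preimage_cylinder// cylinderI !indep//; last first.
  by move=> i k; apply: measurableI => //; case: ifP.
rewrite !big_mkord (bigD1 (Ordinal ni))//= [in RHS](bigD1 (Ordinal ni))//=.
rewrite !big_mkord (bigD1 (Ordinal Nk))//= [in RHS](bigD1 (Ordinal Nk))//=.
rewrite !eqxx/= Bc// setTI probability_setT mul1e [RHS]muleC -!muleA.
congr (_ * _)%E; congr (_ * _)%E.
  apply: eq_bigr => k; rewrite -val_eqE/= => /negbTE ->.
  by rewrite setIT.
apply: eq_bigr => i; rewrite -val_eqE/= => /negbTE ->.
by apply: eq_bigr => k _; rewrite setIT.
Qed.

Lemma measurable_past_increment (c : nat -> nat -> bool) i k : (i < n)%N -> (k < N)%N -> c i k ->
  measurable_fun [set: g_sigma_algebraType (cylinders c)] (xi i k).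
Proof.
move=> ni Nk cik _ B mB; rewrite setTI; apply: sub_gen_smallest.
exists (fun i' k' => if (i' == i) && (k' == k) then B else setT); split.
- by move=> i' k'; case: ifP.
- by move=> i' k'; case: ifPn => // /andP[/eqP -> /eqP ->]; rewrite cik.
- exact: preimage_cylinder.
Qed.

Lemma increment_integral c i k
    (f : g_sigma_algebraType (cylinders c) * E -> \bar R) :
  (i < n)%N -> (k < N)%N -> ~~ c i k ->
  measurable_fun setT f -> (forall x, (0 <= f x)%E) ->
  (\int[P]_w f (w, xi i k w) = \int[P]_w \int[mu]_y f (w, y))%E.
Proof.
move=> ni Nk cF mf f0; apply: indep_integral => //.
- exact: cylinders_measurable.
- exact: cylindersI.
- exact: cylindersT.
- exact: mxi.
- by move=> G B cG mB; exact: cylinders_indep cG mB.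
Qed.

End Cylinders.

(** * Three walks killed at their first crossing *)

Section Walks.
Context {R : realType} {d} {T : measurableType d} (P : probability T R).
Variables (N : nat) (D : R) (xi : nat -> nat -> T -> measurableTypeR R) (x : nat -> R).
Hypothesis D0 : 0 < D.
Hypothesis mxi : forall i k, (i < 3)%N -> (k < N)%N ->
  measurable_fun setT (xi i k).
Local Notation mu := (normal_prob 0 (Num.sqrt D) : probability (measurableTypeR R) R).
Hypothesis indep : forall B, (forall i k, measurable (B i k)) ->
  P (cylinder 3 N xi B)
  = (\prod_(0 <= i < 3) \prod_(0 <= k < N) mu (B i k))%E.

Local Notation past c := (g_sigma_algebraType (cylinders 3 N xi c)).

Definition walk (i k : nat) (w : T) : R := x i + \sum_(0 <= j < k) xi i j w.

Lemma walk0 i w : walk i 0 w = x i.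
Proof. by rewrite /walk big_nil addr0. Qed.

Lemma walkS i k w : walk i k.+1 w = walk i k w + xi i k w.
Proof. by rewrite /walk big_nat_recr//= addrA. Qed.

Lemma measurable_past_walk (c : nat -> nat -> bool) i k : (i < 3)%N -> (k <= N)%N ->
  (forall j, (j < k)%N -> c i j) -> measurable_fun [set: past c] (walk i k).
Proof.
move=> i3; elim: k => [|k IH] kN cik.
  by apply: (eq_measurable_fun (cst (x i))) => // w _; rewrite walk0.
have -> : walk i k.+1 = walk i k \+ xi i k by apply/funext => w; exact: walkS.
apply: measurable_funD.
  by apply: IH => [|j jk]; [exact: ltnW|apply: cik; rewrite ltnS ltnW].
by apply: measurable_past_increment => //; exact: cik.
Qed.

Lemma past_measurable_fun (c : nat -> nat -> bool) d' (U : measurableType d') (f : T -> U) :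
  measurable_fun [set: past c] f -> measurable_fun [set: T] f.
Proof.
move=> mf _ B mB; rewrite setTI.
have := mf measurableT B mB; rewrite setTI.
apply: g_sigma_sub; exact: cylinders_measurable.
Qed.

(** The current position of walk [i] is known to the past and its next increment is independent of
    it, so one step turns [F] into its Gaussian average [TF] around the current position. *)
Lemma walk_step (c : nat -> nat -> bool) i k (F : past c * measurableTypeR R -> R) (TF : T -> \bar R) :
  (i < 3)%N -> (k < N)%N -> ~~ c i k -> (forall j, (j < k)%N -> c i j) ->
  measurable_fun setT F -> (forall p, 0 <= F p) ->
  (forall w, \int[mu]_y (F (w, (walk i k w + y)%R))%:E = TF w)%E ->
  (\int[P]_w (F (w, walk i k.+1 w))%:E = \int[P]_w TF w)%E.
Proof.
move=> i3 kN cik cij mF F0 FT.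
pose f (p : past c * measurableTypeR R) := (F (p.1, walk i k p.1 + p.2))%:E.
have mf : measurable_fun setT f.
  have mw := measurable_past_walk c i k i3 (ltnW kN) cij.
  have m1 : measurable_fun [set: past c * measurableTypeR R] (fun p => walk i k p.1).
    exact: (measurableT_comp mw measurable_fst).
  have m2 : measurable_fun [set: past c * measurableTypeR R] (fun p => walk i k p.1 + p.2).
    exact: (measurable_funD m1 measurable_snd).
  apply/measurable_EFinP; apply: (measurableT_comp mF).
  apply/measurable_fun_pairP; split; [exact: measurable_fst|exact: m2].
under eq_integral do rewrite walkS.
transitivity (\int[P]_w f (w, xi i k w))%E; first by [].
rewrite (increment_integral P 3 N mu xi mxi indep c i k f)//; last first.
  by move=> p; rewrite lee_fin.
by apply: eq_integral => w _; rewrite -FT.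
Qed.

Definition ordered k w :=
  (walk 0 k w < walk 1 k w) && (walk 1 k w < walk 2 k w).

Fixpoint stay k w :=
  ordered k w && (if k is k'.+1 then stay k' w else true).

Lemma measurable_past_stay (c : nat -> nat -> bool) k : (k <= N)%N ->
  (forall i j, (j < k)%N -> c i j) ->
  measurable_fun [set: past c] (fun w => (stay k w)%:R : R).
Proof.
move=> kN cij; apply: measurable_bool_indic; elim: k => [|k IH] in kN cij *.
all: have mw i (i3 : (i < 3)%N) := measurable_past_walk c i _ i3 kN (cij i).
all: have mo := measurableI _ _ (measurable_set_lt _ _ (mw 0 isT) (mw 1 isT))
  (measurable_set_lt _ _ (mw 1 isT) (mw 2 isT)).
  by congr measurable: mo; apply/seteqP; split => w /=;
    rewrite andbT; move/andP.
have := measurableI _ _ mo (IH _ _).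
move=> /(_ (ltnW kN) (fun i j jk => cij i j (ltnW jk))).
congr measurable; apply/seteqP; split => w /=.
  by move=> [[h1 h2] h3]; rewrite /ordered h1 h2.
by move=> /andP[/andP[h1 h2] h3].
Qed.

(** The two increments are integrated out in turn: that of walk [i] while the new position of walk
    [j] counts as known (mask [c1]), then that of walk [j] over the past before step [k] alone (mask
    [c0]). Killing is frozen at time [k], so it factors out of both. *)
Lemma walk_step2 i j k (gi gj : R -> R) (Tgi Tgj : R -> R) :
  (i < 3)%N -> (j < 3)%N -> i != j -> (k < N)%N ->
  measurable_fun setT gi -> measurable_fun setT gj ->
  measurable_fun setT Tgi ->
  (forall z, 0 <= gi z) -> (forall z, 0 <= gj z) -> (forall z, 0 <= Tgi z) ->
  (forall z, \int[mu]_y (gi (z + y)%R)%:E = (Tgi z)%:E)%E ->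
  (forall z, \int[mu]_y (gj (z + y)%R)%:E = (Tgj z)%:E)%E ->
  (\int[P]_w ((stay k w)%:R * (gi (walk i k.+1 w) * gj (walk j k.+1 w)))%:E
   = \int[P]_w ((stay k w)%:R * (Tgi (walk i k w) * Tgj (walk j k w)))%:E)%E.
Proof.
move=> i3 j3 ij kN mgi mgj mTgi gi0 gj0 Tgi0 hi hj.
pose c1 := fun i' k' : nat => (k' < k)%N || (i' == j) && (k' == k).
pose c0 := fun i' k' : nat => (k' < k)%N.
have mstay1 : measurable_fun [set: past c1] (fun w => (stay k w)%:R : R).
  by apply: measurable_past_stay => [|i' k' k'k]; [exact: ltnW|rewrite /c1 k'k].
have mstay0 : measurable_fun [set: past c0] (fun w => (stay k w)%:R : R).
  by apply: measurable_past_stay => [|//]; exact: ltnW.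
have mwj : measurable_fun [set: past c1] (walk j k.+1).
  apply: measurable_past_walk => // k'; rewrite ltnS leq_eqVlt /c1.
  by move=> /orP[/eqP ->|->//]; rewrite !eqxx orbT.
have mwi : measurable_fun [set: past c0] (walk i k).
  by apply: measurable_past_walk => //; exact: ltnW.
pose F1 (p : past c1 * measurableTypeR R) :=
  (stay k p.1)%:R * (gi p.2 * gj (walk j k.+1 p.1)).
pose F0 (p : past c0 * measurableTypeR R) :=
  (stay k p.1)%:R * (Tgi (walk i k p.1) * gj p.2).
transitivity
  (\int[P]_w ((stay k w)%:R * (Tgi (walk i k w) * gj (walk j k.+1 w)))%:E)%E.
  apply: (walk_step c1 i k F1) => //.
  - by rewrite /c1 ltnn (negbTE ij).
  - by move=> k' k'k; rewrite /c1 k'k.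
  - apply: measurable_funM; first exact: (measurableT_comp mstay1 measurable_fst).
    apply: measurable_funM; first exact: (measurableT_comp mgi measurable_snd).
    exact: (measurableT_comp mgj (measurableT_comp mwj measurable_fst)).
  - by move=> p; rewrite !mulr_ge0.
  - move=> w; under eq_integral do rewrite /F1/= mulrCA EFinM.
    rewrite ge0_integralZr//=; first by rewrite hi -EFinM mulrCA.
    + apply/measurable_EFinP; apply: (measurableT_comp mgi).
      exact: measurable_funD.
    + by move=> y _; rewrite lee_fin.
    + by rewrite lee_fin mulr_ge0.
apply: (walk_step c0 j k F0) => //.
- by rewrite /c0 ltnn.
- apply: measurable_funM; first exact: (measurableT_comp mstay0 measurable_fst).
  apply: measurable_funM; last exact: (measurableT_comp mgj measurable_snd).
  exact: (measurableT_comp mTgi (measurableT_comp mwi measurable_fst)).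
- by move=> p; rewrite !mulr_ge0.
- move=> w; under eq_integral do rewrite /F0/= mulrA EFinM.
  rewrite ge0_integralZl//=; first by rewrite hj -EFinM mulrA.
  + apply/measurable_EFinP; apply: (measurableT_comp mgj).
    exact: measurable_funD.
  + by move=> y _; rewrite lee_fin.
  + by rewrite lee_fin mulr_ge0.
Qed.


Variable eps : R.
Hypothesis eps0 : 0 < eps.

(* Pulling the outer walks apart by [eps] turns the determinant, which is
   nonnegative as long as the shifted walks are ordered, into a supersolution:
   it can only be negative after a step of size at least [eps / 2]. *)
Definition pull (i : nat) : R := if i is i'.+1 then i'%:R * eps else - eps.

Definition pulled i k w := walk i k w + pull i.

(** Large increments are counted rather than merely detected, so that the expectation is a sum over
    the three walks. *)
Definition big_step k w : R :=
  \sum_(0 <= i < 3) (eps / 2 <= `|xi i k w|)%R%:R.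

Lemma big_stepE k w : big_step k w = (eps / 2 <= `|xi 0 k w|)%R%:R
  + (eps / 2 <= `|xi 1 k w|)%R%:R + (eps / 2 <= `|xi 2 k w|)%R%:R.
Proof. by rewrite /big_step !big_nat_recr//= big_nil add0r. Qed.

Lemma stay_ordered k w : stay k w -> ordered k w.
Proof. by case: k => [|k] /andP[]. Qed.

Lemma stay_pulled k w : stay k w ->
  pulled 0 k w < pulled 1 k w /\ pulled 1 k w < pulled 2 k w.
Proof.
move=> /stay_ordered /andP[h1 h2]; rewrite /pulled /pull mul0r mul1r addr0.
by split; move: eps0 h1 h2; lra.
Qed.

Lemma pulled_next k w : stay k w ->
  (pulled 0 k.+1 w <= pulled 1 k.+1 w /\ pulled 1 k.+1 w <= pulled 2 k.+1 w)
  \/ 1 <= big_step k w.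
Proof.
move=> /stay_ordered /andP[h1 h2].
have ge0 (b : bool) : 0 <= b%:R :> R by [].
rewrite big_stepE; have [b0|n0] := leP (eps / 2) `|xi 0 k w|.
  by right; rewrite -addrA lerDl addr_ge0.
have [b1|n1] := leP (eps / 2) `|xi 1 k w|; first by right; rewrite add0r lerDl.
have [b2|n2] := leP (eps / 2) `|xi 2 k w|; first by right; rewrite addr0 add0r.
left; rewrite /pulled !walkS /pull mul0r mul1r addr0.
by move: n0 n1 n2; rewrite !ltr_norml; split; lra.
Qed.

(** Killing at step [k.+1] removes [v] only when the order is lost there; the removed [v] is
    nonnegative, or else the shifted walks have crossed, a big step has occurred and at most [M] is
    gained. It is stated for a number [v] because it serves twice: for the determinant with
    [M = 3 * gauss_peak v], and for the terminal indicator with [M = 3]. *)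
Lemma pull_supersolution (v M : R) k w : 0 <= M -> - M <= v ->
  (pulled 0 k.+1 w <= pulled 1 k.+1 w -> pulled 1 k.+1 w <= pulled 2 k.+1 w ->
   0 <= v) ->
  (stay k.+1 w)%:R * v <= (stay k w)%:R * v + M * big_step k w.
Proof.
move=> M0 Mv v0.
have b0 : 0 <= big_step k w by rewrite big_stepE !addr_ge0.
have -> : stay k.+1 w = ordered k.+1 w && stay k w by [].
case: ordered; rewrite /=.
  by rewrite lerDl mulr_ge0.
case: (boolP (stay k w)) => [sk|_]; rewrite ?mul0r ?mul1r ?add0r; last exact: mulr_ge0.
have [[h1 h2]|b1] := pulled_next _ _ sk.
  by rewrite addr_ge0// ?v0// mulr_ge0.
apply: (@le_trans _ _ (v + M)); first by rewrite -lerBlDr sub0r.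
by rewrite lerD2l ler_peMr.
Qed.

Lemma integrable_EFinD d' (T' : measurableType d')
    (m : {measure set T' -> \bar R}) (A : set T') (f g : T' -> R) :
  measurable A -> m.-integrable A (EFin \o f) -> m.-integrable A (EFin \o g) ->
  m.-integrable A (EFin \o (fun w => f w + g w)).
Proof. by move=> mA fi gi; exact: (integrableD mA fi gi). Qed.

Lemma integrable_EFinB d' (T' : measurableType d')
    (m : {measure set T' -> \bar R}) (A : set T') (f g : T' -> R) :
  measurable A -> m.-integrable A (EFin \o f) -> m.-integrable A (EFin \o g) ->
  m.-integrable A (EFin \o (fun w => f w - g w)).
Proof. by move=> mA fi gi; exact: (integrableB mA fi gi). Qed.

(** The expansion of a determinant whose first row is constant, [f i j] being the entry of walk [i]
    in one row times that of walk [j] in the other. Each term involves only two distinct walks, and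
    the sum is linear, so expectations can be computed term by term. *)
Definition alternating (f : nat -> nat -> R) : R :=
  (f 1 0 - f 1 2) + (f 2 1 - f 2 0) + (f 0 2 - f 0 1).

Lemma eq_alternating f g :
  (forall i j, (i < 3)%N -> (j < 3)%N -> i != j -> f i j = g i j) ->
  alternating f = alternating g.
Proof. by move=> fg; rewrite /alternating !fg. Qed.

Lemma mulr_alternating a f :
  a * alternating f = alternating (fun i j => a * f i j).
Proof. by rewrite /alternating !mulrDr !mulrN. Qed.

Lemma integrable_alternating d' (T' : measurableType d')
    (m : {measure set T' -> \bar R}) (A : set T') (f : nat -> nat -> T' -> R) :
  measurable A ->
  (forall i j, (i < 3)%N -> (j < 3)%N -> i != j ->
    m.-integrable A (EFin \o f i j)) ->
  m.-integrable A (EFin \o (fun w => alternating (fun i j => f i j w))).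
Proof.
move=> mA fi; apply: integrable_EFinD => //; [apply: integrable_EFinD => //|];
  by apply: integrable_EFinB => //; exact: fi.
Qed.

Lemma Rintegral_alternating d' (T' : measurableType d')
    (m : {measure set T' -> \bar R}) (A : set T') (f : nat -> nat -> T' -> R) :
  measurable A ->
  (forall i j, (i < 3)%N -> (j < 3)%N -> i != j ->
    m.-integrable A (EFin \o f i j)) ->
  \int[m]_(w in A) alternating (fun i j => f i j w)
  = alternating (fun i j => \int[m]_(w in A) f i j w).
Proof.
move=> mA fi; have fB i j i' j' : (i < 3)%N -> (j < 3)%N -> i != j ->
    (i' < 3)%N -> (j' < 3)%N -> i' != j' ->
    m.-integrable A (EFin \o (fun w => f i j w - f i' j' w)).
  by move=> *; apply: integrable_EFinB => //; exact: fi.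
have B i j i' j' : (i < 3)%N -> (j < 3)%N -> i != j ->
    (i' < 3)%N -> (j' < 3)%N -> i' != j' ->
    \int[m]_(w in A) (f i j w - f i' j' w)
    = \int[m]_(w in A) f i j w - \int[m]_(w in A) f i' j' w.
  by move=> *; apply: RintegralB => //; exact: fi.
rewrite /alternating RintegralD; last 3 first.
- by [].
- by apply: integrable_EFinD => //; exact: fB.
- exact: fB.
by rewrite RintegralD ?B//; exact: fB.
Qed.

Lemma integrable_bounded (f : T -> R) (M : R) : measurable_fun setT f ->
  (forall w, `|f w| <= M) -> P.-integrable setT (EFin \o f).
Proof.
move=> mf fM; apply: measurable_bounded_integrable => //.
  by rewrite -ge0_fin_numE// fin_num_measure.
exists M; split; first exact: num_real.
by move=> y My w _; exact: le_trans (fM w) (ltW My).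
Qed.

Lemma measurable_walk i k : (i < 3)%N -> (k <= N)%N ->
  measurable_fun setT (walk i k).
Proof.
move=> i3 kN; apply: (past_measurable_fun (fun _ _ => true)).
exact: measurable_past_walk.
Qed.

Lemma measurable_pulled i k : (i < 3)%N -> (k <= N)%N ->
  measurable_fun setT (pulled i k).
Proof. by move=> i3 kN; apply: measurable_funD => //; exact: measurable_walk. Qed.

Lemma measurable_stay k : (k <= N)%N ->
  measurable_fun setT (fun w => (stay k w)%:R : R).
Proof.
move=> kN; apply: (past_measurable_fun (fun _ _ => true)).
exact: measurable_past_stay.
Qed.

Definition mid_term v u i j k w :=
  gauss_pdf v (u - pulled i k w) * gauss_cdf v (u - pulled j k w).

Definition pulled_det v u k w :=
  mid_det v (u - pulled 0 k w) (u - pulled 1 k w) (u - pulled 2 k w).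

Lemma pulled_detE a v u k w : a * pulled_det v u k w
  = alternating (fun i j => a * mid_term v u i j k w).
Proof. rewrite /pulled_det /mid_det /alternating /mid_term; ring. Qed.

Lemma measurable_stay_term a v u i j k : 0 < v -> (i < 3)%N -> (j < 3)%N ->
  (a <= N)%N -> (k <= N)%N ->
  measurable_fun setT (fun w => (stay a w)%:R * mid_term v u i j k w).
Proof.
move=> v0 i3 j3 aN kN; apply: measurable_funM; first exact: measurable_stay.
apply: measurable_funM; (apply: measurableT_comp;
  [exact: measurable_gauss_pdf || exact: measurable_gauss_cdf
  |by apply: measurable_funB => //; exact: measurable_pulled]).
Qed.

Lemma stay_term_ge0 a v u i j k w : 0 <= (stay a w)%:R * mid_term v u i j k w.
Proof. by rewrite !mulr_ge0 ?gauss_pdf_ge0 ?gauss_cdf_ge0. Qed.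

Lemma stay_term_le a v u i j k w : 0 < v ->
  (stay a w)%:R * mid_term v u i j k w <= gauss_peak v.
Proof.
move=> v0; rewrite -[leRHS]mul1r -[X in _ <= _ * X]mulr1.
by rewrite !ler_pM ?mulr_ge0 ?gauss_pdf_ge0 ?gauss_cdf_ge0 ?gauss_pdf_le_peak
  ?gauss_cdf_le1// lern1 leq_b1.
Qed.

Lemma integrable_stay_term a v u i j k : 0 < v -> (i < 3)%N -> (j < 3)%N ->
  (a <= N)%N -> (k <= N)%N ->
  P.-integrable setT (EFin \o (fun w => (stay a w)%:R * mid_term v u i j k w)).
Proof.
move=> v0 i3 j3 aN kN.
apply: (integrable_bounded _ (gauss_peak v)); first exact: measurable_stay_term.
by move=> w; rewrite ger0_norm ?stay_term_ge0 ?stay_term_le.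
Qed.

Lemma integrable_stay_det a v u k : 0 < v -> (a <= N)%N -> (k <= N)%N ->
  P.-integrable setT (EFin \o (fun w => (stay a w)%:R * pulled_det v u k w)).
Proof.
move=> v0 aN kN.
have -> : (fun w => (stay a w)%:R * pulled_det v u k w) =
    (fun w => alternating (fun i j => (stay a w)%:R * mid_term v u i j k w)).
  by apply/funext => w; rewrite pulled_detE.
apply: integrable_alternating => // i j i3 j3 _.
exact: integrable_stay_term.
Qed.

Lemma expected_det_alternating a v u k : 0 < v -> (a <= N)%N -> (k <= N)%N ->
  \int[P]_w ((stay a w)%:R * pulled_det v u k w)
  = alternating (fun i j => \int[P]_w ((stay a w)%:R * mid_term v u i j k w)).
Proof.
move=> v0 aN kN; rewrite -Rintegral_alternating//; last first.
  by move=> i j i3 j3 _; exact: integrable_stay_term.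
by apply: eq_Rintegral => w _; exact: pulled_detE.
Qed.

(** Without killing at the new time, each term is a pdf in one walk times a cdf in another. Their
    increments are independent, and each convolution raises the variance by [D]. *)
Lemma expected_det_step k v u : (k < N)%N -> 0 < v ->
  \int[P]_w ((stay k w)%:R * pulled_det v u k.+1 w)
  = \int[P]_w ((stay k w)%:R * pulled_det (v + D) u k w).
Proof.
move=> kN v0; have vD0 : 0 < v + D by rewrite addr_gt0.
have kN' := ltnW kN.
rewrite [LHS](expected_det_alternating k v u k.+1 v0 kN' kN).
rewrite [RHS](expected_det_alternating k (v + D) u k vD0 kN' kN').
have step i j : (i < 3)%N -> (j < 3)%N -> i != j ->
    \int[P]_w ((stay k w)%:R * mid_term v u i j k.+1 w)
    = \int[P]_w ((stay k w)%:R * mid_term (v + D) u i j k w).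
  move=> i3 j3 ij; rewrite /mid_term /pulled /Rintegral; apply: (congr1 fine).
  have mg (g : R -> R) l : measurable_fun setT g ->
      measurable_fun [set: R] (fun z => g (u - (z + pull l))).
    move=> mg; apply: (measurableT_comp mg); apply: measurable_funB => //.
    exact: measurable_funD.
  apply: (walk_step2 i j k (fun z => gauss_pdf v (u - (z + pull i)))
     (fun z => gauss_cdf v (u - (z + pull j)))
     (fun z => gauss_pdf (v + D) (u - (z + pull i)))
     (fun z => gauss_cdf (v + D) (u - (z + pull j)))) => //.
  - by apply: mg; exact: measurable_gauss_pdf.
  - by apply: mg; exact: measurable_gauss_cdf.
  - by apply: mg; exact: measurable_gauss_pdf.
  - by move=> z; exact: gauss_pdf_ge0.
  - by move=> z; exact: gauss_cdf_ge0.
  - by move=> z; exact: gauss_pdf_ge0.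
  - move=> z; etransitivity; last exact: (integral_gauss_pdf_conv v D _ v0 D0).
    apply: eq_integral => y _.
    by rewrite addrAC opprD addrA.
  - move=> z; etransitivity; last exact: (integral_gauss_cdf_conv v D _ v0 D0).
    apply: eq_integral => y _.
    by rewrite addrAC opprD addrA.
exact: eq_alternating.
Qed.

Definition tail_prob := fine (mu [set z : R | eps / 2 <= `|z|]).

Lemma measurable_tail : measurable [set z : R | eps / 2 <= `|z|].
Proof. by apply: measurable_set_le => //; exact: measurableT_comp. Qed.

Lemma integrable_indic_big i k : (i < 3)%N -> (k < N)%N ->
  P.-integrable setT (EFin \o (fun w => (eps / 2 <= `|xi i k w|)%R%:R : R)).
Proof.
move=> i3 kN; apply: (integrable_bounded _ 1).
  apply: measurable_bool_indic; apply: measurable_set_le => //.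
  by apply: measurableT_comp => //; exact: mxi.
by move=> w; rewrite ger0_norm// lern1 leq_b1.
Qed.

Lemma integrable_big_step k : (k < N)%N -> P.-integrable setT (EFin \o big_step k).
Proof.
move=> kN.
have -> : big_step k = (fun w => (eps / 2 <= `|xi 0 k w|)%R%:R
  + (eps / 2 <= `|xi 1 k w|)%R%:R + (eps / 2 <= `|xi 2 k w|)%R%:R).
  by apply/funext => w; rewrite big_stepE.
by apply: integrable_EFinD => //; [apply: integrable_EFinD => //|];
  exact: integrable_indic_big.
Qed.

Lemma expected_big_step k : (k < N)%N ->
  \int[P]_w big_step k w = 3 * tail_prob.
Proof.
move=> kN; have tail i : (i < 3)%N ->
    \int[P]_w ((eps / 2 <= `|xi i k w|)%R%:R : R) = tail_prob.
  move=> i3; rewrite /Rintegral /tail_prob; congr fine.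
  pose B := [set z : R | eps / 2 <= `|z|].
  transitivity (P (xi i k @^-1` B)).
    rewrite -[X in P X]setIT -integral_indic//; last first.
      by rewrite -[X in measurable X]setTI; apply: mxi => //; exact: measurable_tail.
    apply: eq_integral => w _; rewrite indicE; congr (nat_of_bool _)%:R%:E.
    by apply/idP/idP => [h|/set_mem//]; exact/mem_set.
  rewrite -[X in P X]setTI.
  rewrite (cylinders_indep P 3 N mu xi indep (fun _ _ => false))//.
  - by rewrite probability_setT mul1e.
  - exact: cylindersT.
  - exact: measurable_tail.
under eq_Rintegral do rewrite big_stepE.
rewrite !RintegralD ?tail//; try exact: integrable_indic_big.
- by ring.
- by apply: integrable_EFinD => //; exact: integrable_indic_big.
Qed.

Lemma le_gauss_peak (v w : R) : 0 < v -> v <= w -> gauss_peak w <= gauss_peak v.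
Proof.
move=> v0 vw; have w0 : 0 < w := lt_le_trans v0 vw.
rewrite /gauss_peak /normal_peak !sqr_sqrtr ?(ltW v0) ?(ltW w0)//.
rewrite lef_pV2 ?posrE ?sqrtr_gt0 ?pmulrn_lgt0 ?mulr_gt0 ?pi_gt0//.
by rewrite ler_wsqrtr// lerMn2r/= ler_wpM2r// pi_ge0.
Qed.

Lemma integrable_big_stepZ (a : R) k : (k < N)%N ->
  P.-integrable setT (EFin \o (fun w => a * big_step k w)).
Proof.
move=> kN.
have -> : EFin \o (fun w => a * big_step k w)
  = (fun w => a%:E * (EFin \o big_step k) w)%E by [].
by apply: integrableZl => //; exact: integrable_big_step.
Qed.

Lemma error_step (I J p q r n : R) :
  p * r <= q * r -> I <= J + n * (9 * q * r) ->
  I + 3 * p * (3 * r) <= J + (n + 1) * (9 * q * r).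
Proof. by move=> *; lra. Qed.

(** Steps are removed from the end, each one traded for variance [D] in the determinant. A step
    costs at most [3 * gauss_peak v] times the expected number [3 * tail_prob] of big increments;
    since [v] only grows from [D <= v], the peak is at most [gauss_peak D] throughout. *)
Lemma expected_det_rec k (v u : R) : (k <= N)%N -> D <= v ->
  \int[P]_w ((stay k w)%:R * pulled_det v u k w)
  <= \int[P]_w ((stay 0 w)%:R * pulled_det (v + k%:R * D) u 0 w)
     + k%:R * (9 * gauss_peak D * tail_prob).
Proof.
elim: k v => [|k IH] v kN Dv; first by rewrite !mul0r !addr0.
have v0 : 0 < v := lt_le_trans D0 Dv.
have kN' := ltnW kN.
have t0 : 0 <= tail_prob by rewrite fine_ge0.
have p0 := gauss_peak_gt0 _ v0.
have M0 : 0 <= 3 * gauss_peak v by rewrite mulr_ge0// ltW.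
have Dv' : D <= v + D by rewrite lerDr ltW.
have -> : v + k.+1%:R * D = v + D + k%:R * D by rewrite -natr1; ring.
apply: (@le_trans _ _ (\int[P]_w ((stay k w)%:R * pulled_det v u k.+1 w)
    + 3 * gauss_peak v * (3 * tail_prob))).
  rewrite -(expected_big_step k kN) -RintegralZl//; last exact: integrable_big_step.
  rewrite -RintegralD//; last 2 first.
  - exact: integrable_stay_det.
  - exact: integrable_big_stepZ.
  apply: le_Rintegral => //.
  - exact: integrable_stay_det.
  - apply: integrable_EFinD => //; first exact: integrable_stay_det.
    exact: integrable_big_stepZ.
  - move=> w _; apply: pull_supersolution => // [|h1 h2].
      exact: mid_det_ge.
    have [] := andP (mid_det_bounds v (u - pulled 0 k.+1 w)
      (u - pulled 1 k.+1 w) (u - pulled 2 k.+1 w) v0 _ _) => //.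
    + by rewrite lerB.
    + by rewrite lerB.
have step : \int[P]_w ((stay k w)%:R * pulled_det v u k.+1 w)
    <= \int[P]_w ((stay k w)%:R * pulled_det (v + D) u k w).
  by rewrite le_eqVlt; apply/orP; left; apply/eqP; exact: expected_det_step.
have pq : gauss_peak v * tail_prob <= gauss_peak D * tail_prob.
  by rewrite ler_wpM2r// le_gauss_peak.
rewrite -[k.+1%:R]natr1; apply: error_step => //.
exact: (le_trans step (IH (v + D) kN' Dv')).
Qed.

(** At time 0 the positions are deterministic, and the shift by [eps] widens the three gaps by
    [eps], [eps] and [2 * eps]. *)
Lemma expected_det_le k (v u : R) : (k <= N)%N -> D <= v -> x 0 < x 1 -> x 1 < x 2 ->
  \int[P]_w ((stay k w)%:R * pulled_det v u k w)
  <= gauss_peak (v + k%:R * D) ^+ 2 / (v + k%:R * D)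
       * ((x 1 - x 0 + eps) * (x 2 - x 1 + eps) * (x 2 - x 0 + 2 * eps))
     + k%:R * (9 * gauss_peak D * tail_prob).
Proof.
move=> kN Dv x01 x12; apply: (le_trans (expected_det_rec _ _ _ kN Dv)).
rewrite lerD2r; set v' := v + _.
have v0 : 0 < v'.
  by apply: ltr_wpDr; [rewrite mulr_ge0// ltW|exact: lt_le_trans D0 Dv].
have -> : (fun w => (stay 0 w)%:R * pulled_det v' u 0 w) =
   (fun=> mid_det v' (u - (x 0 - eps)) (u - x 1) (u - (x 2 + eps))).
  apply/funext => w; rewrite /pulled_det /pulled /= /ordered !walk0 x01 x12.
  by rewrite /pull mul0r mul1r addr0 mul1r.
rewrite Rintegral_cst// (_ : fine (P setT) = 1); last by rewrite probability_setT.
rewrite mulr1.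
have [||_] := andP (mid_det_bounds v' (u - (x 0 - eps)) (u - x 1)
  (u - (x 2 + eps)) v0 _ _).
- by rewrite lerB// ltW// (lt_trans x12)// ltrDl.
- by rewrite lerB// lerBlDr ltW// (lt_trans x01)// ltrDl.
move/le_trans; apply; rewrite le_eqVlt; apply/orP; left; apply/eqP.
by congr (_ * _); ring.
Qed.

Lemma integral_le_indic (z : R) :
  (\int[mu]_y (((y <= z)%R%:R : R)%:E) = (gauss_cdf D z)%:E)%E.
Proof.
rewrite gauss_cdfE -[X in normal_prob _ _ X]setIT -integral_indic//.
apply: eq_integral => y _; rewrite indicE; congr (nat_of_bool _)%:R%:E.
by apply/idP/idP => [h|/set_mem]; [apply/mem_set; rewrite /= in_itv|
  rewrite /= in_itv].
Qed.

Variable A : set R.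
Hypothesis mA : measurable A.

(** The term of the determinant for zero remaining variance: the distribution function degenerates
    to the indicator of the order of walks [i] and [j], and the density is integrated over [A]. The
    last step of the walks smooths it into [mid_term D]. *)
Definition end_term m i j w : R :=
  \1_A (pulled i m w) * (pulled j m w <= pulled i m w)%R%:R.

Lemma integral_end_term_cdf m i j : (m < N)%N -> (i < 3)%N -> (j < 3)%N ->
  i != j ->
  (\int[P]_w ((stay m w)%:R * end_term m.+1 i j w)%:E
   = \int[P]_w ((stay m w)%:R * (\1_A (pulled i m.+1 w)
       * gauss_cdf D (pulled i m.+1 w - pulled j m w)))%:E)%E.
Proof.
move=> mN i3 j3 ij.
pose c1 := fun i' k' : nat => (k' < m)%N || (i' == i) && (k' == m).
have mstay : measurable_fun [set: past c1] (fun w => (stay m w)%:R : R).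
  by apply: measurable_past_stay => [|i' k' k'k]; [exact: ltnW|rewrite /c1 k'k].
have mpi : measurable_fun [set: past c1] (pulled i m.+1).
  apply: measurable_funD => //; apply: measurable_past_walk => // k'.
  rewrite ltnS leq_eqVlt /c1.
  by move=> /orP[/eqP ->|->//]; rewrite !eqxx orbT.
pose F (p : past c1 * measurableTypeR R) : R :=
  (stay m p.1)%:R * (\1_A (pulled i m.+1 p.1)
     * (p.2 + pull j <= pulled i m.+1 p.1)%R%:R).
apply: (walk_step c1 j m F) => //.
- by rewrite /c1 ltnn eq_sym (negbTE ij).
- by move=> k' k'k; rewrite /c1 k'k.
- apply: measurable_funM; first exact: (measurableT_comp mstay measurable_fst).
  apply: measurable_funM.
    apply: (measurableT_comp (measurable_indic mA)).
    exact: (measurableT_comp mpi measurable_fst).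
  apply: measurable_bool_indic; apply: measurable_set_le.
    by apply: measurable_funD => //; exact: measurable_snd.
  exact: (measurableT_comp mpi measurable_fst).
- by move=> p; rewrite !mulr_ge0.
- move=> w; under eq_integral do rewrite /F/= mulrA EFinM.
  rewrite ge0_integralZl//=.
  + rewrite [in RHS]mulrA [in RHS]EFinM; congr (_ * _)%E.
    rewrite -integral_le_indic.
    apply: eq_integral => y _; congr (nat_of_bool _)%:R%:E.
    by rewrite /pulled [in RHS]lerBrDr addrCA addrA.
  + apply/measurable_EFinP; apply: measurable_bool_indic.
    apply: measurable_set_le => //; apply: measurable_funD => //.
    exact: measurable_funD.
Qed.

(** With the last increment of walk [j] already averaged into a cdf, integrating the last increment
    of walk [i] and substituting its final position for [u] yields the pdf factor. *)
Lemma integral_end_term_pdf m i j : (m < N)%N -> (i < 3)%N -> (j < 3)%N ->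
  i != j ->
  (\int[P]_w ((stay m w)%:R * (\1_A (pulled i m.+1 w)
       * gauss_cdf D (pulled i m.+1 w - pulled j m w)))%:E
   = \int[P]_w \int[lebesgue_measure]_u
       (\1_A u * ((stay m w)%:R * mid_term D u i j m w))%:E)%E.
Proof.
move=> mN i3 j3 ij; have mN' := ltnW mN.
pose c0 := fun i' k' : nat => (k' < m)%N.
have mstay : measurable_fun [set: past c0] (fun w => (stay m w)%:R : R).
  exact: measurable_past_stay.
have mpj : measurable_fun [set: past c0] (pulled j m).
  by apply: measurable_funD => //; exact: measurable_past_walk.
have mB b : measurable_fun [set: measurableTypeR R]
    (fun y : measurableTypeR R => \1_A (y + b) : R).
  by apply: (measurableT_comp (measurable_indic mA)); exact: measurable_funD.
pose F (p : past c0 * measurableTypeR R) : R :=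
  (stay m p.1)%:R * (\1_A (p.2 + pull i)
     * gauss_cdf D (p.2 + pull i - pulled j m p.1)).
apply: (walk_step c0 i m F) => //.
- by rewrite /c0 ltnn.
- apply: measurable_funM; first exact: (measurableT_comp mstay measurable_fst).
  apply: measurable_funM; first exact: (measurableT_comp (mB _) measurable_snd).
  apply: (measurableT_comp (measurable_gauss_cdf D D0)).
  apply: measurable_funB; last exact: (measurableT_comp mpj measurable_fst).
  by apply: measurable_funD => //; exact: measurable_snd.
- by move=> p; rewrite !mulr_ge0// gauss_cdf_ge0.
- move=> w; pose sh (y : R) : R := walk i m w + y + pull i.
  have msh : measurable_fun setT sh.
    by apply: measurable_funD => //; exact: measurable_funD.
  pose g (y : R) : R := (stay m w)%:R
    * (\1_A (sh y) * gauss_cdf D (sh y - pulled j m w)).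
  have mg : measurable_fun setT g.
    apply: measurable_funM; first exact: measurable_cst.
    apply: measurable_funM; first exact: (measurableT_comp (measurable_indic mA)).
    apply: (measurableT_comp (measurable_gauss_cdf D D0)).
    exact: measurable_funB.
  have g0 y : 0 <= g y by rewrite !mulr_ge0// gauss_cdf_ge0.
  have g1 y : g y <= 1.
    rewrite -[leRHS]mul1r -[X in _ <= _ * X]mul1r /g indicE.
    by rewrite !ler_pM ?mulr_ge0 ?gauss_cdf_ge0 ?gauss_cdf_le1 ?lern1 ?leq_b1.
  transitivity (\int[mu]_y (g y)%:E)%E; first by [].
  rewrite integral_normal_prob//; last first.
    by exists 1 => y; rewrite ger0_norm.
  pose f (u : R) := (\1_A u * ((stay m w)%:R * mid_term D u i j m w))%:E.
  have mf : measurable_fun [set: R] f.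
    apply/measurable_EFinP; apply: measurable_funM; first exact: measurable_indic.
    apply: measurable_funM => //; apply: measurable_funM;
      (apply: measurableT_comp; [exact: measurable_gauss_pdf ||
        exact: measurable_gauss_cdf|exact: measurable_funB]).
  rewrite -[RHS](ge0_integral_shift f (pulled i m w))//; last first.
    by move=> u; rewrite lee_fin mulr_ge0// stay_term_ge0.
  apply: eq_integral => y _; rewrite /g /f /mid_term; congr EFin.
  rewrite addrK -/(gauss_pdf D y) /sh.
  have -> : walk i m w + y + pull i = y + pulled i m w.
    by rewrite /pulled addrAC addrC.
  rewrite [X in X * _]mulrCA -!mulrA; congr (_ * (_ * _)); exact: mulrC.
Qed.

Hypothesis finA : (lebesgue_measure A < +oo)%E.

Lemma measurable_stay_term_pair v i j m : 0 < v -> (i < 3)%N -> (j < 3)%N ->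
  (m <= N)%N ->
  measurable_fun [set: T * measurableTypeR R]
    (fun p => (stay m p.1)%:R * mid_term v p.2 i j m p.1).
Proof.
move=> v0 i3 j3 mN.
have mpull l : (l < 3)%N -> measurable_fun [set: T * measurableTypeR R]
    (fun p => p.2 - pulled l m p.1).
  move=> l3; apply: measurable_funB; first exact: measurable_snd.
  exact: (measurableT_comp (measurable_pulled _ _ l3 mN) measurable_fst).
apply: measurable_funM.
  exact: (measurableT_comp (measurable_stay _ mN) measurable_fst).
apply: measurable_funM.
  exact: (measurableT_comp (measurable_gauss_pdf v) (mpull _ i3)).
exact: (measurableT_comp (measurable_gauss_cdf v v0) (mpull _ j3)).
Qed.

Definition expected_term v i j m u :=
  \int[P]_w ((stay m w)%:R * mid_term v u i j m w).

Lemma expected_termE v i j m u : 0 < v -> (i < 3)%N -> (j < 3)%N ->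
  (m <= N)%N -> ((expected_term v i j m u)%:E =
  \int[P]_w ((stay m w)%:R * mid_term v u i j m w)%:E)%E.
Proof.
move=> v0 i3 j3 mN; rewrite /expected_term fineK//.
by apply: integrable_fin_num => //; exact: integrable_stay_term.
Qed.

Lemma expected_term_ge0 v i j m u : 0 <= expected_term v i j m u.
Proof. by apply: Rintegral_ge0 => w _; exact: stay_term_ge0. Qed.

Lemma expected_term_le v i j m u : 0 < v -> (i < 3)%N -> (j < 3)%N ->
  (m <= N)%N -> expected_term v i j m u <= gauss_peak v.
Proof.
move=> v0 i3 j3 mN.
have -> : gauss_peak v = \int[P]_w gauss_peak v.
  rewrite Rintegral_cst// (_ : fine (P setT) = 1) ?mulr1//.
  by rewrite probability_setT.
apply: le_Rintegral => //; first exact: integrable_stay_term.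
  by apply: (integrable_bounded _ `|gauss_peak v|).
by move=> w _; exact: stay_term_le.
Qed.

Lemma measurable_expected_term v i j m : 0 < v -> (i < 3)%N -> (j < 3)%N ->
  (m <= N)%N -> measurable_fun [set: measurableTypeR R] (expected_term v i j m).
Proof.
move=> v0 i3 j3 mN; apply/measurable_EFinP.
apply: (eq_measurable_fun (fubini_G P (fun p : T * measurableTypeR R =>
  ((stay m p.1)%:R * mid_term v p.2 i j m p.1)%:E))).
  by move=> u _; rewrite /= expected_termE.
apply: measurable_fun_fubini_tonelli_G.
- apply/measurable_EFinP; exact: measurable_stay_term_pair.
- by move=> p; rewrite lee_fin stay_term_ge0.
Qed.

Lemma integrable_expected_term v i j m : 0 < v -> (i < 3)%N -> (j < 3)%N ->
  (m <= N)%N ->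
  lebesgue_measure.-integrable A (EFin \o expected_term v i j m).
Proof.
move=> v0 i3 j3 mN; apply: measurable_bounded_integrable => //.
  exact: measurable_funS (measurable_expected_term _ _ _ _ v0 i3 j3 mN).
exists (gauss_peak v); split; first exact: num_real.
move=> y My w _; apply: le_trans (ltW My).
by rewrite /= ger0_norm ?expected_term_ge0// expected_term_le.
Qed.

Lemma expected_end_term m i j : (m < N)%N -> (i < 3)%N -> (j < 3)%N -> i != j ->
  \int[P]_w ((stay m w)%:R * end_term m.+1 i j w)
  = \int[lebesgue_measure]_(u in A) expected_term D i j m u.
Proof.
move=> mN i3 j3 ij; rewrite /Rintegral; apply: (congr1 fine).
have mN' := ltnW mN.
rewrite integral_end_term_cdf// integral_end_term_pdf//.
pose f (p : T * measurableTypeR R) :=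
  (\1_A p.2 * ((stay m p.1)%:R * mid_term D p.2 i j m p.1))%:E.
have mf : measurable_fun setT f.
  apply/measurable_EFinP; apply: measurable_funM.
    exact: (measurableT_comp (measurable_indic mA) measurable_snd).
  exact: measurable_stay_term_pair.
have f0 p : (0 <= f p)%E by rewrite lee_fin mulr_ge0// stay_term_ge0.
transitivity (\int[P]_w \int[lebesgue_measure]_u f (w, u))%E; first by [].
rewrite fubini_tonelli// [RHS]integral_mkcond; apply: eq_integral => u _.
rewrite patchE /f/=; under eq_integral do rewrite EFinM.
rewrite ge0_integralZl//=.
- rewrite indicE expected_termE//; case: (u \in A); first by rewrite mul1e.
  by rewrite mul0e.
- by apply/measurable_EFinP; exact: measurable_stay_term.
- by move=> w _; rewrite lee_fin stay_term_ge0.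
Qed.

Lemma alternating_end_term_ge m w :
  - 3 <= alternating (fun i j => end_term m i j w).
Proof.
have b i j : 0 <= end_term m i j w <= 1.
  rewrite /end_term mulr_ge0//= -[leRHS]mul1r indicE.
  by rewrite ler_pM// lern1 leq_b1.
have := b 1%N 0%N; have := b 1%N 2%N; have := b 2%N 1%N; have := b 2%N 0%N.
have := b 0%N 2%N; have := b 0%N 1%N; rewrite /alternating; clear.
move: (end_term m 1 0 w) (end_term m 1 2 w) (end_term m 2 1 w).
move: (end_term m 2 0 w) (end_term m 0 2 w) (end_term m 0 1 w).
by move=> a1 a2 a3 a4 a5 a6; do 6! move=> /andP[? ?]; lra.
Qed.

(** A tie makes two columns of the determinant equal, so it vanishes; for strictly ordered positions
    it is the indicator of the middle one. *)
Lemma alternating_end_term_ge0 m w :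
  pulled 0 m w <= pulled 1 m w -> pulled 1 m w <= pulled 2 m w ->
  0 <= alternating (fun i j => end_term m i j w).
Proof.
rewrite /alternating /end_term.
move: (pulled 0 m w) (pulled 1 m w) (pulled 2 m w) => a b c ab bc.
rewrite ab bc (le_trans ab bc) !mulr1 subrr addr0.
have [ba|ab'] := leP b a.
  have -> : a = b by apply/eqP; rewrite eq_le ab.
  by rewrite mulr1 addrC subrKA subrr.
have [cb|cb] := leP c b.
  have -> : (c <= a) = false by rewrite leNgt (lt_le_trans ab' bc).
  have -> : b = c by apply/eqP; rewrite eq_le bc.
  by rewrite /= mulr1 mulr0 !subrr addr0.
have -> : (c <= a) = false by rewrite leNgt (le_lt_trans ab cb).
by rewrite /= !mulr0 !subr0 addr0 indicE.
Qed.

Lemma alternating_end_term m w :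
  pulled 0 m w < pulled 1 m w -> pulled 1 m w < pulled 2 m w ->
  alternating (fun i j => end_term m i j w) = \1_A (pulled 1 m w).
Proof.
rewrite /alternating /end_term.
move: (pulled 0 m w) (pulled 1 m w) (pulled 2 m w) => a b c ab bc.
rewrite (ltW ab) (ltW bc) (ltW (lt_trans ab bc)) !leNgt ab bc (lt_trans ab bc)/=.
by rewrite !mulr1 !mulr0 subrr !subr0 !addr0.
Qed.

Lemma integrable_stay_end_term m i j : (m < N)%N -> (i < 3)%N -> (j < 3)%N ->
  P.-integrable setT (EFin \o (fun w => (stay m w)%:R * end_term m.+1 i j w)).
Proof.
move=> mN i3 j3; apply: (integrable_bounded _ 1).
  apply: measurable_funM; first by apply: measurable_stay; exact: ltnW.
  have mp l : (l < 3)%N -> measurable_fun setT (pulled l m.+1).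
    by move=> l3; exact: measurable_pulled.
  apply: measurable_funM.
    exact: (measurableT_comp (measurable_indic mA) (mp _ i3)).
  by apply: measurable_bool_indic; apply: measurable_set_le; exact: mp.
move=> w; rewrite /end_term indicE ger0_norm ?mulr_ge0//.
by rewrite !mulr_ile1 ?mulr_ge0 ?lern1 ?leq_b1.
Qed.

Lemma measurable_ordered_walks :
  measurable [set w | stay N w /\ A (walk 1 N w)].
Proof.
have -> : [set w | stay N w /\ A (walk 1 N w)]
  = [set w | stay N w] `&` (walk 1 N @^-1` A) by [].
apply: measurableI.
  have := measurable_stay N (leqnn N) measurableT _ (@measurable_set1 R 1).
  rewrite setTI; congr measurable; apply/seteqP; split => w /=.
    by case: (stay N w) => //= /eqP; rewrite eq_sym oner_eq0.
  by move=> ->.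
rewrite -[X in measurable X]setTI.
exact: (measurable_walk 1 N isT (leqnn N) measurableT A mA).
Qed.

(** The last of the [m.+1] steps turns the terminal indicator into a determinant of variance [D], at
    a cost of [3 * (3 * tail_prob)]. The other [m] steps are handled by the recursion for each fixed
    [u], which is then integrated over [A]. *)
Lemma ordered_walks_bound m : N = m.+1 -> x 0 < x 1 -> x 1 < x 2 ->
  fine (P [set w | stay N w /\ A (walk 1 N w)])
  <= (gauss_peak (D + m%:R * D) ^+ 2 / (D + m%:R * D)
       * ((x 1 - x 0 + eps) * (x 2 - x 1 + eps) * (x 2 - x 0 + 2 * eps))
      + m%:R * (9 * gauss_peak D * tail_prob)) * fine (lebesgue_measure A)
     + 9 * tail_prob.
Proof.
move=> Nm x01 x12; have mN : (m < N)%N by rewrite Nm.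
have mN' := ltnW mN.
pose S := [set w | stay N w /\ A (walk 1 N w)].
have -> : fine (P [set w | stay N w /\ A (walk 1 N w)])
    = \int[P]_w ((stay N w)%:R * \1_A (pulled 1 N w)).
  rewrite /Rintegral; apply: (congr1 fine).
  have mS : measurable S by exact: measurable_ordered_walks.
  rewrite -/S -[X in P X]setIT -integral_indic//; apply: eq_integral => w _.
  rewrite /pulled /pull mul0r addr0 !indicE; congr EFin.
  have -> : (w \in S) = stay N w && (walk 1 N w \in A).
    apply/idP/idP => [/set_mem[-> /mem_set ->]//|/andP[h1 /set_mem h2]].
    exact/mem_set.
  by case: (stay N w); rewrite ?mul0r ?mul1r.
apply: (@le_trans _ _ (\int[P]_w ((stay m w)%:R
    * alternating (fun i j => end_term m.+1 i j w) + 3 * big_step m w))).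
  apply: le_Rintegral => //.
  - apply: (integrable_bounded _ 1).
      apply: measurable_funM; first exact: measurable_stay.
      apply: (measurableT_comp (measurable_indic mA)).
      exact: measurable_pulled.
    move=> w; rewrite indicE ger0_norm ?mulr_ge0//.
    by rewrite mulr_ile1 ?lern1 ?leq_b1.
  - apply: integrable_EFinD => //; last exact: integrable_big_stepZ.
    have -> : (fun w => (stay m w)%:R * alternating (fun i j => end_term m.+1 i j w))
      = (fun w => alternating (fun i j => (stay m w)%:R * end_term m.+1 i j w)).
      by apply/funext => w; exact: mulr_alternating.
    apply: integrable_alternating => // i j i3 j3 _.
    exact: integrable_stay_end_term.
  - move=> w _; rewrite Nm.
    have := pull_supersolution (alternating (fun i j => end_term m.+1 i j w)) 3 m w.
    rewrite ler0n => /(_ isT (alternating_end_term_ge m.+1 w)).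
    move=> /(_ (alternating_end_term_ge0 m.+1 w)).
    apply: le_trans.
    case: (boolP (stay m.+1 w)) => [sw|_]; last by rewrite !mul0r.
    have [h1 h2] := stay_pulled _ _ sw.
    by rewrite alternating_end_term.
rewrite RintegralD//; last 2 first.
- have -> : (fun w => (stay m w)%:R * alternating (fun i j => end_term m.+1 i j w))
    = (fun w => alternating (fun i j => (stay m w)%:R * end_term m.+1 i j w)).
    by apply/funext => w; exact: mulr_alternating.
  apply: integrable_alternating => // i j i3 j3 _.
  exact: integrable_stay_end_term.
- exact: integrable_big_stepZ.
rewrite RintegralZl//; last exact: integrable_big_step.
rewrite expected_big_step//.
have -> : \int[P]_w ((stay m w)%:R * alternating (fun i j => end_term m.+1 i j w))
    = \int[lebesgue_measure]_(u in A)
        alternating (fun i j => expected_term D i j m u).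
  rewrite Rintegral_alternating//; last first.
    by move=> i j i3 j3 _; exact: integrable_expected_term.
  transitivity (alternating (fun i j =>
      \int[P]_w ((stay m w)%:R * end_term m.+1 i j w))).
    rewrite -Rintegral_alternating//.
      by apply: eq_Rintegral => w _; exact: mulr_alternating.
    by move=> i j i3 j3 _; exact: integrable_stay_end_term.
  by apply: eq_alternating => i j i3 j3 ij; exact: expected_end_term.
have -> : 3 * (3 * tail_prob) = 9 * tail_prob by move: tail_prob => r; lra.
rewrite lerD2r -Rintegral_cst//; apply: le_Rintegral => //.
- apply: integrable_alternating => // i j i3 j3 _.
  exact: integrable_expected_term.
- apply: measurable_bounded_integrable => //.
  set K := _ + _; exists `|K|; split; first exact: num_real.
  by move=> y Ky w _; exact: ltW.
- move=> u _; rewrite -expected_det_alternating//.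
  exact: expected_det_le.
Qed.
End Walks.

(** * From walks to Brownian motions *)

Section TailsAndLimits.
Context {R : realType}.

(** The exact factor is the square root of [c], which is at most [c] for [1 <= c]. *)
Lemma gauss_peak_scale (c v : R) : 1 <= c -> 0 < v ->
  gauss_peak v <= c * gauss_peak (c * v).
Proof.
move=> c1 v0; have c0 : 0 < c := lt_le_trans ltr01 c1.
have cv0 : 0 < c * v by exact: mulr_gt0.
rewrite /gauss_peak /normal_peak !sqr_sqrtr ?(ltW v0) ?(ltW cv0)//.
have p0 : 0 < v * pi *+ 2 :> R by rewrite pmulrn_lgt0 ?mulr_gt0 ?pi_gt0.
have -> : c * v * pi *+ 2 = c * (v * pi *+ 2) by rewrite mulrnAr mulrA.
rewrite sqrtrM ?(ltW c0)// invfM mulrA -[leLHS]mul1r ler_wpM2r ?invr_ge0//.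
rewrite -[X in X / _](sqr_sqrtr (ltW c0)) expr2 mulfK ?gt_eqF ?sqrtr_gt0//.
by rewrite -[leLHS]sqrtr1 ler_wsqrtr.
Qed.

(** Half of the exponent is bounded using [e <= |z|]; the other half is the exponent of the Gaussian
    of doubled variance. *)
Lemma gauss_pdf_tail (v e z : R) : 0 < v -> 0 <= e -> e <= `|z| ->
  gauss_pdf v z <= 2 * expR (- (e ^+ 2 / (4 * v))) * gauss_pdf (2 * v) z.
Proof.
move=> v0 e0 ez; have v20 : 0 < 2 * v by rewrite mulr_gt0.
rewrite !gauss_pdfE// mulrACA ler_pM ?expR_ge0 ?(ltW (gauss_peak_gt0 _ v0))//.
  by rewrite gauss_peak_scale// ler1n.
rewrite -expRD ler_expR.
have -> : - (z ^+ 2) / (v *+ 2)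
    = - (z ^+ 2 / (4 * v)) + - z ^+ 2 / ((2 * v) *+ 2).
  by field; rewrite gt_eqF.
rewrite lerD2r lerN2 ler_wpM2r ?invr_ge0 ?mulr_ge0 ?(ltW v0)//.
by rewrite -[leRHS]real_normK ?num_real// lerXn2r ?nnegrE.
Qed.

Lemma tail_prob_le (v e : R) : 0 < v -> 0 < e ->
  tail_prob v e <= 2 * expR (- ((e / 2) ^+ 2 / (4 * v))).
Proof.
move=> v0 e0; have v20 : 0 < 2 * v by rewrite mulr_gt0.
have mB := measurable_tail e.
have e2 : 0 <= e / 2 by rewrite divr_ge0// ltW.
rewrite -lee_fin /tail_prob fineK ?fin_num_measure//.
set B := [set z : R | _]; set M := 2 * _.
have M0 : 0 <= M by rewrite mulr_ge0 ?expR_ge0.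
apply: (@le_trans _ _ (M%:E * normal_prob 0 (Num.sqrt (2 * v)) B)%E); last first.
  by rewrite -[leRHS]mule1 lee_wpmul2l// probability_le1.
rewrite /= /normal_prob -ge0_integralZl//=.
- apply: ge0_le_integral => //.
  + by move=> z _; rewrite lee_fin normal_pdf_ge0.
  + apply/measurable_EFinP; apply: measurable_funTS.
    exact: measurable_normal_pdf.
  + apply/measurable_EFinP; apply: measurable_funTS; apply: measurable_funM => //.
    exact: measurable_normal_pdf.
  + by move=> z Bz; rewrite lee_fin; exact: gauss_pdf_tail.
- apply/measurable_EFinP; apply: measurable_funTS.
  exact: measurable_normal_pdf.
- by move=> z _; rewrite lee_fin normal_pdf_ge0.
Qed.

(** The third power is what the error needs: there are [n] steps, the peak is bounded by a multiple
    of [n.+1], and a factor of order [1 / n] has to remain. *)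
Lemma expRN_le_cube (z : R) : 0 < z -> expR (- z) <= 6 / z ^+ 3.
Proof.
move=> z0; rewrite expRN -[6]invrK -invfM lef_pV2 ?posrE ?expR_gt0//; last first.
  by rewrite mulr_gt0 ?invr_gt0 ?exprn_gt0.
apply: le_trans (expR_ge1Dxn 2 (ltW z0)).
by rewrite mulrC lerDr.
Qed.

(** An Archimedean form of passing to the limit. *)
Lemma le0_of_harmonic (a C : R) : (forall n : nat, a <= C / n.+1%:R) -> a <= 0.
Proof.
move=> aC; rewrite leNgt; apply/negP => a0.
have C0 : 0 < C by have := lt_le_trans a0 (aC 0%N); rewrite divr1.
have := aC (Num.bound (C / a)); rewrite ler_pdivlMr// => h.
have := archi_boundP (divr_ge0 (ltW C0) (ltW a0)); rewrite ltr_pdivrMr// => h2.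
set B := Num.bound _ in h h2.
have Ba : B%:R * a <= a * B.+1%:R by rewrite mulrC ler_wpM2l ?(ltW a0)// ler_nat.
by have := lt_le_trans h2 (le_trans Ba h); rewrite ltxx.
Qed.

(* With step variance [t / (n + 1)], the accumulated chance of a step larger
   than [e / 2] is of order [1 / n]. *)
Lemma tail_prob_harmonic (t e : R) : 0 < t -> 0 < e ->
  exists2 C, 0 <= C & forall n : nat,
    n%:R * (9 * gauss_peak (t / n.+1%:R) * tail_prob (t / n.+1%:R) e)
      <= C / n.+1%:R
    /\ 9 * tail_prob (t / n.+1%:R) e <= C / n.+1%:R.
Proof.
move=> t0 e0; pose a := (e / 2) ^+ 2 / (4 * t).
have a0 : 0 < a by rewrite divr_gt0 ?exprn_gt0 ?divr_gt0 ?mulr_gt0.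
pose q (n : nat) := tail_prob (t / n.+1%:R) e.
have q0 n : 0 <= q n by rewrite fine_ge0.
(* The constant 12 is the factor 2 of [tail_prob_le] times the factor 6 of [expRN_le_cube]. *)
have qle n : q n <= 12 / a ^+ 3 / n.+1%:R ^+ 3.
  have n0 : 0 < n.+1%:R :> R by rewrite ltr0n.
  apply: (le_trans (tail_prob_le _ _ (divr_gt0 t0 n0) e0)).
  have -> : (e / 2) ^+ 2 / (4 * (t / n.+1%:R)) = a * n.+1%:R.
    by rewrite /a; field; rewrite !gt_eqF.
  apply: (@le_trans _ _ (2 * (6 / (a * n.+1%:R) ^+ 3))).
    by rewrite ler_wpM2l// expRN_le_cube// mulr_gt0.
  rewrite le_eqVlt; apply/orP; left; apply/eqP.
  by field; rewrite !gt_eqF.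
pose c := 12 / a ^+ 3.
have c0 : 0 <= c by rewrite divr_ge0// exprn_ge0// ltW.
exists (9 * (gauss_peak t + 1) * c) => [|n].
  rewrite mulr_ge0// mulr_ge0//; apply: addr_ge0 => //.
  by rewrite ltW// gauss_peak_gt0.
have n0 : 0 < n.+1%:R :> R by rewrite ltr0n.
have n1 : 1 <= n.+1%:R :> R by rewrite ler1n.
have pk0 := gauss_peak_gt0 _ t0.
have pk1 := gauss_peak_gt0 _ (divr_gt0 t0 n0).
have pk : gauss_peak (t / n.+1%:R) <= n.+1%:R * gauss_peak t.
  have := gauss_peak_scale n.+1%:R (t / n.+1%:R) n1 (divr_gt0 t0 n0).
  by rewrite [n.+1%:R * (t / _)]mulrC divfK// gt_eqF.
split.
  apply: (@le_trans _ _ (n.+1%:R * (9 * (n.+1%:R * gauss_peak t)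
      * (c / n.+1%:R ^+ 3)))).
    apply: ler_pM => //.
    - apply: (mulr_ge0 _ (q0 n)); exact: (mulr_ge0 _ (ltW pk1)).
    - by rewrite ler_nat.
    - apply: ler_pM (q0 n) _ (qle n); first exact: (mulr_ge0 _ (ltW pk1)).
      by rewrite ler_wpM2l.
  apply: (@le_trans _ _ (9 * gauss_peak t * c / n.+1%:R)).
    rewrite le_eqVlt; apply/orP; left; apply/eqP.
    by field; rewrite !gt_eqF.
  rewrite ler_wpM2r ?invr_ge0// ?(ltW n0)// ler_wpM2r// ler_wpM2l//.
  by rewrite lerDl.
apply: (@le_trans _ _ (9 * (c / n.+1%:R ^+ 3))).
  by rewrite ler_wpM2l//; exact: qle.
rewrite mulrA; apply: ler_pM.
- by rewrite mulr_ge0.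
- by rewrite invr_ge0 exprn_ge0// ltW.
- by rewrite ler_wpM2r// -[leLHS]mulr1 ler_wpM2l// lerDr ltW.
- by rewrite lef_pV2 ?posrE ?exprn_gt0// -[leLHS]expr1 ler_weXn2l.
Qed.

End TailsAndLimits.

Lemma absorb_error {R : realType} (p q L e f g : R) :
  p <= (q + e) * L + f -> e * L <= g * L -> f <= g -> p - q * L <= g * L + g.
Proof. by rewrite mulrDl => *; lra. Qed.

(** Every power of [e] beyond the constant term is at most [e], and the sum of all coefficients is
    the value at [e = 1]. *)
Lemma mul3_perturb {R : realType} (u v z e : R) :
  0 <= u -> 0 <= v -> 0 <= z -> 0 <= e -> e <= 1 ->
  (u + e) * (v + e) * (z + 2 * e)
  <= u * v * z + (u + 1) * (v + 1) * (z + 2) * e.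
Proof.
move=> u0 v0 z0 e0 e1.
have uv := mulr_ge0 u0 v0; have uz := mulr_ge0 u0 z0; have vz := mulr_ge0 v0 z0.
have uvz := mulr_ge0 uv z0; have ee : e * e <= e by rewrite ler_piMl.
have h (a : R) : 0 <= a -> a * (e * e) <= a * e by move=> a0; rewrite ler_wpM2l.
have eee : e * e * e <= e by rewrite (le_trans _ ee)// ler_piMr// mulr_ge0.
have := h _ u0; have := h _ v0; have := h _ z0; have := mulr_ge0 uvz e0.
nra.
Qed.

(** * Brownian motions that stay ordered *)

Section Noncolliding.
Context {R : realType}.
Variables (t a b c : R).
Hypotheses (t0 : 0 < t) (ab : a < b) (bc : b < c).
Context {d} {T : measurableType d} (P : probability T R).
Variables (W : nat -> R -> T -> R) (A : set R) (S : set T).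
Hypothesis BM : independent_BMs P [:: a; b; c] W.
Hypotheses (mA : measurable A) (finA : (lebesgue_measure A < +oo)%E).
Hypothesis mS : measurable S.
Hypothesis SA : S `<=` [set w |
  (forall s, 0 <= s <= t -> W 0 s w < W 1 s w /\ W 1 s w < W 2 s w)
  /\ A (W 1 t w)].

(** There are [n.+1] steps: [n] for the recursion and one to smooth the terminal indicator. *)
Let step (n : nat) : R := t / n.+1%:R.
Let xi (n i k : nat) (w : T) : measurableTypeR R :=
  W i (k.+1%:R * step n) w - W i (k%:R * step n) w.
Let x (i : nat) : R := [:: a; b; c]`_i.

Let step_gt0 n : 0 < step n.
Proof. by rewrite divr_gt0// ltr0n. Qed.

Let walk_path n i k w : (i < 3)%N -> walk (xi n) x i k w = W i (k%:R * step n) w.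
Proof.
move=> i3; rewrite /walk telescope_sumr//.
case: BM => _ W0 _ _.
by rewrite mul0r W0// addrC subrK.
Qed.

Let noncolliding_step (n : nat) (eps : R) : 0 < eps ->
  fine (P S) <= (gauss_peak t ^+ 2 / t
       * ((b - a + eps) * (c - b + eps) * (c - a + 2 * eps))
      + n%:R * (9 * gauss_peak (step n) * tail_prob (step n) eps))
        * fine (lebesgue_measure A)
     + 9 * tail_prob (step n) eps.
Proof.
move=> eps0; case: (BM) => mW W0 cW indW.
have mxi i k : (i < 3)%N -> (k < n.+1)%N -> measurable_fun setT (xi n i k).
  move=> i3 kn; apply: measurable_funB; apply: mW => //;
    by rewrite mulr_ge0// ltW.
have ind B : (forall i k, measurable (B i k)) ->
    P (cylinder 3 n.+1 (xi n) B)
    = (\prod_(0 <= i < 3) \prod_(0 <= k < n.+1)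
         normal_prob 0 (Num.sqrt (step n)) (B i k))%E.
  move=> mB.
  have s0 : 0 <= 0%:R * step n by rewrite mul0r.
  have sS k : (k < n.+1)%N -> k%:R * step n < k.+1%:R * step n.
    by move=> _; rewrite ltr_pM2r// ltr_nat.
  have -> : cylinder 3 n.+1 (xi n) B = [set w | forall i k : nat,
      (i < size [:: a; b; c])%N -> (k < n.+1)%N ->
      B i k (W i (k.+1%:R * step n) w - W i (k%:R * step n) w)].
    by apply/seteqP; split => w h i k; exact: h.
  rewrite (indW n.+1 (fun k => k%:R * step n) B s0 sS mB).
  apply: eq_bigr => i _; apply: eq_bigr => k _.
  rewrite (_ : k.+1%:R * step n - k%:R * step n = step n); first by [].
  by rewrite -natr1 mulrDl mul1r addrC addKr.
have stepE : step n + n%:R * step n = t.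
  by rewrite -[X in X + _]mul1r -mulrDl nat1r mulrC divfK// pnatr_eq0.
have := ordered_walks_bound P n.+1 (step n) (xi n) x (step_gt0 n) mxi ind eps eps0
  A mA finA n erefl ab bc.
rewrite stepE; apply: le_trans.
have mO := measurable_ordered_walks n.+1 (xi n) x mxi A mA.
apply: fine_le; [exact: fin_num_measure|exact: (fin_num_measure P _ mO)|].
apply: le_measure; rewrite ?inE; [exact: mS|exact: mO|].
move=> w /SA[h Aw]; split; last first.
  by rewrite /= walk_path// /step mulrC divfK// pnatr_eq0.
have ord k : (k <= n.+1)%N -> ordered (xi n) x k w.
  move=> kn; rewrite /ordered !walk_path//.
  have [|-> ->//] := h (k%:R * step n).
  rewrite mulr_ge0 ?(ltW (step_gt0 n))//= /step mulrA ler_pdivrMr ?ltr0n//.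
  by rewrite mulrC ler_pM2l// ler_nat.
elim: {-2}n.+1 (leqnn n.+1) => [|k IH] kn /=; rewrite ord//=.
by apply: IH; exact: ltnW.
Qed.

(** Paths ordered at all times are ordered on every grid, so [S] lies in each grid event. Working
    with a measurable subset [S] avoids the measurability of the event over all times. For fixed
    [eps] the tail errors vanish as [n] grows; only then is [eps] sent to 0 along the values
    [1 / n.+1]. *)
Lemma noncolliding_bound :
  fine (P S) <= gauss_peak t ^+ 2 / t * ((b - a) * (c - b) * (c - a))
                * fine (lebesgue_measure A).
Proof.
set K := gauss_peak t ^+ 2 / t; set L := fine (lebesgue_measure A).
have K0 : 0 <= K by rewrite divr_ge0 ?exprn_ge0 ?ltW ?gauss_peak_gt0.
have L0 : 0 <= L by rewrite fine_ge0.
have eps_bound (eps : R) : 0 < eps -> fine (P S)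
    <= K * ((b - a + eps) * (c - b + eps) * (c - a + 2 * eps)) * L.
  move=> eps0; rewrite -subr_le0.
  have [C C0 hC] := tail_prob_harmonic t eps t0 eps0.
  apply: (@le0_of_harmonic _ _ (C * L + C)) => n.
  have [h1 h2] := hC n.
  have -> : (C * L + C) / n.+1%:R = C / n.+1%:R * L + C / n.+1%:R.
    by rewrite mulrDl mulrAC.
  apply: absorb_error (ler_wpM2r L0 h1) h2.
  exact: noncolliding_step n eps eps0.
set u := b - a; set v := c - b; set z := c - a.
have [u0 v0 z0] : [/\ 0 <= u, 0 <= v & 0 <= z].
  by rewrite !subr_ge0 !ltW//; exact: lt_trans bc.
rewrite -subr_le0.
apply: (@le0_of_harmonic _ _ (K * ((u + 1) * (v + 1) * (z + 2)) * L)) => n.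
set e : R := n.+1%:R^-1.
have e0 : 0 < e by rewrite invr_gt0 ltr0n.
have e1 : e <= 1 by rewrite invf_le1 ?ltr0n// ler1n.
rewrite lerBlDr; apply: (le_trans (eps_bound e e0)).
apply: (@le_trans _ _
  (K * (u * v * z + (u + 1) * (v + 1) * (z + 2) * e) * L)).
  rewrite ler_wpM2r// ler_wpM2l//.
  exact: (mul3_perturb _ _ _ _ u0 v0 z0 (ltW e0) e1).
rewrite le_eqVlt; apply/orP; left; apply/eqP.
by move: K L u v z e {K0 L0 eps_bound u0 v0 z0 e0 e1} => K L u v z e; ring.
Qed.

End Noncolliding.

(** * Coalescing Brownian motions *)

Section ContinuousPaths.
Context {R : realType}.
Implicit Types (f g h : R -> R) (s t r : R).

Lemma path_continuousP f :
  {within `[0, +oo[, continuous f} <->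
  (forall x, 0 <= x -> forall e, 0 < e -> exists2 del, 0 < del &
     forall y, 0 <= y -> `|y - x| < del -> `|f y - f x| < e).
Proof.
rewrite subspace_continuousP; split => [cf x x0 e e0|cf x].
  have : `[0, +oo[%classic x by rewrite /= in_itv/= x0.
  move=> /cf/cvgrPdistC_lt/(_ e e0)/nbhs_ballP[del /= del0 h].
  exists del => // y y0 xy; apply: h => /=; last by rewrite in_itv/= y0.
  by rewrite /ball/= distrC.
rewrite /= in_itv/= andbT => x0; apply/cvgrPdistC_lt => e e0.
have [del del0 h] := cf x x0 e e0.
apply/nbhs_ballP; exists del => //= y; rewrite /ball/= distrC => xy.
by rewrite in_itv/= andbT => y0; exact: h.
Qed.

Lemma path_continuous_itv f s :
  {within `[0, +oo[, continuous f} -> {within `[0, s], continuous f}.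
Proof.
apply: continuous_subspaceW => r /=; rewrite !in_itv/=.
by move=> /andP[-> _].
Qed.

Lemma path_continuousB f g :
  {within `[0, +oo[, continuous f} -> {within `[0, +oo[, continuous g} ->
  {within `[0, +oo[, continuous (fun s => f s - g s)}.
Proof. exact: within_continuousB. Qed.

Lemma path_continuousM f g :
  {within `[0, +oo[, continuous f} -> {within `[0, +oo[, continuous g} ->
  {within `[0, +oo[, continuous (fun s => f s * g s)}.
Proof. by move=> cf cg x; apply: cvgM; [exact: cf|exact: cg]. Qed.

(** The zeros of a continuous path form a closed set: were [f tau] nonzero, zeros close to the
    infimum would contradict continuity. *)
Lemma inf_zero f t : {within `[0, +oo[, continuous f} ->
  (exists2 s, 0 <= s <= t & f s = 0) ->
  let tau := inf [set s | 0 <= s <= t /\ f s = 0] in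
  [/\ 0 <= tau <= t, f tau = 0 &
      forall s, 0 <= s <= t -> f s = 0 -> tau <= s].
Proof.
move=> /path_continuousP cf [s0 s0t fs0]; set Z := [set s | _] => tau.
have Z0 : Z !=set0 by exists s0.
have lbZ : has_lbound Z by exists 0 => s [/andP[]].
have tau0 : 0 <= tau by apply: lb_le_inf => // s [/andP[]].
have tau_le s : 0 <= s <= t -> f s = 0 -> tau <= s.
  by move=> st fs; exact: ge_inf.
split => //.
  by rewrite tau0 (le_trans (tau_le _ s0t fs0))//; case/andP: s0t.
apply/eqP/negP => /negP ft0.
have ft : 0 < `|f tau| by rewrite normr_gt0.
have [del del0 h] := cf tau tau0 _ ft.
have [s [/andP[s1 s2] fs] sdel] := inf_adherent del0 (conj Z0 lbZ).
have := h _ s1; rewrite fs sub0r normrN ltxx ger0_norm ?subr_ge0 ?tau_le ?s1//.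
by rewrite ltrBlDl => /(_ sdel).
Qed.

Lemma no_zero_sign f s : {within `[0, +oo[, continuous f} -> 0 < f 0 -> 0 <= s ->
  (forall r, 0 <= r <= s -> f r <> 0) -> 0 < f s.
Proof.
move=> cf f0 s0 nz; rewrite ltNge; apply/negP => fs.
have [|c] := @IVT R f 0 s 0 s0 (path_continuous_itv _ s cf).
  by rewrite ge_min fs orbT le_max (ltW f0).
by rewrite in_itv/= => /nz.
Qed.

End ContinuousPaths.

(** * Measurability of hitting events *)

Section Hitting.
Context {R : realType} {d} {T : measurableType d}.
Variable f : R -> T -> R.
Hypothesis mf : forall r, 0 <= r -> measurable_fun setT (f r).
Hypothesis cf : forall w, {within `[0, +oo[, continuous (f ^~ w)}.

(** Reduces an uncountable union over times to countably many grid points. A zero is approximated by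
    continuity; conversely, without a zero the minimum of the absolute value over the compact
    interval is positive. *)
Lemma hit_approx s w : 0 <= s ->
  (exists r, 0 <= r <= s /\ f r w = 0) <->
  (forall n : nat, exists m i : nat,
     (i <= m)%N /\ `|f (s * (i%:R / m%:R)) w| < n.+1%:R^-1).
Proof.
move=> s0; split.
  move=> [r [/andP[r0 rs] fr]] n.
  have /path_continuousP/(_ r r0) c := cf w.
  have [|del del0 h] := c n.+1%:R^-1; first by rewrite invr_gt0 ltr0n.
  have [s00|sn0] := eqVneq s 0.
    exists 0%N, 0%N; split => //; rewrite s00 mul0r.
    have -> : 0 = r by apply/eqP; rewrite eq_le r0 -s00.
    by rewrite fr normr0 invr_gt0 ltr0n.
  have sp : 0 < s by rewrite lt_neqAle eq_sym sn0.
  (* The mesh [s / m] is below [del], and [i] is rounded down, so the grid point lies at most one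
     mesh to the left of [r]. *)
  pose m := (Num.bound (s / del)).+1.
  have m0 : 0 < m%:R :> R by rewrite ltr0n.
  have sm : s < del * m%:R.
    rewrite -ltr_pdivrMl// mulrC.
    apply: (lt_le_trans (archi_boundP (divr_ge0 s0 (ltW del0)))).
    by rewrite ler_nat.
  pose i := Num.truncn (r / s * m%:R).
  have q0 : 0 <= r / s * m%:R by rewrite mulr_ge0 ?divr_ge0.
  have /andP[i1 i2] := truncn_itv q0; rewrite -/i in i1 i2.
  exists m, i; split.
    rewrite -(ler_nat R) (le_trans i1)// ler_piMl ?(ltW m0)//.
    by rewrite ler_pdivrMr// mul1r.
  have := h (s * (i%:R / m%:R)); rewrite fr subr0; apply.
    by rewrite mulr_ge0 ?divr_ge0.
  have rsm : s * (r / s * m%:R) = r * m%:R by field.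
  have e1 : s * (i%:R / m%:R) <= r.
    by rewrite mulrA ler_pdivrMr// -rsm ler_pM2l.
  have e2 : r < s * (i%:R / m%:R) + s / m%:R.
    have -> : s * (i%:R / m%:R) + s / m%:R = s * i.+1%:R / m%:R.
      by rewrite -natr1; field; rewrite gt_eqF.
    by rewrite ltr_pdivlMr// -rsm ltr_pM2l.
  have e3 : s / m%:R < del by rewrite ltr_pdivrMr.
  rewrite distrC ger0_norm ?subr_ge0//.
  by move: e1 e2 e3; lra.
move=> h.
have ca : {within `[0, s], continuous (fun r => `|f r w|)}.
  move=> r; apply: cvg_norm; exact: (path_continuous_itv _ s (cf w)).
have [c cs cmin] := EVT_min s0 ca.
exists c; split; first by move: cs; rewrite in_itv.
apply/eqP/negP => /negP fc.
have := h (Num.bound (`|f c w|^-1)) => -[m [i [im]]].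
apply/negP; rewrite -leNgt.
apply: (@le_trans _ _ `|f c w|); last first.
  apply: cmin; rewrite in_itv/= mulr_ge0 ?divr_ge0//= ler_piMr//.
  (* The case [m = 0] is harmless: division by 0 gives 0, so the grid point is the left endpoint. *)
  have [->|m0] := posnP m; first by rewrite invr0 mulr0.
  by rewrite ler_pdivrMr ?ltr0n// mul1r ler_nat.
rewrite invf_ple ?posrE ?ltr0n ?normr_gt0//.
apply/ltW/(lt_le_trans (archi_boundP _)); first by rewrite invr_ge0.
by rewrite ler_nat.
Qed.

Lemma measurable_hit s : 0 <= s ->
  measurable [set w | exists r, 0 <= r <= s /\ f r w = 0].
Proof.
move=> s0.
have -> : [set w | exists r, 0 <= r <= s /\ f r w = 0] =
    \bigcap_n \bigcup_m \bigcup_(i in `I_m.+1)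
      [set w | `|f (s * (i%:R / m%:R)) w| < n.+1%:R^-1].
  apply/seteqP; split => w /=.
    move=> /(hit_approx _ _ s0) h n _; have [m [i [im hi]]] := h n.
    by exists m => //; exists i.
  move=> h; apply/(hit_approx _ _ s0) => n; have [m _ [i im hi]] := h n I.
  by exists m, i.
apply: bigcap_measurable => // n _; apply: bigcup_measurable => m _.
apply: bigcup_measurable => i _; apply: measurable_set_lt => //.
apply: measurableT_comp => //; apply: mf.
by rewrite mulr_ge0 ?divr_ge0.
Qed.

End Hitting.

(** * Continuity and measurability of coalesced paths *)

Section CoalescedPaths.
Context {R : realType}.

Lemma eq_within_continuous (A : set R) (f g : R -> R) :
  (forall x, A x -> f x = g x) ->
  {within A, continuous f} -> {within A, continuous g}.
Proof.
by move=> fg; apply: subspace_eq_continuous => x; rewrite inE; exact: fg.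
Qed.

(** If there is a meeting, the path is glued at the first meeting time [tau]: it follows its own
    motion up to [tau] and the neighbour from [tau] on, and the two agree at [tau]. Without a
    meeting it is its own motion. *)
Lemma coalesced_continuous (w : nat -> R -> R) k :
  (forall j, (j <= k)%N -> {within `[0, +oo[, continuous (w j)}) ->
  {within `[0, +oo[, continuous (coalesced w k)}.
Proof.
elim: k => [|k IH] cw; first by have := cw 0%N; exact.
have cc : {within `[0, +oo[, continuous (coalesced w k)}.
  by apply: IH => j jk; apply: cw; exact: leqW.
have cwk := cw k.+1 (leqnn _).
have ch := path_continuousB _ _ cwk cc.
have [[s0 [s00 ws0]]|nomeet] :=
    pselect (exists s, 0 <= s /\ w k.+1 s = coalesced w k s); last first.
  apply: (eq_within_continuous _ (w k.+1)) cwk => s; rewrite /= in_itv/=.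
  move=> /andP[s0 _]; case: asboolP => // -[r [/andP[r0 _] wr]].
  by exfalso; apply: nomeet; exists r.
have [|/andP[tau0 taus0] htau tau_le] := inf_zero _ s0 ch.
  by exists s0; rewrite ?s00 ?lexx// ws0 subrr.
set tau := inf _ in tau0 taus0 htau tau_le.
have wtau : w k.+1 tau = coalesced w k tau by apply/eqP; rewrite -subr_eq0 htau.
have -> : `[0, +oo[%classic = `[0, tau]%classic `|` `[tau, +oo[%classic.
  apply/seteqP; split => s /=; rewrite !in_itv/= ?andbT.
    by move=> s1; have [st|/ltW ts] := leP s tau; [left; rewrite s1|right].
  by move=> [/andP[]//|]; exact: le_trans.
apply: withinU_continuous.
- exact: interval_closed.
- exact: interval_closed.
- apply: (eq_within_continuous _ (w k.+1)).
    move=> s; rewrite /= in_itv/= => /andP[s1 st].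
    case: asboolP => // -[r [/andP[r0 rs] wr]].
    have tr : tau <= r.
      apply: tau_le; last by rewrite wr subrr.
      by rewrite r0 (le_trans rs)// (le_trans st).
    have -> : s = tau by apply/eqP; rewrite eq_le st (le_trans tr rs).
    by rewrite wtau.
  exact: path_continuous_itv.
- apply: (eq_within_continuous _ (coalesced w k)).
    move=> s; rewrite /= in_itv/= andbT => ts.
    by case: asboolP => // -[]; exists tau; rewrite tau0.
  apply: continuous_subspaceW cc => s /=; rewrite !in_itv/= !andbT.
  exact: le_trans.
Qed.

(** A meeting by time [s] is a zero of the difference with the coalesced neighbour, which is
    continuous, so hitting events apply. *)
Lemma measurable_coalesced d (T : measurableType d) (W : nat -> R -> T -> R) k s :
  (forall j r, (j <= k)%N -> 0 <= r -> measurable_fun setT (W j r)) ->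
  (forall j w, (j <= k)%N -> {within `[0, +oo[, continuous (W j ^~ w)}) ->
  0 <= s ->
  measurable_fun setT (fun w => coalesced (fun j r => W j r w) k s).
Proof.
elim: k s => [|k IH] s mW cW s0 /=; first exact: mW.
have mc r : 0 <= r ->
    measurable_fun setT (fun w => coalesced (fun j r => W j r w) k r).
  move=> r0; apply: IH => // [j r' jk|j w jk].
    by apply: mW; exact: leqW.
  by apply: cW; exact: leqW.
pose f r w := W k.+1 r w - coalesced (fun j r => W j r w) k r.
have mH : measurable [set w | exists r, 0 <= r <= s /\ f r w = 0].
  apply: measurable_hit => // [r r0|w].
    by apply: measurable_funB; [exact: mW|exact: mc].
  apply: path_continuousB; first exact: cW.
  by apply: coalesced_continuous => j jk; apply: cW; exact: leqW.
pose b w := `[< exists r, 0 <= r <= s /\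
  W k.+1 r w = coalesced (fun j r => W j r w) k r >].
have mb : measurable_fun setT (fun w => (b w)%:R : R).
  apply: measurable_bool_indic; move: mH; congr measurable.
  apply/seteqP; split => w /=.
    move=> [r [rs fr]]; apply/asboolP; exists r; split => //.
    by apply/eqP; rewrite -subr_eq0; apply/eqP.
  by move=> /asboolP[r [rs fr]]; exists r; rewrite /f fr subrr.
have -> : (fun w => if b w then coalesced (fun j r => W j r w) k s else W k.+1 s w)
  = (fun w => W k.+1 s w + (b w)%:R *
       (coalesced (fun j r => W j r w) k s - W k.+1 s w)).
  apply/funext => w; case: (b w); rewrite ?mul1r ?mul0r ?addr0//.
  by rewrite addrC subrK.
apply: measurable_funD; first exact: mW.
apply: measurable_funM => //; apply: measurable_funB; first exact: mc.
exact: mW.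
Qed.

End CoalescedPaths.

(** * Laws determined by rectangles *)

Section EqualLaws.
Context {R : realType}.

Lemma measure_eq_rect d1 d2 (T1 : measurableType d1) (T2 : measurableType d2)
    (m1 m2 : {measure set (T1 * T2) -> \bar R}) :
  (m1 setT < +oo)%E ->
  (forall A B, measurable A -> measurable B -> m1 (A `*` B) = m2 (A `*` B)) ->
  forall S, measurable S -> m1 S = m2 S.
Proof.
move=> m1oo m12 S mS.
apply: (@g_sigma_algebra_measure_unique _ R _
  [set A `*` B | A in measurable & B in measurable] _ (fun=> setT)) => //.
- by move=> _ [A mA [B mB <-]]; exact: measurableX.
- by move=> _; exists setT => //; exists setT => //; rewrite setXTT.
- by rewrite bigcup_const.
- move=> _ _ [A mA [B mB <-]] [A' mA' [B' mB' <-]].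
  exists (A `&` A'); first exact: measurableI.
  exists (B `&` B'); first exact: measurableI.
  by rewrite setXI.
- by move=> _ [A mA [B mB <-]]; exact: m12.
- by move: mS; rewrite measurable_prod_measurableType.
Qed.

Context {d d'} {T : measurableType d} {T' : measurableType d'}.
Variables (P : probability T R) (P' : probability T' R).
Variables (Y : nat -> T -> R) (Z : nat -> T' -> R).
Hypothesis mY : forall i, (i < 3)%N -> measurable_fun setT (Y i).
Hypothesis mZ : forall i, (i < 3)%N -> measurable_fun setT (Z i).
Hypothesis YZ : forall B : nat -> set R, (forall k, measurable (B k)) ->
  P [set w | forall k, (k < 3)%N -> B k (Y k w)]
  = P' [set w | forall k, (k < 3)%N -> B k (Z k w)].

(** The definition of the coalescing system gives equality only on rectangles, while inequality of
    two coordinates is not one. The pi-system argument is used twice: for the pair against the third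
    coordinate, then for the first two under the measure restricted to the third lying in [C]. *)
Lemma equal_law3 (S : set (R * R * R)) : measurable S ->
  P [set w | S (Y 0 w, Y 1 w, Y 2 w)] = P' [set w | S (Z 0 w, Z 1 w, Z 2 w)].
Proof.
have mY01 : measurable_fun setT (fun w => (Y 0 w, Y 1 w)).
  by apply/measurable_fun_pairP; split; exact: mY.
have mZ01 : measurable_fun setT (fun w => (Z 0 w, Z 1 w)).
  by apply/measurable_fun_pairP; split; exact: mZ.
have mYY : measurable_fun setT (fun w => (Y 0 w, Y 1 w, Y 2 w)).
  by apply/measurable_fun_pairP; split => //; exact: mY.
have mZZ : measurable_fun setT (fun w => (Z 0 w, Z 1 w, Z 2 w)).
  by apply/measurable_fun_pairP; split => //; exact: mZ.
have YZ3 A B C : measurable A -> measurable B -> measurable C ->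
    P [set w | (A (Y 0 w) /\ B (Y 1 w)) /\ C (Y 2 w)]
    = P' [set w | (A (Z 0 w) /\ B (Z 1 w)) /\ C (Z 2 w)].
  move=> mA mB mC.
  pose D k := if k is k'.+1 then if k' is 0 then B else C else A.
  have := YZ D _; have -> : [set w | forall k, (k < 3)%N -> D k (Y k w)]
      = [set w | (A (Y 0 w) /\ B (Y 1 w)) /\ C (Y 2 w)].
    apply/seteqP; split => w /= => [h|[[h0 h1] h2] [|[|[|]]]//].
    exact: (conj (conj (h 0 isT) (h 1 isT)) (h 2 isT)).
  have -> : [set w | forall k, (k < 3)%N -> D k (Z k w)]
      = [set w | (A (Z 0 w) /\ B (Z 1 w)) /\ C (Z 2 w)].
    apply/seteqP; split => w /= => [h|[[h0 h1] h2] [|[|[|]]]//].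
    exact: (conj (conj (h 0 isT) (h 1 isT)) (h 2 isT)).
  by apply; case=> [|[|k]].
move: S; apply: (@measure_eq_rect _ _ _ _
  (pushforward P (fun w => (Y 0 w, Y 1 w, Y 2 w)))
  (pushforward P' (fun w => (Z 0 w, Z 1 w, Z 2 w)))) => //.
  by rewrite /= /pushforward preimage_setT probability_setT ltry.
move=> S C mS mC.
have mYC : measurable (Y 2 @^-1` C) by rewrite -[X in measurable X]setTI; exact: mY.
have mZC : measurable (Z 2 @^-1` C) by rewrite -[X in measurable X]setTI; exact: mZ.
move: S mS; apply: (@measure_eq_rect _ _ _ _
  (pushforward (mrestr P mYC) (fun w => (Y 0 w, Y 1 w)))
  (pushforward (mrestr P' mZC) (fun w => (Z 0 w, Z 1 w)))).
  rewrite /= /pushforward preimage_setT /mrestr setTI.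
  by rewrite -ge0_fin_numE// fin_num_measure.
by move=> A B mA mB; exact: YZ3.
Qed.

End EqualLaws.

(** * Three coalescing Brownian motions *)

Section CoalescingBound.
Context {R : realType}.
Variables (t a b c : R).
Hypotheses (t0 : 0 < t) (ab : a < b) (bc : b < c).

(** A meeting on [[0, t]] would make two coalesced values equal at [t]. Hence path 1 never meets
    path 0 and remains its own motion, so the neighbour of path 2 is the motion [W 1]; continuity
    preserves the initial order. *)
Lemma coalesced_distinct (W : nat -> R -> R) :
  (forall j, (j < 3)%N -> {within `[0, +oo[, continuous (W j)}) ->
  W 0%N 0 < W 1%N 0 -> W 1%N 0 < W 2%N 0 ->
  coalesced W 0 t <> coalesced W 1 t -> coalesced W 1 t <> coalesced W 2 t ->
  coalesced W 1 t = W 1%N t /\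
  forall s, 0 <= s <= t -> W 0%N s < W 1%N s /\ W 1%N s < W 2%N s.
Proof.
move=> cW W01 W12 h01 h12.
have n01 r : 0 <= r <= t -> W 1%N r <> W 0%N r.
  move=> rt W10; apply: h01; rewrite /=; case: asboolP => // -[].
  by exists r.
have c1 s : 0 <= s <= t -> coalesced W 1 s = W 1%N s.
  move=> /andP[s0 st] /=; case: asboolP => // -[r [/andP[r0 rs] W10]].
  by exfalso; apply: (n01 r) => //; rewrite r0 (le_trans rs).
have n12 r : 0 <= r <= t -> W 2%N r <> W 1%N r.
  move=> rt; rewrite -c1// => W21; apply: h12.
  by rewrite [RHS]/=; case: asboolP => // -[]; exists r.
split; first by rewrite c1// lexx ltW.
move=> s /andP[s0 st]; split; rewrite -subr_gt0.
  apply: (@no_zero_sign _ (fun r => W 1%N r - W 0%N r)) => //.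
  - by apply: path_continuousB; exact: cW.
  - by rewrite subr_gt0.
  - move=> r /andP[r0 rs] /eqP; rewrite subr_eq0 => /eqP.
    by apply: n01; rewrite r0 (le_trans rs).
apply: (@no_zero_sign _ (fun r => W 2%N r - W 1%N r)) => //.
- by apply: path_continuousB; exact: cW.
- by rewrite subr_gt0.
- move=> r /andP[r0 rs] /eqP; rewrite subr_eq0 => /eqP.
  by apply: n12; rewrite r0 (le_trans rs).
Qed.

(** The event is a Borel condition on three values at time [t], so it has the same probability on
    the space of the driving motions, where it forces them to stay ordered. *)
Lemma coalescing_bound d (T : measurableType d) (P : probability T R)
    (Y : nat -> R -> T -> R) (A : set R) :
  coalescing_BMs P [:: a; b; c] Y ->
  (forall i, (i < 3)%N -> measurable_fun setT (Y i t)) ->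
  measurable A -> (lebesgue_measure A < +oo)%E ->
  (P [set w | Y 0%N t w <> Y 1%N t w /\ Y 1%N t w <> Y 2%N t w /\ A (Y 1%N t w)]
   <= (gauss_peak t ^+ 2 / t * ((b - a) * (c - b) * (c - a))
        * fine (lebesgue_measure A))%:E)%E.
Proof.
move=> [d' [T' [P' [W [BM law]]]]] mY mA finA; case: (BM) => mW W0 cW _.
pose Z k w := coalesced (fun j r => W j r w) k t.
have mZ k : (k < 3)%N -> measurable_fun setT (Z k).
  move=> k3; apply: measurable_coalesced; last exact: ltW.
    by move=> j r jk; apply: mW; exact: leq_ltn_trans k3.
  by move=> j w jk; apply: cW; exact: leq_ltn_trans k3.
pose S : set (R * R * R) := [set p | p.1.1 <> p.1.2 /\ p.1.2 <> p.2 /\ A p.1.2].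
have mS : measurable S.
  have m11 : measurable_fun setT (fun p : R * R * R => p.1.1).
    exact: (measurableT_comp measurable_fst measurable_fst).
  have m12 : measurable_fun setT (fun p : R * R * R => p.1.2).
    exact: (measurableT_comp measurable_snd measurable_fst).
  have m2 : measurable_fun setT (fun p : R * R * R => p.2) by exact: measurable_snd.
  apply: measurableI; first exact: measurableC (measurable_set_eq _ _ m11 m12).
  apply: measurableI; first exact: measurableC (measurable_set_eq _ _ m12 m2).
  by rewrite -[X in measurable X]setTI; exact: m12.
have -> : [set w | Y 0%N t w <> Y 1%N t w /\ Y 1%N t w <> Y 2%N t w /\ A (Y 1%N t w)]
  = [set w | S (Y 0%N t w, Y 1%N t w, Y 2%N t w)] by [].
rewrite (equal_law3 P P' (fun i => Y i t) Z mY mZ)//; last first.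
  move=> B mB; apply: (law 3%N id (fun=> t) B) => [k k3|//].
  by split => //; exact: ltW.
set S' := [set w | _].
have mS' : measurable S'.
  have mZZ : measurable_fun setT (fun w => (Z 0%N w, Z 1%N w, Z 2%N w)).
    by apply/measurable_fun_pairP; split; [apply/measurable_fun_pairP; split|];
      exact: mZ.
  by rewrite -[X in measurable X]setTI; exact: mZZ.
rewrite -[leLHS]fineK ?fin_num_measure// lee_fin.
apply: (noncolliding_bound t a b c t0 ab bc P' W A S' BM mA finA mS').
move=> w [h01 [h12 AZ]]; rewrite /= in h01 h12 AZ.
have [|||c1 ord] := coalesced_distinct (fun j r => W j r w) _ _ _ h01 h12.
- by move=> j j3; exact: cW.
- by rewrite !W0.
- by rewrite !W0.
by split => //; rewrite /Z c1 in AZ.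
Qed.

End CoalescingBound.

(** * Counting distinct values *)

Section LowerIntegral.
Context {R : realType} {d} {T : measurableType d}.
Variable mu : {measure set T -> \bar R}.
Implicit Types f g : T -> \bar R.

(* The integral of a nonnegative function is defined as a supremum over simple
   functions, so monotonicity does not require measurability. *)
Lemma le_lower_integral f g :
  (forall w, (0 <= f w)%E) -> (forall w, (f w <= g w)%E) ->
  (\int[mu]_w f w <= \int[mu]_w g w)%E.
Proof.
move=> f0 fg; rewrite !ge0_integralTE//; last first.
  by move=> w; exact: le_trans (f0 w) (fg w).
apply: le_ereal_sup => _ [h hf <-]; exists h => // w.
exact: le_trans (hf w) (fg w).
Qed.

Lemma le_lower_integral_ae f g :
  (forall w, (0 <= f w)%E) -> (forall w, (0 <= g w)%E) -> measurable_fun setT g ->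
  {ae mu, forall w, (f w <= g w)%E} ->
  (\int[mu]_w f w <= \int[mu]_w g w)%E.
Proof.
move=> f0 g0 mg [N [mN N0 fgN]].
pose g' w := if w \in N then +oo%E else g w.
have mg' : measurable_fun setT g'.
  apply: measurable_fun_ifT => //.
  apply: (measurable_fun_bool true); rewrite setTI.
  by rewrite [X in measurable X](_ : _ = N)//; apply/seteqP; split => w /=;
    [move/set_mem|move/mem_set].
apply: (@le_trans _ _ (\int[mu]_w g' w)%E).
  apply: le_lower_integral => // w; rewrite /g'; case: ifPn => [_|/negP wN].
    by rewrite leey.
  by apply: contrapT => fg; apply: wN; apply/mem_set; exact: fgN.
rewrite (ae_eq_integral g)//.
exists N; split => // w /= /not_implyP[_]; rewrite /g'; case: ifPn => //.
by move/set_mem.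
Qed.

(** For the reverse inequality [g] is lowered to 0 on the null set, again with the same integral. *)
Lemma ae_eq_lower_integral f g :
  (forall w, (0 <= f w)%E) -> (forall w, (0 <= g w)%E) -> measurable_fun setT g ->
  {ae mu, forall w, f w = g w} -> (\int[mu]_w f w = \int[mu]_w g w)%E.
Proof.
move=> f0 g0 mg fg; apply/eqP; rewrite eq_le; apply/andP; split.
  apply: le_lower_integral_ae => //.
  by apply: filterS fg => w ->.
case: fg => N [mN N0 fgN].
pose g' w := if w \in N then 0%E else g w.
have mg' : measurable_fun setT g'.
  apply: measurable_fun_ifT => //.
  apply: (measurable_fun_bool true); rewrite setTI.
  by rewrite [X in measurable X](_ : _ = N)//; apply/seteqP; split => w /=;
    [move/set_mem|move/mem_set].
have -> : (\int[mu]_w g w = \int[mu]_w g' w)%E.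
  apply: ae_eq_integral => //.
  exists N; split => // w /= /not_implyP[_]; rewrite /g'; case: ifPn => //.
  by move/set_mem.
apply: le_lower_integral => w; rewrite /g'; case: ifPn => // /negP wN.
rewrite le_eqVlt; apply/orP; left; apply/eqP/esym.
by apply: contrapT => fg; apply: wN; apply/mem_set; exact: fgN.
Qed.

End LowerIntegral.

(** * Sums over distinct values *)

Section DistinctSum.
Context {R : realType}.

Definition distinct_sum (f : R -> R) (vs : seq R) : R := \sum_(v <- undup vs) f v.

Lemma distinct_sum_cons f v vs :
  distinct_sum f (v :: vs) = (v \notin vs)%:R * f v + distinct_sum f vs.
Proof.
rewrite /distinct_sum /=; case: ifPn => _; first by rewrite mul0r add0r.
by rewrite big_cons mul1r.
Qed.

Lemma eq_mem_distinct_sum f vs vs' : vs =i vs' ->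
  distinct_sum f vs = distinct_sum f vs'.
Proof.
move=> vv'; apply: perm_big; apply: uniq_perm; rewrite ?undup_uniq// => v.
by rewrite !mem_undup.
Qed.

Lemma distinct_sum_ge0 f vs : (forall v, 0 <= f v) -> 0 <= distinct_sum f vs.
Proof. by move=> f0; apply: sumr_ge0. Qed.

Lemma distinct_sum_le_size f vs : (forall v, 0 <= f v <= 1) ->
  distinct_sum f vs <= (size vs)%:R.
Proof.
move=> f01; elim: vs => [|v vs IH]; first by rewrite /distinct_sum big_nil.
rewrite distinct_sum_cons /= -nat1r lerD//.
by have /andP[? ?] := f01 v; rewrite mulr_ile1// lern1 leq_b1.
Qed.

Lemma le_distinct_sum f vs vs' : (forall v, 0 <= f v) -> {subset vs <= vs'} ->
  distinct_sum f vs <= distinct_sum f vs'.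
Proof.
move=> f0 vv'.
have -> : distinct_sum f vs' = distinct_sum f (vs ++ vs').
  apply: eq_mem_distinct_sum => v; rewrite mem_cat.
  by case: (boolP (v \in vs)) => // /vv'.
have -> : distinct_sum f (vs ++ vs') = distinct_sum f (vs' ++ vs).
  by apply: eq_mem_distinct_sum => v; rewrite !mem_cat orbC.
elim: vs' {vv'} => //= v vs' IH; rewrite distinct_sum_cons.
by apply: le_trans IH _; rewrite lerDr mulr_ge0.
Qed.

(** If [b] equals [a] or [c] it is already counted, hence it can contribute only when it differs
    from both. *)
Lemma distinct_sum_insert f a b c vs vs' : (forall v, 0 <= f v) ->
  a \in vs -> c \in vs -> vs' =i b :: vs ->
  distinct_sum f vs' <= distinct_sum f vs + ((a != b) && (b != c))%:R * f b.
Proof.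
move=> f0 avs cvs /eq_mem_distinct_sum ->; rewrite distinct_sum_cons addrC lerD2l.
rewrite ler_wpM2r// ler_nat; case: (boolP (b \in vs)) => // bvs.
case: eqVneq => [ab|_]; first by rewrite -ab avs in bvs.
by case: eqVneq => // bc; rewrite bc cvs in bvs.
Qed.

Lemma measurable_distinct_sum d (T : measurableType d) (f : R -> R)
    (I : eqType) (s : seq I) (Y : I -> T -> R) :
  measurable_fun setT f -> {in s, forall i, measurable_fun setT (Y i)} ->
  measurable_fun setT (fun w => distinct_sum f [seq Y i w | i <- s]).
Proof.
move=> mf; elim: s => [|i s IH] mY /=.
  have -> : (fun=> distinct_sum f [::]) = (cst 0 : T -> R).
    by apply/funext => w; rewrite /distinct_sum big_nil.
  exact: measurable_cst.
under eq_fun do rewrite distinct_sum_cons.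
have mYi : measurable_fun setT (Y i) by apply: mY; rewrite mem_head.
have mYs : {in s, forall j, measurable_fun setT (Y j)}.
  by move=> j js; apply: mY; rewrite in_cons js orbT.
apply: measurable_funD; last exact: IH.
apply: measurable_funM; last exact: measurableT_comp.
apply: measurable_bool_indic.
have -> : [set w | Y i w \notin [seq Y j w | j <- s]]
    = ~` [set w | Y i w \in [seq Y j w | j <- s]].
  apply/seteqP; split => w; rewrite /setC/=; first by move/negP => h; exact: h.
  by move=> h; exact/negP.
apply: measurableC; elim: s mYs {IH mY} => [|j s IH] mYs /=.
  by rewrite [X in measurable X](_ : _ = set0)//; apply/seteqP; split.
have -> : [set w | Y i w \in Y j w :: [seq Y j w | j <- s]]
    = [set w | Y i w = Y j w] `|` [set w | Y i w \in [seq Y j w | j <- s]].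
  apply/seteqP; split => w /=; rewrite in_cons.
    by move=> /orP[/eqP|]; [left|right].
  by move=> [->|->]; rewrite ?eqxx ?orbT.
apply: measurableU.
  by apply: measurable_set_eq => //; apply: mYs; rewrite mem_head.
by apply: IH => l ls; apply: mYs; rewrite in_cons ls orbT.
Qed.

End DistinctSum.

(** * Inserting one point into a partition *)

Section Refinement.
Context {R : realType}.
Implicit Types s : seq R.

Definition cube_gaps s : R := \sum_(0 <= j < (size s).-1) (s`_j.+1 - s`_j) ^+ 3.

Lemma gap_sum_pairmap (F : R -> R -> R) (x : R) s :
  \sum_(0 <= j < size s) F (x :: s)`_j (x :: s)`_j.+1
  = \sum_(g <- pairmap F x s) g.
Proof.
rewrite [RHS](big_nth 0) size_pairmap; apply: eq_big_nat => j /andP[_ js].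
by rewrite (nth_pairmap 0).
Qed.

Lemma cube_gaps_cons (x : R) s :
  cube_gaps (x :: s) = \sum_(g <- pairmap (fun a b => (b - a) ^+ 3) x s) g.
Proof. by rewrite -gap_sum_pairmap. Qed.

Lemma cube_gaps_insert (x b c : R) s s' (a := last x s) :
  cube_gaps (x :: s ++ b :: c :: s')
  = cube_gaps (x :: s ++ c :: s') - 3 * ((b - a) * (c - b) * (c - a)).
Proof.
rewrite !cube_gaps_cons !pairmap_cat !big_cat/= !big_cons -/a; ring.
Qed.

(** By cardinality [s'] has a point [b] outside [s], and deleting it from [s'] gives back [s]. Since
    the end points agree, [b] is neither first nor last, so it has neighbours [a] and [c], both in
    [s]. *)
Lemma refinement_insert s s' : (0 < size s)%N ->
  sorted <%R s -> sorted <%R s' -> size s' = (size s).+1 -> {subset s <= s'} ->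
  s`_0 = s'`_0 -> s`_(size s).-1 = s'`_(size s').-1 ->
  exists a b c, [/\ a < b /\ b < c, a \in s /\ c \in s, s' =i b :: s &
    cube_gaps s' = cube_gaps s - 3 * ((b - a) * (c - b) * (c - a))].
Proof.
move=> s0 ss ss' size_s' sub s00 slast.
have us := lt_sorted_uniq ss; have us' := lt_sorted_uniq ss'.
have [b bs' bs] : exists2 b, b \in s' & b \notin s.
  apply: contrapT => nb.
  have : {subset s' <= s}.
    by move=> b bs'; apply: contrapT => /negP bs; apply: nb; exists b.
  by move/(uniq_leq_size us'); rewrite size_s' ltnn.
pose k := index b s'.
have ks' : (k < size s')%N by rewrite index_mem.
have nthk : s'`_k = b by rewrite nth_index.
have s'E : s' = take k s' ++ b :: drop k.+1 s'.
  by rewrite -nthk -drop_nth// cat_take_drop.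
have sE : s = take k s' ++ drop k.+1 s'.
  apply: lt_sorted_eq => //.
    apply: subseq_sorted ss'; first exact: lt_trans.
    rewrite [X in subseq _ X]s'E; apply: cat_subseq => //.
    exact: subseq_cons.
  have [|||h] := @uniq_min_size _ s (take k s' ++ drop k.+1 s') => //.
  - move=> y ys; have := sub y ys; rewrite {1}s'E !mem_cat in_cons.
    case/or3P => [->//|/eqP yb|->]; last by rewrite orbT.
    by rewrite -yb ys in bs.
  - rewrite size_cat size_take size_drop ks' size_s' subSS.
    by rewrite subnKC// -ltnS -size_s'.
have k0 : (0 < k)%N.
  rewrite lt0n; apply/eqP => k0; move: bs; rewrite -nthk k0 -s00.
  by rewrite mem_nth.
have kn : (k.+1 < size s')%N.
  rewrite ltn_neqAle ks' andbT; apply/eqP => kn; move: bs; rewrite -nthk.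
  have -> : k = (size s').-1 by rewrite -kn.
  by rewrite -slast mem_nth// prednK.
case: (take k s') (size_takel (ltnW ks')) s'E sE => [/esym k00|x p _] s'E sE.
  by rewrite k00 in k0.
case: (drop k.+1 s') (size_drop k.+1 s') s'E sE => [/esym/eqP h|c q _] s'E sE.
  by move: h; rewrite subn_eq0 leqNgt kn.
exists (last x p), b, c; split.
- move: ss'; rewrite {1}s'E /= cat_path /= => /and4P[_ h1 h2 _].
  by split.
- rewrite sE; split; first by rewrite mem_cat mem_last.
  by rewrite mem_cat mem_head orbT.
- move=> y; rewrite s'E sE !(mem_cat, in_cons).
  by case: (y == x); case: (y \in p); case: (y == b); rewrite ?orbT.
- by rewrite s'E sE cat_cons cube_gaps_insert cat_cons.
Qed.

Lemma sorted_nth_ltS s j : sorted <%R s -> (j < (size s).-1)%N ->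
  s`_j < s`_j.+1.
Proof.
move=> ss; rewrite ltn_predRL => js.
by rewrite lt_sorted_ltn_nth// inE// ltnW.
Qed.

Lemma cube_gaps_ge0 s : sorted <%R s -> 0 <= cube_gaps s.
Proof.
move=> ss; rewrite /cube_gaps big_mkord; apply: sumr_ge0 => j _.
have js := ltn_ord j.
by rewrite exprn_ge0// subr_ge0 ltW// sorted_nth_ltS.
Qed.

(** One factor of each cube is kept, and the gaps sum to 1. *)
Lemma cube_gaps_le n (s : n.-tuple R) : sorted <%R s -> (2 <= n)%N ->
  s`_0 = 0 -> s`_n.-1 = 1 ->
  cube_gaps s <= \big[Num.max/0]_(0 <= j < n.-1) (s`_j.+1 - s`_j) ^+ 2.
Proof.
move=> ss n2 s0 s1; set M := (X in _ <= X).
rewrite /cube_gaps size_tuple.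
apply: (@le_trans _ _ (\sum_(0 <= j < n.-1) M * (s`_j.+1 - s`_j))).
  apply: ler_sum_nat => j /andP[_ jn]; rewrite exprSr ler_wpM2r//.
    by rewrite subr_ge0 ltW// sorted_nth_ltS// size_tuple.
  apply: (@le_bigmax_seq _ _ _ _ _ j xpredT (fun j => (s`_j.+1 - s`_j) ^+ 2)) => //.
  by rewrite mem_index_iota.
by rewrite -mulr_sumr telescope_sumr// s0 s1 subr0 mulr1.
Qed.

End Refinement.

(** * The flow started from a partition *)

Section FlowAtPartitions.
Context {R : realType} {d} {T : measurableType d} {P : probability T R}.
Variables (X : R -> R -> T -> R) (U : forall n, n.-tuple R) (t : R).
Hypothesis hX : Arratia_flow P X.
Hypothesis hU : nested_partitions U.
Hypothesis t0 : 0 < t.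

Lemma partition_sorted n : (2 <= n)%N -> sorted <%R (U n).
Proof. by case: hU => h _ _ n2; case: (h n n2). Qed.

Lemma partition_first n : (2 <= n)%N -> (U n)`_0 = 0.
Proof. by case: hU => h _ _ n2; case: (h n n2). Qed.

Lemma partition_last n : (2 <= n)%N -> (U n)`_n.-1 = 1.
Proof. by case: hU => h _ _ n2; case: (h n n2). Qed.

Lemma partition_subset n m : (2 <= n)%N -> (n <= m)%N -> {subset U n <= U m}.
Proof.
move=> n2; elim: m => [|m IH]; first by rewrite leqn0 => /eqP n0; rewrite n0 in n2.
rewrite leq_eqVlt => /predU1P[->//|]; rewrite ltnS => nm u /(IH nm).
by case: hU => _ h _; apply: h; exact: leq_trans nm.
Qed.

Lemma partition_itv n u : (2 <= n)%N -> u \in U n -> 0 <= u <= 1.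
Proof.
move=> n2 un; have ss := partition_sorted n n2.
have n0 : (0 < n)%N := ltnW n2.
rewrite -(partition_first n n2) -(partition_last n n2).
have iu : (index u (U n) < n)%N by rewrite -[X in (_ < X)%N](size_tuple (U n)) index_mem.
rewrite -{1 2}(nth_index 0 un); apply/andP; split.
  by rewrite lt_sorted_leq_nth// inE size_tuple.
rewrite lt_sorted_leq_nth// ?inE ?size_tuple ?prednK//.
by rewrite -ltnS prednK.
Qed.

Lemma measurable_flow u s : 0 <= u <= 1 -> 0 <= s -> measurable_fun setT (X u s).
Proof. by case: hX => h _ _ _ _; exact: h. Qed.

Definition flow_values n w := [seq X u t w | u <- U n].

Definition flow_count (A : set R) n w := distinct_sum \1_A (flow_values n w).

Lemma measurable_flow_count A n : (2 <= n)%N -> measurable A ->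
  measurable_fun setT (flow_count A n).
Proof.
move=> n2 mA; apply: measurable_distinct_sum => // u un.
by apply: measurable_flow; [exact: partition_itv un|exact: ltW].
Qed.

Lemma flow_count_ge0 A n w : 0 <= flow_count A n w.
Proof. by apply: distinct_sum_ge0 => v. Qed.

Lemma flow_count_le A n w : flow_count A n w <= n%:R.
Proof.
apply: le_trans (distinct_sum_le_size _ _ _) _.
  by move=> v; rewrite indicE ler0n lern1 leq_b1.
by rewrite size_map size_tuple.
Qed.

Lemma flow_values_subset n m w : (2 <= n)%N -> (n <= m)%N ->
  {subset flow_values n w <= flow_values m w}.
Proof.
move=> n2 nm _ /mapP[u un ->]; apply/mapP; exists u => //.
exact: partition_subset un.
Qed.

Lemma flow_count_nondecreasing A n m w : (2 <= n)%N -> (n <= m)%N ->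
  flow_count A n w <= flow_count A m w.
Proof. by move=> n2 nm; apply: le_distinct_sum => //; exact: flow_values_subset. Qed.

Variable A : set R.
Hypothesis mA : measurable A.
Hypothesis finA : (lebesgue_measure A < +oo)%E.

Let K := gauss_peak t ^+ 2 / t.
Let L := fine (lebesgue_measure A).

Lemma flow_coalescing_bound a b c : 0 <= a -> a < b -> b < c -> c <= 1 ->
  (P [set w | X a t w <> X b t w /\ X b t w <> X c t w /\ A (X b t w)]
   <= (K * ((b - a) * (c - b) * (c - a)) * L)%:E)%E.
Proof.
move=> a0 ab bc c1; have b0 := le_trans a0 (ltW ab); have b1 := le_trans (ltW bc) c1.
have a1 := le_trans (ltW ab) b1; have c0 := le_trans b0 (ltW bc).
case: hX => mX _ _ _ law.
have := coalescing_bound t a b c t0 ab bc d T P (fun i => X [:: a; b; c]`_i) A.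
apply => //.
- by apply: law; rewrite /= ?ab ?bc ?a0 ?b0 ?c0 ?a1 ?b1 ?c1.
- by case=> [|[|[|i]]]//= _; apply: mX; rewrite ?a0 ?b0 ?c0 ?a1 ?b1 ?c1// ltW.
Qed.

Lemma expected_count_step n : (2 <= n)%N ->
  (\int[P]_w (flow_count A n.+1 w)%:E <= \int[P]_w (flow_count A n w)%:E
    + (K / 3 * (cube_gaps (U n) - cube_gaps (U n.+1)) * L)%:E)%E.
Proof.
move=> n2; have n2' : (2 <= n.+1)%N by exact: leqW.
have [|||||||a [b [c [[ab bc] [an cn] mem_insert ->]]]] :=
  refinement_insert (U n) (U n.+1).
- by rewrite size_tuple ltnW.
- exact: partition_sorted.
- exact: partition_sorted.
- by rewrite !size_tuple.
- exact: partition_subset.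
- by rewrite !partition_first.
- by rewrite !size_tuple !partition_last.
have /andP[a0 _] := partition_itv n a n2 an.
have /andP[_ c1] := partition_itv n c n2 cn.
have -> : K / 3 * (cube_gaps (U n) - (cube_gaps (U n)
    - 3 * ((b - a) * (c - b) * (c - a)))) * L
  = K * ((b - a) * (c - b) * (c - a)) * L by field.
pose S := [set w | X a t w <> X b t w /\ X b t w <> X c t w /\ A (X b t w)].
have mX u : 0 <= u -> u <= 1 -> measurable_fun setT (X u t).
  by move=> u0 u1; apply: measurable_flow; rewrite ?u0// ltW.
have b0 := le_trans a0 (ltW ab); have b1 := le_trans (ltW bc) c1.
have mXa := mX a a0 (le_trans (ltW ab) b1).
have mXb := mX b b0 b1; have mXc := mX c (le_trans b0 (ltW bc)) c1.
have mS : measurable S.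
  apply: measurableI; first exact: measurableC (measurable_set_eq _ _ mXa mXb).
  apply: measurableI; first exact: measurableC (measurable_set_eq _ _ mXb mXc).
  by rewrite -[X in measurable X]setTI; exact: mXb.
apply: (@le_trans _ _
    (\int[P]_w ((flow_count A n w)%:E + (\1_S w)%:E))%E); last first.
  rewrite ge0_integralD//.
  - rewrite leeD2l// integral_indic// setIT.
    exact: flow_coalescing_bound.
  - by move=> w _; rewrite lee_fin flow_count_ge0.
  - by apply/measurable_EFinP; exact: measurable_flow_count.
  - by apply/measurable_EFinP; exact: measurable_indic.
apply: le_lower_integral => w; first by rewrite lee_fin flow_count_ge0.
rewrite -EFinD lee_fin.
apply: le_trans (distinct_sum_insert _ (X a t w) (X b t w) (X c t w)
  (flow_values n w) _ _ _ _ _) _ => //.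
- exact: map_f.
- exact: map_f.
- exact: (eq_mem_map (fun u => X u t w) mem_insert).
rewrite lerD2l !indicE; case: (boolP (X b t w \in A)) => [/set_mem Xb|_].
  rewrite mulr1 ler_nat; case: (boolP (_ && _)) => // /andP[/eqP h1 /eqP h2].
  by rewrite mem_set.
by rewrite mulr0.
Qed.

Lemma expected_count_refine n m : (2 <= n)%N -> (n <= m)%N ->
  (\int[P]_w (flow_count A m w)%:E <= \int[P]_w (flow_count A n w)%:E
    + (K / 3 * (cube_gaps (U n) - cube_gaps (U m)) * L)%:E)%E.
Proof.
move=> n2; elim: m => [|m IH]; first by rewrite leqn0 => /eqP n0; rewrite n0 in n2.
rewrite leq_eqVlt => /predU1P[<-|]; first by rewrite subrr mulr0 mul0r adde0.
rewrite ltnS => nm; apply: le_trans (expected_count_step m (leq_trans n2 nm)) _.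
apply: le_trans (leeD2r _ (IH nm)) _; rewrite -addeA -EFinD.
rewrite leeD2l// lee_fin -mulrDl -mulrDr.
by rewrite [X in _ / 3 * X](_ : _ = cube_gaps (U n) - cube_gaps (U m.+1))//; ring.
Qed.

(** Dropping the nonnegative [cube_gaps (U m)] makes the bound uniform in [m], as needed for the
    limit. *)
Lemma expected_count_bound n m : (2 <= n)%N -> (n <= m)%N ->
  (\int[P]_w (flow_count A m w)%:E <= \int[P]_w (flow_count A n w)%:E
    + (K / 3 * \big[Num.max/0]_(0 <= j < n.-1) ((U n)`_j.+1 - (U n)`_j) ^+ 2
        * L)%:E)%E.
Proof.
move=> n2 nm; apply: le_trans (expected_count_refine n m n2 nm) _.
have K0 : 0 <= K by rewrite divr_ge0 ?exprn_ge0 ?ltW ?gauss_peak_gt0.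
rewrite leeD2l// lee_fin; apply: ler_wpM2r; first exact: fine_ge0.
apply: ler_wpM2l; first exact: divr_ge0.
have Qm := cube_gaps_ge0 (U m) (partition_sorted m (leq_trans n2 nm)).
rewrite lerBlDr; apply: le_trans (cube_gaps_le n (U n) (partition_sorted n n2)
  n2 (partition_first n n2) (partition_last n n2)) _.
by rewrite lerDl.
Qed.

End FlowAtPartitions.

(** * From partition points to the whole range *)

Section FlowRange.
Context {R : realType} {d} {T : measurableType d} {P : probability T R}.
Variables (X : R -> R -> T -> R) (U : forall n, n.-tuple R) (t : R).
Hypothesis hX : Arratia_flow P X.
Hypothesis hU : nested_partitions U.
Hypothesis t0 : 0 < t.

Local Notation values := (flow_values X U t).
Local Notation count := (flow_count X U t).

(** Once the mesh is below [v - u], the first partition point beyond [u] is still below [v], because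
    its predecessor is at most [u]. *)
Lemma partition_dense u v : 0 <= u -> u < v -> v <= 1 ->
  exists m x, [/\ (2 <= m)%N, x \in U m & u < x < v].
Proof.
move=> u0 uv v1; have vu : 0 < v - u by rewrite subr_gt0.
case: (hU) => _ _ /cvgrPdist_lt/(_ _ vu)[N _ mesh].
pose m := maxn N 2; have m2 : (2 <= m)%N by rewrite leq_maxr.
have := mesh m (leq_maxl _ _); rewrite /= sub0r normrN => /ltr_normlW {}mesh.
have sz := size_tuple (U m).
pose i := find (fun x => u < x) (U m).
have hi : has (fun x => u < x) (U m).
  apply/hasP; exists 1; last exact: lt_le_trans v1.
  by rewrite -(partition_last U hU m m2) mem_nth// sz prednK// ltnW.
have im : (i < m)%N by rewrite -[X in (_ < X)%N]sz -has_find.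
have ui : u < (U m)`_i := nth_find 0 hi.
have i0 : (0 < i)%N.
  rewrite lt0n; apply/eqP => i0; move: ui.
  by rewrite i0 (partition_first U hU m m2) ltNge u0.
have ui1 : (U m)`_i.-1 <= u.
  rewrite leNgt; apply/negP => h.
  have : (i.-1 < i)%N by rewrite prednK.
  by move/(before_find 0) => /=; rewrite h.
exists m, (U m)`_i; split => //; first by rewrite mem_nth// sz.
rewrite ui/=; have : (U m)`_i - (U m)`_i.-1 < v - u.
  apply: le_lt_trans mesh; rewrite -{1}(prednK i0).
  apply: (@le_bigmax_seq _ _ _ _ _ i.-1 xpredT (fun j => (U m)`_j.+1 - (U m)`_j)) => //.
  by rewrite mem_index_iota/= -ltnS !prednK// ltnW.
by move: ui1; lra.
Qed.

Lemma seq_isolated (y : R) (l : seq R) :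
  exists2 e, 0 < e & forall x, x \in l -> x != y -> e <= `|x - y|.
Proof.
elim: l => [|x l [e e0 he]]; first by exists 1.
have [->|xy] := eqVneq x y.
  exists e => // z; rewrite in_cons => /predU1P[->|/he//].
  by rewrite eqxx.
exists (Num.min e `|x - y|); first by rewrite lt_min e0 normr_gt0 subr_eq0.
move=> z; rewrite in_cons ge_min => /predU1P[->|zl zy]; first by rewrite lexx orbT.
by rewrite he.
Qed.

(** Bounded counts mean that from some [m] on no new partition value appears in a window around [y].
    The finitely many values already there stay away from [y] unless equal to it, while
    right-continuity produces partition values arbitrarily close to [y]; so [y] is one of them. *)
Lemma flow_value_reached w u :
  (forall v, 0 <= v < 1 -> X x t w @[x --> v^'+] --> X v t w) ->
  (forall M : nat, exists B : R, forall m, (2 <= m)%N ->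
     count `[- M%:R, M%:R] m w <= B) ->
  0 <= u <= 1 -> exists m, (2 <= m)%N /\ X u t w \in values m w.
Proof.
move=> rc fin /andP[u0 u1]; have [u1'|u1'] := ltP u 1; last first.
  (* The end point 1 has no right neighbourhood in the unit interval, but belongs to every
     partition. *)
  have -> : u = 1 by apply/eqP; rewrite eq_le u1.
  exists 2%N; split => //; apply/mapP; exists 1 => //.
  by rewrite -(partition_last U hU 2 isT) mem_nth// size_tuple.
apply: contrapT => notin; pose y := X u t w.
pose M := (Num.bound `|y|).+1.
have yM : `|y| + 1 <= M%:R.
  by rewrite -natr1 lerD2r ltW// archi_boundP.
have [B hB] := fin M; set A := `[- M%:R, M%:R]%classic in hB.
(* The count cannot gain 1 infinitely often without exceeding [B]. *)
have [m [m2 mmax]] : exists m, (2 <= m)%N /\ forall m', (m <= m')%N ->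
    ~ (count A m w + 1 <= count A m' w).
  apply: contrapT => nomax.
  have next m : (2 <= m)%N -> exists m', (m <= m')%N /\ count A m w + 1 <= count A m' w.
    move=> m2; apply: contrapT => h; apply: nomax; exists m; split => // m' mm' hm'.
    by apply: h; exists m'.
  have many k : exists m, (2 <= m)%N /\ k%:R <= count A m w.
    elim: k => [|k [m [m2 km]]]; first by exists 2%N; rewrite flow_count_ge0.
    have [m' [mm' h]] := next m m2; exists m'; split; first exact: leq_trans mm'.
    by apply: le_trans h; rewrite -natr1 lerD2r.
  have [m [m2 hm]] := many (Num.bound `|B|).+1.
  have := le_lt_trans (le_trans hm (hB m m2)) (le_lt_trans (ler_norm B)
    (archi_boundP (normr_ge0 B))).
  by rewrite ltr_nat ltnNge leqnSn.
have inm v m' : (2 <= m')%N -> A v -> v \in values m' w -> v \in values m w.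
  move=> m'2 Av vm'; apply: contrapT => /negP vm.
  apply: (mmax (maxn m m')); first exact: leq_maxl.
  have vin : v \in values (maxn m m') w.
    by apply: flow_values_subset vm' => //; exact: leq_maxr.
  have sub := flow_values_subset X U t hU m (maxn m m') w m2 (leq_maxl _ _).
  apply: (@le_trans _ _ (distinct_sum \1_A (v :: values m w))).
    by rewrite distinct_sum_cons vm mul1r indicE mem_set// addrC.
  by apply: le_distinct_sum => // z; rewrite in_cons => /predU1P[->|/sub].
have [e e0 he] := seq_isolated y (values m w).
(* The cap 1 keeps the approximating value inside the window, whose radius [M] is at least
   [|y| + 1]. *)
pose e' := Num.min e 1; have e'0 : 0 < e' by rewrite lt_min e0 ltr01.
have u01 : 0 <= u < 1 by rewrite u0.
have /cvgrPdist_lt/(_ _ e'0) := rc u u01.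
rewrite near_withinE => /nbhs_ballP[r /= r0 hr].
have uv : u < Num.min (u + r) 1 by rewrite lt_min ltrDl r0.
have v1 : Num.min (u + r) 1 <= 1 by rewrite ge_min lexx orbT.
have [m' [x [m'2 xm' /andP[ux]]]] := partition_dense _ _ u0 uv v1.
rewrite lt_min => /andP[xr x1].
have := hr x; rewrite /ball/= distrC gtr0_norm ?subr_gt0// ltrBlDl => /(_ xr ux).
rewrite -/y lt_min distrC => /andP[xe xy1].
have xval : X x t w \in values m' w by apply/mapP; exists x.
have xM : A (X x t w).
  rewrite /A/= in_itv/= -ler_norml.
  by have := ler_normD y (X x t w - y); rewrite addrC subrK; move: xy1 yM; lra.
have xin := inm _ _ m'2 xM xval.
have [xy|xy] := eqVneq (X x t w) y.
  by apply: notin; exists m; rewrite -/y -xy.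
by have := he _ xin xy; rewrite leNgt xe.
Qed.

Definition flow_range_sum (f : R -> R) (w : T) : \bar R :=
  \esum_(v in [set X u t w | u in `[0, 1]]) (f v)%:E.

Lemma flow_range_sum_ge0 f w : (forall v, 0 <= f v) -> (0 <= flow_range_sum f w)%E.
Proof. by move=> f0; apply: esum_ge0 => v _; rewrite lee_fin. Qed.

Lemma flow_count_le_range A n w : (2 <= n)%N ->
  ((count A n w)%:E <= flow_range_sum \1_A w)%E.
Proof.
move=> n2; apply: esum_ge; exists [set` undup (values n w)].
  split; first exact: finite_seq.
  move=> v /=; rewrite mem_undup => /mapP[u un ->]; exists u => //=.
  by rewrite in_itv/=; exact: partition_itv un.
by rewrite -fsbig_seq ?undup_uniq// sumEFin.
Qed.

(** The index is shifted by 2 because [U n] is a partition only from [n = 2] on. *)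
Let count2 A m w : \bar R := (count A m.+2 w)%:E.

Lemma count2_nondecreasing A w : nondecreasing_seq (fun m => count2 A m w).
Proof.
by move=> m m' mm'; rewrite lee_fin flow_count_nondecreasing// !ltnS.
Qed.

(** A sum over the range is a supremum over finite subsets, and the partitions being nested, each
    finite set of reached values is contained in a single [values m w]. *)
Lemma range_le_lim_count A w :
  (forall u, 0 <= u <= 1 -> exists m, (2 <= m)%N /\ X u t w \in values m w) ->
  (flow_range_sum \1_A w <= limn (fun m => count2 A m w))%E.
Proof.
move=> reach; apply: ge_ereal_sup => _ [F [/finite_seqP[l ->] lX] <-].
have -> : [set` l] = [set` undup l].
  by apply/seteqP; split => v /=; rewrite mem_undup.
rewrite -fsbig_seq ?undup_uniq// sumEFin.
have {lX} lX v : v \in l -> exists m, (2 <= m)%N /\ v \in values m w.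
  by move=> /lX[u]; rewrite /= in_itv/= => u01 <-; exact: reach.
have [m [m2 lm]] : exists m, (2 <= m)%N /\ {subset l <= values m w}.
  elim: l lX => [|v l IH] lX; first by exists 2%N.
  have [|m [m2 lm]] := IH; first by move=> z zl; apply: lX; rewrite in_cons zl orbT.
  have [m' [m'2 vm']] := lX v (mem_head _ _).
  exists (maxn m m'); split; first by rewrite leq_max m2.
  move=> z; rewrite in_cons => /predU1P[->|/lm].
    exact: (flow_values_subset X U t hU m' _ w m'2 (leq_maxr _ _) v vm').
  exact: (flow_values_subset X U t hU m _ w m2 (leq_maxl _ _)).
apply: (@le_trans _ _ (count2 A m.-2 w)).
  have -> : count2 A m.-2 w = (count A m w)%:E by case: m m2 {lm} => [|[|m]].
  by rewrite lee_fin; exact: le_distinct_sum.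
apply: lime_ge; first exact/ereal_nondecreasing_is_cvgn/count2_nondecreasing.
by exists m.-2 => // k /= mk; exact: count2_nondecreasing.
Qed.

Lemma measurable_lim_count A : measurable A ->
  measurable_fun setT (fun w => limn (fun m => count2 A m w)).
Proof.
move=> mA; apply: (emeasurable_fun_cvg (count2 A)).
  by move=> m; apply/measurable_EFinP; exact: (measurable_flow_count X U t hX hU t0).
move=> w _; exact/ereal_nondecreasing_is_cvgn/count2_nondecreasing.
Qed.

Let K := gauss_peak t ^+ 2 / t.
Let mesh2 n := \big[Num.max/0]_(0 <= j < n.-1) ((U n)`_j.+1 - (U n)`_j) ^+ 2.

Lemma integral_lim_count A n : measurable A -> (lebesgue_measure A < +oo)%E ->
  (2 <= n)%N ->
  (\int[P]_w limn (fun m => count2 A m w) <= \int[P]_w (count A n w)%:E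
    + (K / 3 * mesh2 n * fine (lebesgue_measure A))%:E)%E.
Proof.
move=> mA finA n2; rewrite monotone_convergence//.
- apply: lime_le.
    apply: ereal_nondecreasing_is_cvgn => m m' mm'; apply: ge0_le_integral => //.
    + by move=> w _; rewrite lee_fin flow_count_ge0.
    + by apply/measurable_EFinP; exact: (measurable_flow_count X U t hX hU t0).
    + by apply/measurable_EFinP; exact: (measurable_flow_count X U t hX hU t0).
    + by move=> w _; exact: count2_nondecreasing.
  exists n => // m /= nm.
  by apply: (expected_count_bound X U t hX hU t0) => //; exact: leqW (leqW nm).
- by move=> m; apply/measurable_EFinP; exact: (measurable_flow_count X U t hX hU t0).
- by move=> m w _; rewrite lee_fin flow_count_ge0.
- by move=> w _; exact: count2_nondecreasing.
Qed.

Lemma integral_count_le A n : (2 <= n)%N -> measurable A ->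
  (\int[P]_w (count A n w)%:E <= n%:R%:E)%E.
Proof.
move=> n2 mA; have -> : (n%:R%:E = \int[P]_w n%:R%:E :> \bar R)%E.
  rewrite integral_cst// [X in (_ * X)%E](_ : _ = 1%E) ?mule1//.
  exact: probability_setT.
apply: le_lower_integral => w; rewrite lee_fin ?flow_count_ge0//.
exact: flow_count_le.
Qed.

(** The bound for partitions alone makes the limit of the counts integrable, hence almost surely
    finite, in each of the countably many windows. The range is not involved, so the argument is not
    circular. *)
Lemma flow_count_ae_bounded : {ae P, forall w, forall M : nat,
  exists B : R, forall m, (2 <= m)%N -> count `[- M%:R, M%:R] m w <= B}.
Proof.
apply: ae_foralln => M; set A := `[- M%:R, M%:R]%classic.
have mA : measurable A by exact: measurable_itv.
have finA : (lebesgue_measure A < +oo)%E.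
  by rewrite lebesgue_measure_itv/=; case: ifP => _; rewrite -?EFinB ltry.
have ge0 w : (0 <= limn (fun m => count2 A m w))%E.
  apply: lime_ge; first exact/ereal_nondecreasing_is_cvgn/count2_nondecreasing.
  by exists 0%N => // m _ /=; rewrite lee_fin flow_count_ge0.
have int : P.-integrable setT (fun w => limn (fun m => count2 A m w)).
  apply/integrableP; split; first exact: measurable_lim_count.
  under eq_integral do rewrite gee0_abs//.
  apply: le_lt_trans (integral_lim_count A 2 mA finA isT) _.
  apply: le_lt_trans (leeD2r _ (integral_count_le A 2 isT mA)) _.
  by rewrite -EFinD ltry.
have := integrable_ae measurableT int; apply: filterS => w /(_ I) fin.
exists (fine (limn (fun m => count2 A m w))) => m m2.
rewrite -lee_fin fineK//.
apply: lime_ge; first exact/ereal_nondecreasing_is_cvgn/count2_nondecreasing.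
exists m => // k /= mk; rewrite lee_fin; apply: flow_count_nondecreasing => //.
exact: leqW (leqW mk).
Qed.

(** The lower bound holds pointwise. For the upper one the range sum is dominated almost surely by
    the measurable limit of the counts. *)
Lemma expected_range_sum A n : measurable A -> (lebesgue_measure A < +oo)%E ->
  (2 <= n)%N ->
  (\int[P]_w (count A n w)%:E <= \int[P]_w flow_range_sum \1_A w
   <= \int[P]_w (count A n w)%:E
      + (K / 3 * mesh2 n * fine (lebesgue_measure A))%:E)%E.
Proof.
move=> mA finA n2; apply/andP; split.
  apply: le_lower_integral => w; first by rewrite lee_fin flow_count_ge0.
  exact: flow_count_le_range.
apply: le_trans (integral_lim_count A n mA finA n2).
apply: le_lower_integral_ae.
- by move=> w; apply: flow_range_sum_ge0.
- move=> w; apply: lime_ge.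
    exact/ereal_nondecreasing_is_cvgn/count2_nondecreasing.
  by exists 0%N => // m _ /=; rewrite lee_fin flow_count_ge0.
- exact: measurable_lim_count.
- case: hX => _ _ _ rc _; move: rc flow_count_ae_bounded.
  apply: filterS2 => w rc bd; apply: range_le_lim_count => u u01.
  apply: flow_value_reached => // v v01.
  by apply: rc => //; exact: ltW.
Qed.

End FlowRange.

(** * Coalescence schemes *)

Section SchemeCombinatorics.
Context {R : realType}.
Implicit Types (vs : seq R) (z : seq (R -> R)) (t : R).

(** The first repeated value has another occurrence further right, so it is not the last entry. This
    puts the index, counted from 1, into the range required by [schemes]. *)
Lemma first_repeated_ltn vs : ~~ uniq vs -> ((first_repeated vs).+1 < size vs)%N.
Proof.
move=> nuniq; set p := fun x => (1 < count_mem x vs)%N.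
have hp : has p vs.
  apply: contraR nuniq => /hasPn np; apply: count_mem_uniq => x.
  case: (boolP (x \in vs)) => [xvs|/count_memPn->//].
  have := np x xvs; rewrite -leqNgt => c1.
  by apply/eqP; rewrite eqn_leq c1/= -has_count has_pred1.
set j := first_repeated vs; have jvs : (j < size vs)%N by rewrite -has_find.
pose x := nth 0 vs j; have px : p x := nth_find 0 hp.
have vsE : vs = take j vs ++ x :: drop j.+1 vs by rewrite -drop_nth// cat_take_drop.
have xtake : x \notin take j vs.
  apply/negP => xt; have i_j : (index x (take j vs) < j)%N.
    by rewrite -[X in (_ < X)%N](size_takel (ltnW jvs)) index_mem.
  have := before_find 0 i_j; rewrite -(nth_take 0 i_j) nth_index//=.
  by move=> h; move: px; rewrite /p h.
move: px; rewrite /p [X in count _ X]vsE count_cat (count_memPn xtake) /= eqxx add0n add1n ltnS.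
rewrite -has_count has_pred1 => xd; rewrite -subn_gt0 -size_drop.
by case: (drop _ _) xd.
Qed.

(** The Vandermonde product. It turns a collision among several paths into a zero of one continuous
    function, to which [inf_zero] and the hitting events apply. *)
Fixpoint differences vs : R :=
  if vs is v :: vs' then (\prod_(y <- vs') (v - y)) * differences vs' else 1.

Lemma differences_eq0 vs : (differences vs == 0) = ~~ uniq vs.
Proof.
elim: vs => [|v vs IH] /=; first by rewrite oner_eq0.
rewrite mulf_eq0 IH negb_and negbK; congr (_ || _).
rewrite prodf_seq_eq0; apply/hasP/idP => [[y yvs]|vvs].
  by rewrite /= subr_eq0 => /eqP ->.
by exists v => //=; rewrite subrr.
Qed.

Definition path_continuous (f : R -> R) := {within `[0, +oo[, continuous f}.

Lemma differences_continuous z : {in z, forall f, path_continuous f} ->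
  path_continuous (fun s => differences [seq f s | f <- z]).
Proof.
have cst1 : path_continuous (fun=> 1) by move=> x; exact: cvg_cst.
elim: z => [|f z IH] cz //=.
have cf : path_continuous f by apply: cz; rewrite mem_head.
apply: path_continuousM; last by apply: IH => g gz; apply: cz; rewrite in_cons gz orbT.
elim: z cz {IH} => [|g z IH] cz /=.
  by apply: (eq_within_continuous _ (fun=> 1)) => // s _; rewrite big_nil.
apply: (eq_within_continuous _ (fun s => (f s - g s) *
    \prod_(y <- [seq h s | h <- z]) (f s - y))) => [s _|]; first by rewrite big_cons.
apply: path_continuousM.
  by apply: path_continuousB => //; apply: cz; rewrite !in_cons eqxx orbT.
apply: IH => h; rewrite in_cons => /predU1P[->|hz]; first exact: cf.
by apply: cz; rewrite !in_cons hz !orbT.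
Qed.

Lemma collision_timeE t z : collision_time t z =
  inf [set s | 0 <= s <= t /\ differences [seq f s | f <- z] = 0].
Proof.
congr inf; apply/seteqP; split => s /= [st].
  by rewrite -differences_eq0 => /eqP.
by move=> e; rewrite -differences_eq0 e eqxx.
Qed.

Lemma collision_timeP t z s : {in z, forall f, path_continuous f} ->
  0 <= s <= t -> ~~ uniq [seq f s | f <- z] ->
  let tau := collision_time t z in
  [/\ 0 <= tau <= t, ~~ uniq [seq f tau | f <- z] & tau <= s].
Proof.
move=> cz st nu tau; rewrite /tau collision_timeE.
have cd := differences_continuous z cz.
have dz : differences [seq f s | f <- z] = 0.
  by apply/eqP; rewrite differences_eq0.
have [|h1 h2 h3] := inf_zero _ t cd; first by exists s.
by split => //; [rewrite -differences_eq0; apply/eqP|exact: h3].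
Qed.

(** The inequality is an invariant: deleting a path lowers [r] and the size by one and cannot
    increase the number of distinct values. While [r] is positive, it forces a repeated value at
    time [t], hence a collision to process. *)
Lemma scheme_steps_in t r z : 0 <= t -> {in z, forall f, path_continuous f} ->
  (r + size (undup [seq f t | f <- z]) <= size z)%N ->
  scheme_steps t r z \in schemes (size z) r.
Proof.
move=> t0; elim: r z => [|r IH] z cz rz; first by rewrite mem_head.
have nu : ~~ uniq [seq f t | f <- z].
  apply/negP => /undup_id e; move: rz; rewrite e size_map addSn.
  by rewrite ltnNge leq_addl.
have [|_ nutau _] := collision_timeP t z t cz _ nu; first by rewrite t0 lexx.
have := first_repeated_ltn _ nutau; rewrite size_map => /=.
set j := first_repeated _ => jz.
have sz' : size (take j z ++ drop j.+1 z) = (size z).-1.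
  rewrite size_cat size_take size_drop (ltnW jz) subnS.
  by rewrite -subn1 addnBA ?subn_gt0 ?(ltnW jz)// subnKC ?subn1// ltnW// ltnW.
apply/allpairsP; exists (j.+1, scheme_steps t r (take j z ++ drop j.+1 z)).
split => //=; first by rewrite mem_iota/= add1n prednK// (leq_trans _ jz).
rewrite -sz'; apply: IH.
  move=> f; rewrite mem_cat => /orP[/mem_take|/mem_drop]; exact: cz.
rewrite sz'.
have : (size (undup [seq f t | f <- take j z ++ drop j.+1 z])
    <= size (undup [seq f t | f <- z]))%N.
  apply: uniq_leq_size; first exact: undup_uniq.
  move=> v; rewrite !mem_undup => /mapP[f]; rewrite mem_cat => fz ->.
  by apply: map_f; case/orP: fz => [/mem_take|/mem_drop].
rewrite -(leq_add2l r) => /leq_trans; apply.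
by rewrite -ltnS prednK ?(leq_trans (ltn0Sn _) jz)// -addSn.
Qed.

Lemma schemes_size n r J : J \in schemes n r -> size J = r.
Proof.
elim: r n J => [|r IH] n J /=; first by rewrite inE => /eqP ->.
by move=> /allpairsP[[j J'] /= [_ J'in ->]] /=; rewrite (IH _ _ J'in).
Qed.

Lemma schemes_uniq n r : uniq (schemes n r).
Proof.
elim: r n => [|r IH] n //=; apply: allpairs_uniq => //; first exact: iota_uniq.
by move=> [j J] [j' J'] _ _ /= [-> ->].
Qed.

(** The length [n - l] of a collection determines [l], and [schemes] has no duplicates, so [S] is
    met exactly once in the double sum. *)
Lemma sum_schemes n l0 (S : seq nat) : (1 <= l0 <= n)%N ->
  S \in schemes n (n - l0) ->
  \sum_(1 <= l < n.+1) \sum_(J <- schemes n (n - l)) (S == J)%:R = 1 :> R.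
Proof.
move=> /andP[l1 ln] Sin.
have sumE l : \sum_(J <- schemes n (n - l)) (S == J)%:R
    = (S \in schemes n (n - l))%:R :> R.
  have := schemes_uniq n (n - l); elim: (schemes n (n - l)) => [|J s IH] /=.
    by rewrite big_nil.
  move=> /andP[Js us]; rewrite big_cons IH// in_cons.
  have [->|_] := eqVneq S J; last by rewrite add0r.
  by rewrite (negbTE Js) addr0.
rewrite (eq_bigr _ (fun l _ => sumE l)) (bigD1_seq l0)/= ?iota_uniq//; last first.
  by rewrite mem_index_iota l1.
rewrite Sin big_seq_cond big1 ?addr0// => l /andP[].
rewrite mem_index_iota ltnS => /andP[_ lln] ll0.
case: (boolP (_ \in _)) => // /schemes_size; rewrite (schemes_size _ _ _ Sin).
by move/eqP; rewrite eqn_sub2lE// eq_sym (negbTE ll0).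
Qed.

End SchemeCombinatorics.

Lemma uniq_map_inj (I : eqType) (J : eqType) (g : I -> J) (l : seq I) :
  uniq (map g l) -> forall i j, i \in l -> j \in l -> g i = g j -> i = j.
Proof.
elim: l => //= k l IH /andP[gk ul] i j; rewrite !in_cons.
move=> /predU1P[->|il] /predU1P[->|jl] // gij; last exact: IH.
  by move: gk; rewrite gij map_f.
by move: gk; rewrite -gij map_f.
Qed.

(** * Measurability of the coalescence scheme *)

Section MeasurableScheme.
Context {R : realType} {d} {T : measurableType d} {K : eqType}.
Variables (Z : K -> R -> T -> R) (t : R).
Hypothesis t0 : 0 <= t.
Implicit Types l : seq K.

Let regular l := forall i, i \in l ->
  (forall r, 0 <= r -> measurable_fun setT (Z i r)) /\
  (forall w, path_continuous (Z i ^~ w)).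

Definition paths l (w : T) : seq (R -> R) := [seq Z i ^~ w | i <- l].

Lemma paths_at l w s : [seq f s | f <- paths l w] = [seq Z i s w | i <- l].
Proof. by rewrite -map_comp. Qed.

Lemma paths_continuous l w : regular l -> {in paths l w, forall f, path_continuous f}.
Proof. by move=> rl _ /mapP[i il ->]; have [] := rl i il. Qed.

Lemma measurable_differences l r : regular l -> 0 <= r ->
  measurable_fun setT (fun w => differences [seq Z i r w | i <- l]).
Proof.
move=> rl r0; elim: l rl => [|i l IH] rl /=; first exact: measurable_cst.
have mi : measurable_fun setT (Z i r) by case: (rl i (mem_head _ _)) => + _; apply.
apply: measurable_funM; last by apply: IH => j jl; apply: rl; rewrite in_cons jl orbT.
elim: l rl {IH} => [|j l IH] rl /=.
  by under eq_fun do rewrite big_nil; exact: measurable_cst.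
under eq_fun do rewrite big_cons.
apply: measurable_funM.
  apply: measurable_funB => //.
  by case: (rl j) => [|+ _]; [rewrite !in_cons eqxx orbT|apply].
apply: IH => k; rewrite in_cons => kl; apply: rl; rewrite !in_cons.
by case/orP: kl => ->; rewrite ?orbT.
Qed.

Definition met_by l s : set T :=
  [set w | exists r, 0 <= r <= s /\ differences [seq Z i r w | i <- l] = 0].

Lemma measurable_met_by l s : regular l -> 0 <= s -> measurable (met_by l s).
Proof.
move=> rl s0.
apply: (measurable_hit (fun r w => differences [seq Z i r w | i <- l])) => //.
  by move=> r r0; exact: measurable_differences.
move=> w; have := differences_continuous _ (paths_continuous l w rl).
by apply: eq_within_continuous => s' _; rewrite paths_at.
Qed.

(* Only rational times occur on the right, which spares the measurability of
   the collision time itself. *)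
Lemma collision_eqP l i j w : regular l -> i \in l -> j \in l -> i != j ->
  met_by l t w ->
  let tau := collision_time t (paths l w) in
  Z i tau w = Z j tau w <->
  met_by [:: i; j] t w /\ forall q : rat, 0 <= (ratr q : R) <= t ->
    met_by l (ratr q : R) w -> met_by [:: i; j] (ratr q : R) w.
Proof.
move=> rl il jl ij [s0 [s0t ds0]] tau.
have met2E s : differences [seq Z k s w | k <- [:: i; j]] = Z i s w - Z j s w.
  by rewrite /= big_seq1 big_nil !mulr1.
have [tau0t nutau _] : [/\ 0 <= tau <= t,
    ~~ uniq [seq f tau | f <- paths l w] & tau <= s0].
  apply: collision_timeP => //; first exact: paths_continuous.
  by rewrite paths_at -differences_eq0 ds0.
have tau_min s : 0 <= s <= t -> differences [seq Z k s w | k <- l] = 0 -> tau <= s.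
  move=> st ds; have [|//] := collision_timeP t (paths l w) s (paths_continuous l w rl) st.
  by rewrite paths_at -differences_eq0 ds.
split=> [Ztau|[[r0 [r0t d0]] hq]].
  have /andP[tau0 taut] := tau0t.
  have hit s : tau <= s -> met_by [:: i; j] s w.
    by move=> taus; exists tau; rewrite tau0 taus met2E Ztau subrr.
  split; first exact: hit.
  move=> q /andP[q0 qt] [r [/andP[r0 rq] dr]]; apply: hit.
  apply: (le_trans (y := r)) => //; apply: tau_min => //.
  by rewrite r0 (le_trans rq qt).
move: d0; rewrite met2E => d0.
have cij : path_continuous (fun s => Z i s w - Z j s w).
  have [[_ ci] [_ cj]] := (rl i il, rl j jl).
  exact: (path_continuousB _ _ (ci w) (cj w)).
have [|tau'0t dtau' tau'_min] := inf_zero _ t cij; first by exists r0.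
set tau' := inf _ in tau'0t dtau' tau'_min.
have pair_zero s : Z i s w - Z j s w = 0 -> differences [seq Z k s w | k <- l] = 0.
  move=> /eqP; rewrite subr_eq0 => /eqP Zij; apply/eqP; rewrite differences_eq0.
  apply/negP => u; move: ij.
  by rewrite (uniq_map_inj _ _ (fun k => Z k s w) l u i j il jl Zij) eqxx.
have tautau' : tau <= tau' by apply: tau_min => //; exact: pair_zero.
have -> : tau = tau'.
  apply/eqP; rewrite eq_le tautau'/= leNgt; apply/negP => lt_tau.
  (* A rational strictly between the first collision of all paths and that of the pair would see the
     former but not the latter. *)
  have [q] := rat_in_itvoo lt_tau; rewrite in_itv/= => /andP[tauq qtau'].
  have /andP[tau0 taut] := tau0t; have /andP[tau'0 tau't] := tau'0t.
  have qt : 0 <= (ratr q : R) <= t by rewrite (le_trans tau0 (ltW tauq)) (le_trans (ltW qtau')).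
  have [|r [/andP[r1 rq]]] := hq q qt.
    exists tau; rewrite tau0 (ltW tauq); split => //.
    by apply/eqP; rewrite differences_eq0 -paths_at.
  rewrite met2E => dr.
  have := tau'_min r _ dr; rewrite r1 (le_trans rq) ?(andP qt).2// => /(_ isT).
  by rewrite leNgt (le_lt_trans rq).
by apply/eqP; rewrite -subr_eq0 dtau'.
Qed.

Lemma measurable_collision_eq l i j : regular l -> i \in l -> j \in l ->
  measurable [set w | let tau := collision_time t (paths l w) in
    Z i tau w = Z j tau w].
Proof.
move=> rl il jl; have [->|ij] := eqVneq i j.
  by rewrite [X in measurable X](_ : _ = setT); last by apply/seteqP; split.
have mi k r : k \in l -> 0 <= r -> measurable_fun setT (Z k r).
  by move=> kl; have [+ _] := rl k kl; apply.
have rij : regular [:: i; j].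
  by move=> k; rewrite !inE => /orP[]/eqP ->; exact: rl.
have mD := measurable_met_by l t rl t0.
pose B (q : rat) := if 0 <= (ratr q : R) <= t
  then ~` met_by l (ratr q) `|` met_by [:: i; j] (ratr q) else setT.
have -> : [set w | let tau := collision_time t (paths l w) in
    Z i tau w = Z j tau w] =
  (met_by l t `&` (met_by [:: i; j] t `&` \bigcap_q B q)) `|`
  (~` met_by l t `&` [set w | Z i 0 w = Z j 0 w]).
  (* Without a collision the infimum is taken over the empty set and equals 0 by convention, so this
     case reduces to equality at time 0. *)
  have off w : ~ met_by l t w -> collision_time t (paths l w) = 0.
    move=> nD; rewrite collision_timeE (_ : [set _ | _] = set0) ?inf0//.
    by apply/seteqP; split => // s /= [st]; rewrite paths_at => ds; apply: nD; exists s.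
  apply/seteqP; split => w /=.
    have [Dw|nDw] := pselect (met_by l t w); last by rewrite (off w nDw); right.
    move=> /(collision_eqP l i j w rl il jl ij Dw)[h1 h2]; left; split => //; split => //.
    move=> q _; rewrite /B; case: ifPn => // qt.
    by have [/(h2 q qt)|] := pselect (met_by l (ratr q : R) w); [right|left].
  move=> [[Dw [h1 h2]]|[nDw]]; last by rewrite (off w nDw).
  apply/(collision_eqP l i j w rl il jl ij Dw); split => // q qt Dq.
  by have := h2 q I; rewrite /B qt => -[].
apply: measurableU; apply: measurableI => //.
- apply: measurableI; first exact: measurable_met_by.
  rewrite -(setCK (\bigcap_q _)) setC_bigcap; apply: measurableC.
  apply: bigcupT_measurable_rat => q; apply: measurableC; rewrite /B.
  case: ifPn => [/andP[q0 _]|_]; last exact: measurableT.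
  by apply: measurableU; [apply: measurableC|]; exact: measurable_met_by.
- exact: measurableC.
- by apply: measurable_set_eq; exact: mi.
Qed.

Lemma measurable_find (A : K -> pred T) l k :
  {in l, forall i, measurable [set w | A i w]} ->
  measurable [set w | find (A ^~ w) l = k].
Proof.
elim: l k => [|i l IH] k mA /=.
  case: k => [|k].
    by rewrite [X in measurable X](_ : _ = setT); last by apply/seteqP; split.
  by rewrite [X in measurable X](_ : _ = set0); last by apply/seteqP; split.
have mi : measurable [set w | A i w] by apply: mA; rewrite mem_head.
have ml : {in l, forall j, measurable [set w | A j w]}.
  by move=> j jl; apply: mA; rewrite in_cons jl orbT.
case: k => [|k].
  rewrite [X in measurable X](_ : _ = [set w | A i w])//.
  by apply/seteqP; split => w /=; case: (A i w).
rewrite [X in measurable X](_ : _ = ~` [set w | A i w] `&` [set w | find (A ^~ w) l = k]).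
  by apply: measurableI; [exact: measurableC|exact: IH].
apply/seteqP; split => w /=; case: (A i w) => //=.
- by move=> [].
- by case.
- by case=> _ ->.
Qed.

Lemma measurable_sum_bool (A : K -> pred T) l :
  {in l, forall i, measurable [set w | A i w]} ->
  measurable_fun setT (fun w => \sum_(i <- l) (A i w)%:R : R).
Proof.
elim: l => [|i l IH] mA.
  by under eq_fun do rewrite big_nil; exact: measurable_cst.
under eq_fun do rewrite big_cons.
apply: measurable_funD; first by apply/measurable_bool_indic/mA/mem_head.
by apply: IH => k kl; apply: mA; rewrite in_cons kl orbT.
Qed.

(** The index depends only on which pairs of paths agree at the collision time, and each of these
    finitely many events is measurable. *)
Lemma measurable_first_repeated l k : regular l ->
  measurable [set w | first_repeated
    [seq f (collision_time t (paths l w)) | f <- paths l w] = k].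
Proof.
move=> rl.
pose eqs i j w := let tau := collision_time t (paths l w) in
  Z i tau w == Z j tau w.
have -> : [set w | first_repeated
    [seq f (collision_time t (paths l w)) | f <- paths l w] = k] =
  [set w | find (fun i => (1 < count (fun j => eqs j i w) l)%N) l = k].
  apply/seteqP; split => w /=; rewrite /first_repeated paths_at find_map;
    rewrite (@eq_find _ _ (fun i => (1 < count (fun j => eqs j i w) l)%N))//;
    by move=> i /=; rewrite count_map.
apply: (measurable_find (fun i w => (1 < count (fun j => eqs j i w) l)%N)) => i il.
have meq : {in l, forall j, measurable [set w | eqs j i w]}.
  move=> j jl; have := measurable_collision_eq l j i rl jl il.
  by congr measurable; apply/seteqP; split => w /= /eqP.
have -> : [set w | (1 < count (fun j => eqs j i w) l)%N] =
  [set w | cst (1 : R) w < \sum_(j <- l) (eqs j i w)%:R].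
  have countE w : count (fun j => eqs j i w) l = (\sum_(j <- l) eqs j i w)%N.
    by rewrite -sum1_count big_mkcond; apply: eq_bigr => j _; case: ifP.
  by apply/seteqP; split => w; rewrite /= /cst countE -natr_sum ltr1n.
apply: measurable_set_lt; first exact: measurable_cst.
exact: (measurable_sum_bool (fun j w => eqs j i w)).
Qed.

(** Where the first deleted index equals [j], the remaining system is indexed by the fixed list
    [take j l ++ drop j.+1 l], so the induction meets no random index list. *)
Lemma measurable_scheme_steps r l J : regular l ->
  measurable [set w | scheme_steps t r (paths l w) = J].
Proof.
elim: r l J => [|r IH] l J rl.
  case: J => [|j J].
    by rewrite [X in measurable X](_ : _ = setT); last by apply/seteqP; split.
  by rewrite [X in measurable X](_ : _ = set0); last by apply/seteqP; split.
case: J => [|[|j] J] /=.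
- by rewrite [X in measurable X](_ : _ = set0); last by apply/seteqP; split.
- by rewrite [X in measurable X](_ : _ = set0); last by apply/seteqP; split.
have -> : [set w | (first_repeated [seq f (collision_time t (paths l w)) | f <- paths l w]).+1
      :: scheme_steps t r (take (first_repeated
           [seq f (collision_time t (paths l w)) | f <- paths l w]) (paths l w) ++
         drop (first_repeated
           [seq f (collision_time t (paths l w)) | f <- paths l w]).+1 (paths l w))
      = j.+1 :: J] =
  [set w | first_repeated [seq f (collision_time t (paths l w)) | f <- paths l w] = j]
  `&` [set w | scheme_steps t r (paths (take j l ++ drop j.+1 l) w) = J].
  apply/seteqP; split => w /=; rewrite /paths map_cat map_take map_drop.
    by case=> ->.
  by move=> [-> ->].
apply: measurableI; first exact: measurable_first_repeated.
by apply: IH => k; rewrite mem_cat => /orP[/mem_take|/mem_drop]; exact: rl.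
Qed.

(** The number of steps is random as well; the event is split according to the number [k] of
    distinct values at time [t], written as a [distinct_sum] of the constant 1. *)
Lemma measurable_scheme l J : regular l ->
  measurable [set w | scheme t (paths l w) = J].
Proof.
move=> rl; rewrite /scheme.
have -> : [set w | scheme_steps t (size (paths l w) -
      size (undup [seq f t | f <- paths l w])) (paths l w) = J] =
  \bigcup_k ([set w | distinct_sum (cst 1) [seq Z i t w | i <- l] = cst (k%:R : R) w] `&`
    [set w | scheme_steps t (size l - k) (paths l w) = J]).
  have sumE w : distinct_sum (cst 1) [seq Z i t w | i <- l] =
      (size (undup [seq f t | f <- paths l w]))%:R :> R.
    by rewrite /distinct_sum paths_at -sum1_size natr_sum.
  apply/seteqP; split => w /=.
    rewrite size_map => SJ; exists (size (undup [seq f t | f <- paths l w])) => //.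
    by split.
  move=> [k _ [h <-]]; move: (etrans (esym (sumE w)) h) => /eqP.
  by rewrite /cst eqr_nat => /eqP ->; rewrite size_map.
apply: bigcup_measurable => k _; apply: measurableI; last exact: measurable_scheme_steps.
apply: measurable_set_eq; last exact: measurable_cst.
apply: measurable_distinct_sum; first exact: measurable_cst.
by move=> i il; case: (rl i il) => + _; apply.
Qed.

End MeasurableScheme.

(** * Densities *)

Section DensityComparison.
Context {R : realType} {d} {T : measurableType d}.
Variable mu : {measure set T -> \bar R}.
Implicit Types (f g : T -> R) (A : set T).

(** Densities are nonnegative only almost everywhere; truncation makes the theorems on nonnegative
    functions applicable. *)
Lemma integral_max0 f : measurable_fun setT f -> {ae mu, forall y, 0 <= f y} ->
  (\int[mu]_y (f y)%:E = \int[mu]_y (Num.max (f y) 0)%:E)%E.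
Proof.
move=> mf f0; apply: ae_eq_integral => //.
- exact/measurable_EFinP.
- by apply/measurable_EFinP/measurable_funTS; apply: measurable_maxr.
- by apply: filterS f0 => y fy _; rewrite max_l.
Qed.

Lemma ae_ge0_integralD f g :
  measurable_fun setT f -> {ae mu, forall y, 0 <= f y} ->
  measurable_fun setT g -> {ae mu, forall y, 0 <= g y} ->
  (\int[mu]_y (f y + g y)%:E = \int[mu]_y (f y)%:E + \int[mu]_y (g y)%:E)%E.
Proof.
move=> mf f0 mg g0; rewrite (integral_max0 f)// (integral_max0 g)//.
have mm (h : T -> R) : measurable_fun setT h -> measurable_fun setT (fun y => (Num.max (h y) 0)%:E : \bar R).
  by move=> mh; apply/measurable_EFinP/measurable_funTS; apply: measurable_maxr.
rewrite -ge0_integralD//; first last.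
- exact: mm.
- by move=> y _; rewrite lee_fin le_max lexx orbT.
- exact: mm.
- by move=> y _; rewrite lee_fin le_max lexx orbT.
apply: ae_eq_integral => //.
- by apply/measurable_EFinP; exact: measurable_funD.
- by apply: emeasurable_funD; exact: mm.
- by apply: filterS2 f0 g0 => y fy gy _; rewrite !max_l.
Qed.

Lemma integral_ge0_eq0 f : measurable_fun setT f -> (forall y, 0 <= f y) ->
  (\int[mu]_y (f y)%:E = 0)%E -> {ae mu, forall y, f y = 0}.
Proof.
move=> mf f0 int0.
have [+ _] := ae_eq_integral_abs mu measurableT
  (f := EFin \o f) ltac:(exact/measurable_EFinP).
rewrite (eq_integral (EFin \o f)); last by move=> y _; rewrite gee0_abs// lee_fin.
by move=> /(_ int0); apply: filterS => y /(_ I)[].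
Qed.

Lemma measurable_indicM A f : measurable A -> measurable_fun setT f ->
  measurable_fun setT (fun y => \1_A y * f y).
Proof. by move=> mA mf; apply: measurable_funM. Qed.

Lemma ae_indicM_ge0 A f : {ae mu, forall y, 0 <= f y} ->
  {ae mu, forall y, 0 <= \1_A y * f y}.
Proof. by apply: filterS => y fy; rewrite mulr_ge0. Qed.

(** Tested on the part of [{g < f}] inside a set of finite measure: the integral of [f] there is
    finite, so that of [g] can be cancelled and the integral of the positive difference is 0. *)
Lemma ae_le_of_integral_le f g : sigma_finite setT mu ->
  measurable_fun setT f -> {ae mu, forall y, 0 <= f y} ->
  measurable_fun setT g -> {ae mu, forall y, 0 <= g y} ->
  (forall A, measurable A -> (mu A < +oo)%E ->
    (\int[mu]_y (\1_A y * f y)%:E < +oo)%E /\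
    (\int[mu]_y (\1_A y * f y)%:E <= \int[mu]_y (\1_A y * g y)%:E)%E) ->
  {ae mu, forall y, f y <= g y}.
Proof.
move=> [F FT Ffin] mf f0 mg g0 fg.
suff : {ae mu, forall y, forall M : nat, F M y -> f y <= g y}.
  apply: filterS => y h; have : setT y by [].
  by rewrite FT => -[M _ FMy]; exact: (h M).
apply: ae_foralln => M; have [mI finI] := Ffin M.
pose A := [set y | g y < f y] `&` F M.
have mA : measurable A by apply: measurableI => //; exact: measurable_set_lt.
have finA : (mu A < +oo)%E.
  by apply: le_lt_trans finI; apply: le_measure; rewrite ?inE//; exact: subIsetr.
have [fin le] := fg A mA finA.
have md : measurable_fun setT (fun y => \1_A y * (f y - g y)).
  by apply: measurable_indicM => //; exact: measurable_funB.
have d0 y : 0 <= \1_A y * (f y - g y).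
  rewrite indicE; case: (boolP (y \in A)) => [/set_mem[gf _]|_]; last by rewrite mul0r.
  by rewrite mul1r subr_ge0 ltW.
have E : (\int[mu]_y (\1_A y * f y)%:E =
    \int[mu]_y (\1_A y * g y)%:E + \int[mu]_y (\1_A y * (f y - g y))%:E)%E.
  rewrite -ae_ge0_integralD//.
  - by apply: eq_integral => y _; rewrite -mulrDr addrC subrK.
  - exact: measurable_indicM.
  - exact: ae_indicM_ge0.
  - exact: aeW.
have b0 : (0 <= \int[mu]_y (\1_A y * g y)%:E)%E.
  rewrite integral_max0//; first by apply: integral_ge0 => y _; rewrite lee_fin le_max lexx orbT.
  exact: measurable_indicM.
  exact: ae_indicM_ge0.
have c0 : (0 <= \int[mu]_y (\1_A y * (f y - g y))%:E)%E.
  by apply: integral_ge0 => y _; rewrite lee_fin.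
have : (\int[mu]_y (\1_A y * (f y - g y))%:E = 0)%E.
  move: fin le; rewrite E; move: b0 c0.
  case: (\int[mu]_y (\1_A y * g y)%:E)%E => [b| |]//;
    case: (\int[mu]_y (\1_A y * (f y - g y))%:E)%E => [c| |]//=.
  rewrite !lee_fin => _ c0 _ cb.
  by congr EFin; apply/eqP; rewrite eq_le c0 andbT -(lerD2l b) addr0.
move=> int0.
have := integral_ge0_eq0 _ md d0 int0.
apply: filterS => y d1 FMy; rewrite leNgt; apply/negP => gf.
move: d1; rewrite indicE mem_set// mul1r => /eqP; rewrite subr_eq0 => /eqP e.
by rewrite e ltxx in gf.
Qed.
End DensityComparison.

#[local] Instance lebesgue_ae_filter {R : realType} :
  Filter (nbhs (almost_everywhere (@lebesgue_measure R))).
Proof. exact: (ae_filter_ringOfSetsType (@lebesgue_measure R)). Qed.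

Section HasDensity.
Context {R : realType} {d} {T : measurableType d}.
Variable P : probability T R.
Local Notation mu := (@lebesgue_measure R).

(** The defining identity, tested with the indicator of the set where [p] is negative, forces this
    set to be null. *)
Lemma density_ge0 S p : is_density P S p ->
  (forall f w, (forall y, 0 <= f y) -> (0 <= S f w)%E) ->
  {ae mu, forall y, 0 <= p y}.
Proof.
move=> [mp hp] S0; pose N := [set y : R | p y < cst 0 y].
have mN : measurable N by apply: measurable_set_lt.
pose q y := \1_N y * - p y.
have q0 y : 0 <= q y.
  rewrite /q indicE; case: (boolP (y \in N)) => [/set_mem yN|_]; last by rewrite mul0r.
  by rewrite mul1r oppr_ge0 ltW.
have mq : measurable_fun setT q by apply: measurable_indicM => //; exact: measurableT_comp.
have : (0 <= \int[mu]_y (\1_N y * p y)%:E)%E.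
  rewrite hp//; first by apply: integral_ge0 => w _; apply: S0 => y.
  by exists 1 => y; rewrite indicE lern1 leq_b1.
have -> : (\int[mu]_y (\1_N y * p y)%:E = \int[mu]_y (- (q y)%:E))%E.
  by apply: eq_integral => y _; rewrite -EFinN /q mulrN opprK.
rewrite integral_ge0N//; last by move=> y _; rewrite lee_fin.
rewrite oppe_ge0 => qle.
have q_int : (\int[mu]_y (q y)%:E = 0)%E.
  by apply/eqP; rewrite eq_le qle integral_ge0// => y _; rewrite lee_fin.
have : {ae mu, forall y, q y = 0} by exact: integral_ge0_eq0.
apply: filterS => y qy; rewrite leNgt.
apply/negP => py; move: qy; rewrite /q indicE mem_set// mul1r => /eqP.
by rewrite oppr_eq0 => /eqP p0; rewrite p0 ltxx in py.
Qed.

(** A form of the density relation restricted to indicators, with measurability and signs recorded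
    so that it is stable under finite sums; [F A w] is the random mass of [A]. *)
Definition count_density (F : set R -> T -> R) (p : R -> R) :=
  [/\ measurable_fun setT p, {ae mu, forall y, 0 <= p y},
      forall A, measurable A -> measurable_fun setT (F A) /\ forall w, 0 <= F A w
    & forall A, measurable A ->
      (\int[mu]_y (\1_A y * p y)%:E = \int[P]_w (F A w)%:E)%E].

Lemma count_density_sum (I : eqType) (s : seq I) (F : I -> set R -> T -> R)
    (p : I -> R -> R) :
  {in s, forall i, count_density (F i) (p i)} ->
  count_density (fun A w => \sum_(i <- s) F i A w) (fun y => \sum_(i <- s) p i y).
Proof.
elim: s => [|i s IH] h.
  split.
  - by under eq_fun do rewrite big_nil; exact: measurable_cst.
  - by apply: aeW => y; rewrite big_nil.
  - move=> A _; split; last by move=> w; rewrite big_nil.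
    by under eq_fun do rewrite big_nil; exact: measurable_cst.
  - move=> A _; under eq_integral do rewrite big_nil mulr0.
    by under [RHS]eq_integral do rewrite big_nil; rewrite !integral0.
have [mp p0 mF E] : count_density (F i) (p i) by apply: h; rewrite mem_head.
have [|mp' p0' mF' E'] := IH; first by move=> j js; apply: h; rewrite in_cons js orbT.
split.
- by under eq_fun do rewrite big_cons; exact: measurable_funD.
- by apply: filterS2 p0 p0' => y y0 y0'; rewrite big_cons addr_ge0.
- move=> A mA; have [mFA FA0] := mF A mA; have [mFA' FA0'] := mF' A mA.
  split; last by move=> w; rewrite big_cons addr_ge0.
  by under eq_fun do rewrite big_cons; exact: measurable_funD.
- move=> A mA; have [mFA FA0] := mF A mA; have [mFA' FA0'] := mF' A mA.
  under eq_integral do rewrite big_cons mulrDr.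
  under [RHS]eq_integral do rewrite big_cons.
  rewrite ae_ge0_integralD//; first last.
  + exact: ae_indicM_ge0.
  + exact: measurable_indicM.
  + exact: ae_indicM_ge0.
  + exact: measurable_indicM.
  rewrite ae_ge0_integralD//; first last.
  + exact: aeW.
  + exact: aeW.
  by rewrite E// E'.
Qed.

End HasDensity.

(** * Summing the densities over coalescence schemes *)

Section SchemeDensities.
Context {R : realType} {d} {T : measurableType d} {P : probability T R}.
Variables (X : R -> R -> T -> R) (U : forall n, n.-tuple R) (t : R).
Hypothesis hX : Arratia_flow P X.
Hypothesis hU : nested_partitions U.
Hypothesis t0 : 0 < t.

Local Notation values := (flow_values X U t).
Local Notation count := (flow_count X U t).

Lemma flow_ae_continuous (l : seq R) : {in l, forall u, 0 <= u <= 1} ->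
  {ae P, forall w, {in l, forall u, path_continuous (fun s => X u s w)}}.
Proof.
elim: l => [|u l IH] l01; first exact: aeW.
have hu : {ae P, forall w, path_continuous (fun s => X u s w)}.
  by case: hX => _ + _ _ _; apply; apply: l01; rewrite mem_head.
have hl : {ae P, forall w, {in l, forall v, path_continuous (fun s => X v s w)}}.
  by apply: IH => v vl; apply: l01; rewrite in_cons vl orbT.
by apply: filterS2 hu hl => w wu wl v; rewrite in_cons => /predU1P[->|/wl].
Qed.

(* Setting all paths to 0 on a null set makes them everywhere continuous. *)
Lemma flow_scheme_measurable n : (2 <= n)%N -> exists S : T -> seq nat,
  (forall J, measurable [set w | S w = J]) /\
  {ae P, forall w, flow_scheme X (U n) t w = S w /\
    S w \in schemes n (n - size (undup (values n w)))}.
Proof.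
move=> n2.
have [N [mN N0 NX]] := flow_ae_continuous (U n) (fun u => partition_itv U hU n u n2).
pose Z u s w := if w \in N then 0 else X u s w.
have ZX w u : ~ N w -> Z u ^~ w = X u ^~ w.
  by move=> wN; apply/funext => s; rewrite /Z memNset.
have cX w u : ~ N w -> u \in (U n : seq R) -> path_continuous (fun s => X u s w).
  by move=> wN un; apply: (contrapT (fun h => wN (NX w h))).
have pathsX w : ~ N w -> paths Z (U n) w = [seq (fun s => X u s w) | u <- U n].
  by move=> wN; apply: eq_map => u; exact: ZX.
have regular u : u \in (U n : seq R) ->
    (forall r, 0 <= r -> measurable_fun setT (Z u r)) /\
    (forall w, path_continuous (Z u ^~ w)).
  move=> un; split=> [r r0|w].
    apply: measurable_fun_ifT => //.
      apply: (measurable_fun_bool true); rewrite setTI.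
      by rewrite [X in measurable X](_ : _ = N)//; apply/seteqP; split => w /=;
        [move/set_mem|move/mem_set].
    by case: hX => + _ _ _ _; apply => //; exact: partition_itv un.
  have [wN|wN] := pselect (N w); last by rewrite ZX//; exact: cX.
  have -> : Z u ^~ w = fun=> 0 by apply/funext => s; rewrite /Z mem_set.
  by move=> x; exact: cvg_cst.
exists (fun w => scheme t (paths Z (U n) w)); split.
  by move=> J; apply: measurable_scheme => //; exact: ltW.
exists N; split => // w /=; apply: contra_notP => wN.
have E : flow_scheme X (U n) t w = scheme t (paths Z (U n) w).
  by rewrite /flow_scheme pathsX.
split => //; rewrite /scheme.
have vE : [seq f t | f <- paths Z (U n) w] = values n w.
  by rewrite pathsX// -map_comp.
have sE : size (paths Z (U n) w) = n by rewrite size_map size_tuple.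
rewrite vE -[in X in _ \in schemes X _]sE -[in X in _ \in schemes _ (X - _)]sE.
apply: scheme_steps_in; first exact: ltW.
  by move=> f /mapP[u un ->]; have [_] := regular u un; apply.
rewrite vE subnK// sE.
by rewrite (leq_trans (size_undup _))// size_map size_tuple.
Qed.

(** Each scheme indicator is replaced by a measurable version, and almost surely exactly one of
    these equals 1, so the summed identities give the full count. *)
Lemma points_count_density n (pJ : seq nat -> R -> R) : (2 <= n)%N ->
  (forall l J, (1 <= l <= n)%N -> J \in schemes n (n - l) ->
     scheme_density P X t (U n) J (pJ J)) ->
  count_density P (fun A => count A n) (points_density n pJ).
Proof.
move=> n2 hpJ; have [S [mS aeS]] := flow_scheme_measurable n n2.
have mcount A : measurable A -> measurable_fun setT (count A n).
  exact: (measurable_flow_count X U t hX hU t0).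
have dJ l J : (1 <= l <= n)%N -> J \in schemes n (n - l) ->
    count_density P (fun A w => count A n w * (S w == J)%:R) (pJ J).
  move=> l1n Jin; have hJ := hpJ l J l1n Jin.
  have mSJ : measurable [set w | S w == J].
    have := mS J; congr measurable; apply/seteqP; split => w /= => [->|/eqP->] //.
  split.
  - by case: hJ.
  - apply: density_ge0 hJ _ => f w f0; rewrite lee_fin mulr_ge0//.
    exact: sumr_ge0.
  - move=> A mA; split; last by move=> w; rewrite mulr_ge0// flow_count_ge0.
    by apply: measurable_funM; [exact: mcount|exact: measurable_bool_indic].
  - move=> A mA; case: hJ => mpJ ->//; last by exists 1 => y; rewrite indicE lern1 leq_b1.
    apply: ae_eq_lower_integral.
    + move=> w; rewrite lee_fin mulr_ge0//; exact: sumr_ge0.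
    + by move=> w; rewrite lee_fin mulr_ge0// flow_count_ge0.
    + apply/measurable_EFinP; apply: measurable_funM; first exact: mcount.
      exact: measurable_bool_indic.
    + by apply: filterS aeS => w [-> _].
have [mp p0 mF E] : count_density P
    (fun A w => \sum_(1 <= l < n.+1) \sum_(J <- schemes n (n - l)) (count A n w * (S w == J)%:R))
    (points_density n pJ).
  apply: count_density_sum => l; rewrite mem_index_iota ltnS => l1n.
  by apply: count_density_sum => J; exact: dJ.
split => // A mA.
  by split; [exact: mcount|move=> w; exact: flow_count_ge0].
have [mFA FA0] := mF A mA.
rewrite E//; apply: ae_eq_lower_integral.
- by move=> w; rewrite lee_fin.
- by move=> w; rewrite lee_fin flow_count_ge0.
- by apply/measurable_EFinP; exact: mcount.
- apply: filterS aeS => w [_ Sin]; congr EFin.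
  (* There is at least one value, so the number of distinct values lies in the summation range,
     which starts at 1. *)
  have l0n : (1 <= size (undup (values n w)) <= n)%N.
    rewrite (leq_trans (size_undup _)) ?size_map ?size_tuple// andbT.
    rewrite -has_predT; apply/hasP; exists (X (U n)`_0 t w) => //.
    by rewrite mem_undup; apply/map_f/mem_nth; rewrite size_tuple ltnW.
  under eq_bigr do rewrite -mulr_sumr.
  by rewrite -mulr_sumr (sum_schemes n _ _ l0n Sin) mulr1.
Qed.

End SchemeDensities.

Theorem theorem3p3 (R : realType) (t : R) (ht : 0 < t <= 1) :
  exists C : R, 0 < C /\
    forall (d : measure_display) (T : measurableType d) (P : probability T R)
      (X : R -> R -> T -> R) (hX : Arratia_flow P X)
      (U : forall n, n.-tuple R) (hU : nested_partitions U)
      (p : R -> R) (hp : flow_density P X t p)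
      (pJ : nat -> seq nat -> R -> R)
      (hpJ : forall n l J, (2 <= n)%N -> (1 <= l <= n)%N ->
         J \in schemes n (n - l) -> scheme_density P X t (U n) J (pJ n J)),
    forall n, (2 <= n)%N ->
      {ae (@lebesgue_measure R), forall y : R,
        0 <= p y - points_density n (pJ n) y
          <= C * \big[Num.max/0]_(0 <= j < n.-1)
                   ((U n)`_j.+1 - (U n)`_j) ^+ 2}.
Proof.
have [t0 _] := andP ht.
have C0 : 0 < gauss_peak t ^+ 2 / t / 3 by rewrite divr_gt0// divr_gt0// exprn_gt0// gauss_peak_gt0.
(* The factor of the three-motion bound, divided by the 3 of the telescoping identity; it depends on
   [t] alone. *)
exists (gauss_peak t ^+ 2 / t / 3); split => //.
move=> d T P X hX U hU p hp pJ hpJ n n2.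
set C := _ / 3 in C0 *; set M := \big[Num.max/0]_(0 <= j < n.-1) _.
have M0 : 0 <= M.
  by rewrite /M; elim/big_ind: _ => // [x y x0 y0|j _]; [rewrite le_max x0|exact: sqr_ge0].
have [mpn pn0 mc En] := points_count_density X U t hX hU t0 n (pJ n) n2
  (fun l J => hpJ n l J n2).
have p0 : {ae @lebesgue_measure R, forall y, 0 <= p y}.
  by apply: density_ge0 hp _ => f w f0; exact: flow_range_sum_ge0.
have [mp Ep] := hp.
have EpA A : measurable A -> (\int[lebesgue_measure]_y (\1_A y * p y)%:E =
    \int[P]_w flow_range_sum X t \1_A w)%E.
  by move=> mA; rewrite Ep//; exists 1 => y; rewrite indicE lern1 leq_b1.
have le1 : {ae @lebesgue_measure R, forall y, points_density n (pJ n) y <= p y}.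
  apply: ae_le_of_integral_le => //; first exact: sigma_finiteT.
  move=> A mA finA; rewrite En// EpA//.
  have /andP[h _] := expected_range_sum X U t hX hU t0 A n mA finA n2.
  split => //.
  exact: le_lt_trans (integral_count_le X U t A n n2 mA) (ltry _).
(* The constant [C * M] is compared as a density: its integral over [A] is the error term [C * M]
   times the measure of [A]. *)
have le2 : {ae @lebesgue_measure R, forall y, p y <= points_density n (pJ n) y + C * M}.
  have CM0 : 0 <= C * M by rewrite mulr_ge0// ltW.
  apply: ae_le_of_integral_le => //; first exact: sigma_finiteT.
  - by apply: measurable_funD => //; exact: measurable_cst.
  - by apply: filterS pn0 => y y0; rewrite addr_ge0.
  move=> A mA finA.
  have /andP[_ h] := expected_range_sum X U t hX hU t0 A n mA finA n2.
  have -> : (\int[lebesgue_measure]_y (\1_A y * (points_density n (pJ n) y + C * M))%:E =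
    \int[P]_w (flow_count X U t A n w)%:E + (C * M * fine (@lebesgue_measure R A))%:E)%E.
    under eq_integral do rewrite mulrDr.
    rewrite ae_ge0_integralD//.
    + rewrite En//; congr (_ + _)%E.
      under eq_integral do rewrite mulrC EFinM.
      rewrite ge0_integralZl_EFin//.
      * by rewrite integral_indic// setIT (EFinM (C * M)) fineK// ge0_fin_numE.
      * by apply/measurable_EFinP.
    + exact: measurable_indicM.
    + exact: ae_indicM_ge0.
    + by apply: measurable_indicM => //; exact: measurable_cst.
    + by apply: aeW => y; rewrite mulr_ge0.
  rewrite EpA//; split => //.
  apply: le_lt_trans h _; apply: le_lt_trans (leeD2r _ (integral_count_le X U t A n n2 mA)) _.
  by rewrite -EFinD ltry.
apply: filterS2 le1 le2 => y h1 h2.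
by rewrite subr_ge0 h1 lerBlDl.
Qed.
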